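(* Given $Q \in SO(3)$, the set $X_{Q,c} \subset X_Q$ is either empty or a contractible connected component of $X_Q$.
   Context: $\mathbb{S}^2 \subset \mathbb{R}^3$ is the unit sphere, $e_1,e_2,e_3$ the canonical basis. A curve $\gamma: [0,1] \to \mathbb{S}^2$ is locally convex if $\det(\gamma(t),\gamma'(t),\gamma''(t)) > 0$ for all $t$. For $Q \in SO(3)$, $X_Q$ is the space of locally convex curves $\gamma: [0,1] \to \mathbb{S}^2$ with $\gamma(0) = e_1$, $\gamma'(0) = c_0 e_2$, $\gamma(1) = Qe_1$, $\gamma'(1) = c_1 Qe_2$ for some $c_0, c_1 > 0$. The topology can be taken to be $C^\infty$, $C^k$ ($k \ge 2$) or Sobolev $H^k$ ($k \ge 2$); the choice is immaterial. For a locally convex $\gamma$, $V_\gamma \subseteq \mathbb{R}^3$ is the closure of the set of all positive linear combinations $a_1\gamma(t_1) + \cdots + a_n\gamma(t_n)$, $a_i > 0$, $t_i \in [0,1]$. The curve $\gamma$ is convex if it is simple (no self-intersections, except that $\gamma(0)=\gamma(1)$ is allowed) and its image is contained in the boundary of $V_\gamma$. $X_{Q,c} \subset X_Q$ is the set of convex curves in $X_Q$. *)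

(* Defs.v *)
From HB Require Import structures.
From mathcomp Require Import all_boot all_order all_algebra.
From mathcomp Require Import all_classical all_reals all_analysis.

Set Implicit Arguments.
Unset Strict Implicit.
Unset Printing Implicit Defensive.

Import Order.TTheory GRing.Theory Num.Theory numFieldNormedType.Exports.
Local Open Scope classical_set_scope.
Local Open Scope ring_scope.

Definition contractible (R : realType) (T : topologicalType) (A : set T) : Prop :=
  exists (a : T) (H : R * T -> T),
    [/\ A a,
        {within `[0, 1]%classic `*` A, continuous H},
        forall s x, s \in `[0, 1] -> A x -> A (H (s, x)),
        forall x, A x -> H (0, x) = x
      & forall x, A x -> H (1, x) = a].

Definition SO3 (R : realType) : set 'M[R]_3 :=
  [set Q | Q^T *m Q = 1%:M /\ \det Q = 1].

Section Curves.
Variable R : realType.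

(* The closed interval as a type, with the subspace topology of R. *)
Definition unitI : Type := set_type (`[0, 1]%classic : set R).
HB.instance Definition _ := Topological.on unitI.

Lemma unitI0_subproof : (0 : R) \in (`[0, 1]%classic : set R).
Proof. by rewrite inE /= in_itv /= lexx ler01. Qed.
Lemma unitI1_subproof : (1 : R) \in (`[0, 1]%classic : set R).
Proof. by rewrite inE /= in_itv /= lexx ler01. Qed.

Definition t0 : unitI := exist _ 0 unitI0_subproof.
Definition t1 : unitI := exist _ 1 unitI1_subproof.

Implicit Types (f gamma : unitI -> 'cV[R]_3) (k : option nat).

(* As s ranges over [0, 1] only, the derivative is one-sided at 0 and 1; it
   is a junk value where the limit does not exist. *)
Definition diff_quot f (t s : unitI) : 'cV[R]_3 :=
  (\val s - \val t)^-1 *: (f s - f t).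

Definition differentiableI f : Prop :=
  forall t : unitI, cvg (diff_quot f t s @[s --> t^']).

Definition derivI f (t : unitI) : 'cV[R]_3 :=
  lim (diff_quot f t s @[s --> t^']).

Definition derivnI (i : nat) f : unitI -> 'cV[R]_3 := iter i derivI f.

(* Smoothness orders: [Some m] stands for C^m and [None] for C^oo. *)
Definition le_order (i : nat) k : bool := if k is Some m then (i <= m)%N else true.

Definition classC k f : Prop :=
  (forall i, le_order i.+1 k -> differentiableI (derivnI i f)) /\
  (forall i, le_order i k -> continuous (derivnI i f)).

(* The C^k topology: the initial topology for the maps sending f to its i-th
   derivative, i <= k, where the target carries uniform convergence.  The
   carrier consists of all functions; the topology is only used on subsets
   of [classC k]. *)
Definition jet k f :
    prod_topology (fun _ : {i : nat | le_order i k} => {uniform unitI -> 'cV[R]_3}) :=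
  fun i => derivnI (sval i) f.

Definition curves k : Type := initial_topology (@jet k).
HB.instance Definition _ k := Topological.on (curves k).

Definition e1 : 'cV[R]_3 := delta_mx 0 0.
Definition e2 : 'cV[R]_3 := delta_mx 1 0.

Definition det3 (u v w : 'cV[R]_3) : R :=
  \det (\matrix_(i < 3, j < 3) [:: u; v; w]`_j i 0).

Definition sphere : set 'cV[R]_3 := [set x | \sum_i x i 0 ^+ 2 = 1].

Definition locally_convex gamma : Prop :=
  forall t, 0 < det3 (gamma t) (derivI gamma t) (derivnI 2 gamma t).

Definition XQ k (Q : 'M[R]_3) : set (curves k) :=
  [set gamma : curves k |
    [/\ classC k gamma,
        forall t, sphere (gamma t),
        locally_convex gamma,
        gamma t0 = e1 /\ (exists2 c0 : R, 0 < c0 & derivI gamma t0 = c0 *: e2)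
      & gamma t1 = Q *m e1 /\
        (exists2 c1 : R, 0 < c1 & derivI gamma t1 = c1 *: (Q *m e2))]].

Definition Vcone gamma : set 'cV[R]_3 :=
  closure [set v | exists (n : nat) (a : 'I_n.+1 -> R) (t : 'I_n.+1 -> unitI),
    (forall i, 0 < a i) /\ v = \sum_i a i *: gamma (t i)].

Definition simple_curve gamma : Prop :=
  forall s t : unitI, \val s < \val t -> gamma s = gamma t -> s = t0 /\ t = t1.

Definition convex_curve gamma : Prop :=
  simple_curve gamma /\
  (forall t, (closure (Vcone gamma) `\` interior (Vcone gamma)) (gamma t)).

Definition XQc k (Q : 'M[R]_3) : set (curves k) :=
  [set gamma : curves k | XQ Q gamma /\ convex_curve gamma].

End Curves.

Arguments XQ {R} k Q.
Arguments XQc {R} k Q.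

(* Main.v *)
(* Write e1, e2, e3 for the standard basis and g = (X, Y, Z) for a curve in X_Q.
   Convexity of g is equivalent to Z > 0 and Y Z' - Z Y' > 0 on the open
   interval (0, 1): in the chart (X / Z, Y / Z) such a curve is a convex graph.
   Local convexity and the prescribed flags at the ends make this condition
   both open and closed in X_Q.
   Given convex curves g and g0 in X_Q, a common vector n is on the positive
   side of all their tangent planes.  Projecting along n turns both into plane
   curves winding at most once around the origin, with increasing polar angles
   that agree at both ends.  Hence, after a change of parameter h and a positive
   rescaling rho, rho g0(h) - g is a multiple of n, so the determinant of
   (1 - s) g + s rho g0(h) and its two derivatives is a convex combination of
   those for s = 0 and s = 1, hence positive.  Normalizing, and then moving h
   linearly to the identity, deforms g into g0 inside X_Q, continuously in g;
   since convexity is open and closed in X_Q, the curves stay convex. *)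
Require Import Defs.
From mathcomp Require Import all_boot all_order all_algebra.
From mathcomp Require Import all_classical all_reals all_analysis.
From mathcomp Require Import ring lra.

Import Order.TTheory GRing.Theory Num.Theory numFieldNormedType.Exports.
Local Open Scope classical_set_scope.
Local Open Scope ring_scope.

Set Implicit Arguments.
Unset Strict Implicit.
Unset Printing Implicit Defensive.

(** * The unit interval *)

(** Everything is stated for families of curves indexed by an arbitrary space [E]. Indexing by a
    connected set of curves gives that convexity is open and closed; indexing by the interval times
    the set of convex curves gives a deformation continuous in the curve. The main obstacle is at
    the two ends, where the strict inequalities characterizing convexity may degenerate, so
    compactness alone does not make them an open condition. There the common flags fix which
    quantities vanish, and local convexity makes the next coefficient nonzero. Regularity may be as
    low as C^2. Hence Wronskians are estimated through difference quotients instead of third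
    derivatives, and the reparametrization must not lose an order: the angular speed has one order
    less than the curve, and integration restores it. The winding bound is what makes the two final
    polar angles equal and not merely congruent modulo 2 pi. The blended determinant is affine in s
    because adding multiples of one vector to the three rows is a change of rank one. *)

Lemma for_continuous_pair (X Y Z : topologicalType) (f : X -> Y) (g : X -> Z) x :
  {for x, continuous f} -> {for x, continuous g} ->
  {for x, continuous (fun y => (f y, g y))}.
Proof.
move=> cf cg U [[A B] /= [nA nB] AB].
have H : nbhs x (f @^-1` A `&` g @^-1` B) by apply: filterI; [exact: cf|exact: cg].
suff : nbhs x ((fun y => (f y, g y)) @^-1` U) by [].
by apply: filterS H => y [Ay By]; exact: (AB (f y, g y)).
Qed.

Lemma for_continuous_cst (X Y : topologicalType) (c : Y) (x : X) :
  {for x, continuous (fun=> c)}.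
Proof.
move=> U /nbhs_singleton Uc.
suff : nbhs x ((fun=> c) @^-1` U) by [].
by apply: filterE => y.
Qed.

Lemma for_continuous_fst (X Y : topologicalType) (p : X * Y) :
  {for p, continuous fst}.
Proof. by move=> U nU; exists (U, setT) => /=; [split=> //; exact: filterT|case=> ? ? []]. Qed.

Lemma for_continuous_snd (X Y : topologicalType) (p : X * Y) :
  {for p, continuous snd}.
Proof. by move=> U nU; exists (setT, U) => /=; [split=> //; exact: filterT|case=> ? ? []]. Qed.

Section UnitInterval.
Variable R : realType.
Local Notation I := (unitI R).
Local Notation "0I" := (t0 R).
Local Notation "1I" := (t1 R).
Implicit Types (s t : I).

Lemma unitI_ge0 t : 0 <= \val t.
Proof. by case: t => x /=; rewrite inE /= in_itv /= => /andP[]. Qed.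

Lemma unitI_le1 t : \val t <= 1.
Proof. by case: t => x /=; rewrite inE /= in_itv /= => /andP[]. Qed.

Definition clampR (x : R) : R := Num.max 0 (Num.min x 1).

Lemma clampR_subproof x : clampR x \in (`[0, 1]%classic : set R).
Proof.
rewrite inE /= in_itv /= /clampR le_max lexx /= ge_max ler01 /=.
by rewrite ge_min lexx orbT.
Qed.

Definition clamp (x : R) : I := exist _ (clampR x) (clampR_subproof x).

Lemma val_clamp x : 0 <= x <= 1 -> \val (clamp x) = x.
Proof.
by move=> /andP[x0 x1]; rewrite /= /clampR; rewrite min_l // max_r.
Qed.

Lemma clamp_val t : clamp (\val t) = t.
Proof. by apply: val_inj; rewrite val_clamp// unitI_ge0 unitI_le1. Qed.

Lemma clamp0 : clamp 0 = 0I.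
Proof. by apply: val_inj; rewrite val_clamp //= lexx ler01. Qed.

Lemma clamp1 : clamp 1 = 1I.
Proof. by apply: val_inj; rewrite val_clamp //= lexx ler01. Qed.

Lemma clamp_ge1 x : 1 <= x -> clamp x = 1I.
Proof. by move=> x1; apply: val_inj; rewrite /= /clampR min_r // max_r. Qed.

Lemma clamp_le0 x : x <= 0 -> clamp x = 0I.
Proof.
move=> x1; apply: val_inj; rewrite /= /clampR max_l //.
by rewrite ge_min x1.
Qed.

Lemma continuous_unitI (X : topologicalType) (f : X -> I) (x : X) :
  (\val (f y) : R) @[y --> x] --> (\val (f x) : R) -> {for x, continuous f}.
Proof.
move=> cf U [_ /= [[W oW <-] Wfx WU]].
have H : nbhs x ((fun y => \val (f y) : R) @^-1` W) := cf W (open_nbhs_nbhs (conj oW Wfx)).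
suff : nbhs x (f @^-1` U) by [].
by apply: filterS H => y Wy; exact: WU.
Qed.

Lemma val_unitI_continuous : continuous (fun t : I => \val t : R).
Proof. exact: (@initial_continuous I R \val). Qed.

Lemma clampR_continuous : continuous clampR.
Proof.
move=> x; apply: (@continuous_max R R (fun=> 0) (fun x => Num.min x 1)).
  exact: cvg_cst.
apply: (@continuous_min R R (fun x => x) (fun=> 1)); last exact: cvg_cst.
exact: cvg_id.
Qed.

Lemma clamp_continuous : continuous clamp.
Proof. by move=> x; apply: continuous_unitI; exact: clampR_continuous. Qed.

Lemma unitI_compact : compact [set: I].
Proof.
have -> : [set: I] = clamp @` `[0, 1]%classic.
  apply/esym/seteqP; split=> // t _; exists (\val t); last exact: clamp_val.
  by rewrite /= in_itv /= unitI_ge0 unitI_le1.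
apply: continuous_compact; last exact: segment_compact.
apply: continuous_subspaceT; exact: clamp_continuous.
Qed.

Lemma nbhs_unitIP t (U : set I) :
  nbhs t U <-> exists2 d : R, 0 < d & forall s, `|\val s - \val t| < d -> U s.
Proof.
split=> [[_ /= [[W oW <-] Wt WU]]|[d d0 dU]].
  have /nbhs_ballP[d /= d0 dW] := open_nbhs_nbhs (conj oW Wt).
  by exists d => // s st; apply: WU; apply: dW; rewrite /ball /= distrC.
have H : nbhs (\val t : R) [set x | `|x - \val t| < d].
  by apply/nbhs_ballP; exists d => // x; rewrite /ball /= distrC.
have : nbhs t [set s | `|\val s - \val t| < d] := val_unitI_continuous H.
by apply: filterS => s; exact: dU.
Qed.

Lemma nbhs_unitI_interior t (U : set I) : nbhs t U ->
  exists s, [/\ 0 < \val s < 1, s != t & U s].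
Proof.
move=> /nbhs_unitIP[d d0 dU].
have t_ge0 := unitI_ge0 t; have t_le1 := unitI_le1 t.
pose u := Num.min (d / 2) (1 / 4).
have u0 : 0 < u by rewrite lt_min !divr_gt0.
have ud : u < d by rewrite /u gt_min; apply/orP; left; lra.
have u1 : u <= 1 / 4 by rewrite ge_min lexx orbT.
(* A move of at most 1/4 towards the farther end stays strictly inside (0, 1), even when [t] is an
   end. *)
pose x := if \val t <= 1 / 2 then \val t + u else \val t - u.
have x01 : 0 < x < 1 by rewrite /x; case: ifPn; rewrite -?ltNge => ?; apply/andP; split; lra.
have vx : \val (clamp x) = x by rewrite val_clamp//; case/andP: x01 => /ltW -> /ltW ->.
exists (clamp x); split.
- by rewrite vx.
- apply/eqP => /(congr1 (fun t : I => \val t : R)); rewrite vx /x.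
  by case: ifP => _ ?; lra.
- by apply: dU; rewrite vx /x ltr_norml; case: ifP => _; apply/andP; split; lra.
Qed.

Lemma nbhs_unitI_right t (U : set I) : nbhs t U -> \val t < 1 ->
  exists s, [/\ \val t < \val s, \val s < 1 & U s].
Proof.
move=> /nbhs_unitIP[d d0 dU] t1; have t_ge0 := unitI_ge0 t.
pose u := Num.min (d / 2) ((1 - \val t) / 2).
have u0 : 0 < u by rewrite lt_min !divr_gt0// subr_gt0.
have ud : u < d by rewrite /u gt_min; apply/orP; left; lra.
have u1 : u <= (1 - \val t) / 2 by rewrite ge_min lexx orbT.
have vx : \val (clamp (\val t + u)) = \val t + u.
  by rewrite val_clamp//; apply/andP; split; lra.
exists (clamp (\val t + u)); rewrite vx; split; [lra|lra|].
by apply: dU; rewrite vx ltr_norml; apply/andP; split; lra.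
Qed.

Lemma nbhs_unitI_left t (U : set I) : nbhs t U -> 0 < \val t ->
  exists s, [/\ \val s < \val t, 0 < \val s & U s].
Proof.
move=> /nbhs_unitIP[d d0 dU] t1; have t_le1 := unitI_le1 t.
pose u := Num.min (d / 2) (\val t / 2).
have u0 : 0 < u by rewrite lt_min !divr_gt0.
have ud : u < d by rewrite /u gt_min; apply/orP; left; lra.
have u1 : u <= \val t / 2 by rewrite ge_min lexx orbT.
have vx : \val (clamp (\val t - u)) = \val t - u.
  by rewrite val_clamp//; apply/andP; split; lra.
exists (clamp (\val t - u)); rewrite vx; split; [lra|lra|].
by apply: dU; rewrite vx ltr_norml; apply/andP; split; lra.
Qed.

Lemma ge0_of_interior (f : I -> R) : continuous f ->
  (forall t, 0 < \val t < 1 -> 0 <= f t) -> forall t, 0 <= f t.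
Proof.
move=> cf f0 t; rewrite leNgt; apply/negP => ft.
have H : nbhs t [set s | f s < 0].
  exact: (cf t _ (open_nbhs_nbhs (conj (@open_lt _ 0) ft))).
have [s [s01 _ /=]] := nbhs_unitI_interior H.
by rewrite ltNge f0.
Qed.

(** Tube lemma, by compactness of the interval: it turns local information at each time into a
    neighbourhood of [e0] that serves all times. *)
Lemma near_unitI_all (E : topologicalType) (e0 : E) (P : E -> I -> Prop) :
  (forall t, \forall p \near (e0, t), P p.1 p.2) ->
  \forall e \near e0, forall t, P e t.
Proof.
move=> nP; have /compact_near_coveringP/(_ _ (nbhs e0) P _) := unitI_compact.
have H : forall t, [set: I] t -> \forall t' \near t & e \near e0, P e t'.
  move=> t _; have := nP t.
  case=> -[A B] /= [A1 B1] AB.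
  by exists (B, A) => //= -[x y] /= [Bx Ay]; exact: (AB (y, x)).
by move=> /(_ H); apply: filterS => e He t; exact: He.
Qed.

End UnitInterval.
Arguments clamp {R}.

(** * Calculus with parameters *)

Section Families.
Variables (R : realType) (E : topologicalType).
Local Notation I := (unitI R).
Implicit Types (F G : E -> I -> R) (q : E -> I -> I -> R) (h : E -> I -> I).

Definition jcont F : Prop := continuous (fun p : E * I => F p.1 p.2).

Definition jcont2 q : Prop :=
  continuous (fun p : E * (I * I) => q p.1 p.2.1 p.2.2).

(* Continuity of the difference quotient up to the diagonal encodes
   C^1 regularity (one-sided at the ends of I), jointly with the parameter,
   and turns the rules of calculus into algebraic identities. *)
Definition jder F G : Prop :=
  jcont F /\ exists q, [/\ jcont2 q,
    forall e a b, F e b - F e a = q e a b * (\val b - \val a)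
  & forall e a, q e a a = G e a].

Lemma jder_jcontr F G : jder F G -> jcont G.
Proof.
case=> _ [q [cq _ qG]].
rewrite (_ : G = fun e a => q e a a); last by do 2 apply/funext => ?; rewrite qG.
move=> p.
apply: (@continuous_comp _ _ _ (fun p : E * I => (p.1, (p.2, p.2)))
  (fun p : E * (I * I) => q p.1 p.2.1 p.2.2)); last exact: cq.
by apply: for_continuous_pair; [exact: for_continuous_fst|apply: for_continuous_pair; exact: for_continuous_snd].
Qed.

Lemma jcont2_fst F : jcont F -> jcont2 (fun e a _ => F e a).
Proof.
move=> cF p; apply: (@continuous_comp _ _ _ (fun p : E * (I * I) => (p.1, p.2.1))
  (fun p : E * I => F p.1 p.2)); last exact: cF.
apply: for_continuous_pair; first exact: for_continuous_fst.
by apply: (@continuous_comp _ _ _ snd fst);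
  [exact: for_continuous_snd|exact: for_continuous_fst].
Qed.

Lemma jcont2_snd F : jcont F -> jcont2 (fun e _ b => F e b).
Proof.
move=> cF p; apply: (@continuous_comp _ _ _ (fun p : E * (I * I) => (p.1, p.2.2))
  (fun p : E * I => F p.1 p.2)); last exact: cF.
apply: for_continuous_pair; first exact: for_continuous_fst.
by apply: (@continuous_comp _ _ _ snd snd); exact: for_continuous_snd.
Qed.

Lemma jcont2_comp q h : jcont2 q -> jcont (fun e t => \val (h e t)) ->
  jcont2 (fun e a b => q e (h e a) (h e b)).
Proof.
move=> cq ch p; apply: (@continuous_comp _ _ _
  (fun p : E * (I * I) => (p.1, (h p.1 p.2.1, h p.1 p.2.2)))
  (fun p : E * (I * I) => q p.1 p.2.1 p.2.2)); last exact: cq.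
apply: for_continuous_pair; first exact: for_continuous_fst.
apply: for_continuous_pair; apply: continuous_unitI.
- exact: (jcont2_fst ch).
- exact: (jcont2_snd ch).
Qed.

Lemma jcont_comp F h : jcont F -> jcont (fun e t => \val (h e t)) ->
  jcont (fun e t => F e (h e t)).
Proof.
move=> cF ch p; apply: (@continuous_comp _ _ _
  (fun p : E * I => (p.1, h p.1 p.2)) (fun p : E * I => F p.1 p.2)); last exact: cF.
by apply: for_continuous_pair; [exact: for_continuous_fst|exact: continuous_unitI (ch p)].
Qed.

Lemma jcontD F G : jcont F -> jcont G -> jcont (fun e t => F e t + G e t).
Proof. by move=> cF cG p; apply: cvgD; [exact: cF|exact: cG]. Qed.

Lemma jcontB F G : jcont F -> jcont G -> jcont (fun e t => F e t - G e t).
Proof. by move=> cF cG p; apply: cvgB; [exact: cF|exact: cG]. Qed.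

Lemma jcontN F : jcont F -> jcont (fun e t => - F e t).
Proof. by move=> cF p; apply: cvgN; exact: cF. Qed.

Lemma jcontM F G : jcont F -> jcont G -> jcont (fun e t => F e t * G e t).
Proof. by move=> cF cG p; apply: cvgM; [exact: cF|exact: cG]. Qed.

Lemma jcontV F : (forall e t, F e t != 0) -> jcont F ->
  jcont (fun e t => (F e t)^-1).
Proof. by move=> F0 cF p; apply: cvgV; [exact: F0|exact: cF]. Qed.

Lemma jcont_sqrt F : jcont F -> jcont (fun e t => Num.sqrt (F e t)).
Proof.
move=> cF p; apply: (@continuous_comp _ _ _ (fun p : E * I => F p.1 p.2) Num.sqrt).
  exact: cF.
exact: sqrt_continuous.
Qed.

Lemma jcont_param (f : E -> R) : continuous f -> jcont (fun e _ => f e).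
Proof. by move=> cf p; apply: (@continuous_comp _ _ _ fst f);
  [exact: for_continuous_fst|exact: cf]. Qed.

Lemma jcont_cst (c : R) : jcont (fun _ _ => c).
Proof. by move=> p; exact: cvg_cst. Qed.

Lemma jcont_val : jcont (fun _ t => \val t).
Proof.
move=> p; apply: (@continuous_comp _ _ _ snd (fun t : I => \val t : R)).
  exact: for_continuous_snd.
exact: val_unitI_continuous.
Qed.

Lemma jder_param (f : E -> R) : continuous f -> jder (fun e _ => f e) (fun _ _ => 0).
Proof.
move=> cf; split; first exact: jcont_param.
by exists (fun _ _ _ => 0); split=> // [p|e a b]; [exact: cvg_cst|rewrite subrr mul0r].
Qed.

Lemma jder_cst (c : R) : jder (fun _ _ => c) (fun _ _ => 0).
Proof. by apply: (@jder_param (fun=> c)) => e; exact: cvg_cst. Qed.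

Lemma jder_val : jder (fun _ t => \val t) (fun _ _ => 1).
Proof.
split; first exact: jcont_val.
by exists (fun _ _ _ => 1); split=> // [p|e a b]; [exact: cvg_cst|rewrite mul1r].
Qed.

Lemma jderD F F' G G' : jder F F' -> jder G G' ->
  jder (fun e t => F e t + G e t) (fun e t => F' e t + G' e t).
Proof.
move=> [cF [q [cq qF q']]] [cG [p [cp pG p']]]; split; first exact: jcontD.
exists (fun e a b => q e a b + p e a b); split.
- by move=> x; apply: cvgD; [exact: cq|exact: cp].
- by move=> e a b; rewrite mulrDl -qF -pG; ring.
- by move=> e a; rewrite q' p'.
Qed.

Lemma jderN F F' : jder F F' -> jder (fun e t => - F e t) (fun e t => - F' e t).
Proof.
move=> [cF [q [cq qF q']]]; split; first exact: jcontN.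
exists (fun e a b => - q e a b); split.
- by move=> x; apply: cvgN; exact: cq.
- by move=> e a b; rewrite mulNr -qF; ring.
- by move=> e a; rewrite q'.
Qed.

Lemma jderB F F' G G' : jder F F' -> jder G G' ->
  jder (fun e t => F e t - G e t) (fun e t => F' e t - G' e t).
Proof. by move=> dF /jderN dG; exact: jderD. Qed.

Lemma jderM F F' G G' : jder F F' -> jder G G' ->
  jder (fun e t => F e t * G e t) (fun e t => F' e t * G e t + F e t * G' e t).
Proof.
move=> [cF [q [cq qF q']]] [cG [p [cp pG p']]]; split; first exact: jcontM.
exists (fun e a b => q e a b * G e b + F e a * p e a b); split.
- move=> x; apply: cvgD; apply: cvgM.
  + exact: cq.
  + exact: (jcont2_snd cG).
  + exact: (jcont2_fst cF).
  + exact: cp.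
- move=> e a b; rewrite mulrDl mulrAC -qF -mulrA -pG; ring.
- by move=> e a; rewrite q' p'.
Qed.

Lemma jderV F F' : (forall e t, F e t != 0) -> jder F F' ->
  jder (fun e t => (F e t)^-1) (fun e t => - F' e t * ((F e t)^-1 * (F e t)^-1)).
Proof.
move=> F0 [cF [q [cq qF q']]]; split; first exact: jcontV.
exists (fun e a b => - q e a b * ((F e a)^-1 * (F e b)^-1)); split.
- move=> x; apply: cvgM; first by apply: cvgN; exact: cq.
  apply: cvgM.
  + exact: (jcont2_fst (jcontV F0 cF)).
  + exact: (jcont2_snd (jcontV F0 cF)).
- move=> e a b; rewrite mulrAC mulNr -qF; field.
  by rewrite !F0.
- by move=> e a; rewrite q'.
Qed.

(** The sum of two equal roots is the diagonal value of the denominator in (F b - F a) / (sqrt (F a)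
    + sqrt (F b)), times b - a. *)
Lemma jder_sqrt F F' : (forall e t, 0 < F e t) -> jder F F' ->
  jder (fun e t => Num.sqrt (F e t))
       (fun e t => F' e t * (Num.sqrt (F e t) + Num.sqrt (F e t))^-1).
Proof.
move=> F0 [cF [q [cq qF q']]]; split; first exact: jcont_sqrt.
have s0 e t : 0 < Num.sqrt (F e t) by rewrite sqrtr_gt0.
exists (fun e a b => q e a b * (Num.sqrt (F e a) + Num.sqrt (F e b))^-1); split.
- move=> x; apply: cvgM; first exact: cq.
  apply: cvgV; first by rewrite lt0r_neq0// addr_gt0.
  apply: cvgD.
  + exact: (jcont2_fst (jcont_sqrt cF)).
  + exact: (jcont2_snd (jcont_sqrt cF)).
- move=> e a b; rewrite mulrAC -qF.
  have -> : F e b - F e a = Num.sqrt (F e b) ^+ 2 - Num.sqrt (F e a) ^+ 2.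
    by rewrite !sqr_sqrtr// ltW.
  by field; rewrite lt0r_neq0// addr_gt0.
- by move=> e a; rewrite q'.
Qed.

Lemma jder_comp F F' h (h' : E -> I -> R) : jder F F' -> jder (fun e t => \val (h e t)) h' ->
  jder (fun e t => F e (h e t)) (fun e t => F' e (h e t) * h' e t).
Proof.
move=> [cF [q [cq qF q']]] [ch [p [cp ph p']]]; split; first exact: jcont_comp.
exists (fun e a b => q e (h e a) (h e b) * p e a b); split.
- move=> x; apply: cvgM; last exact: cp.
  exact: (jcont2_comp cq ch).
- by move=> e a b; rewrite -mulrA -ph -qF.
- by move=> e a; rewrite q' p'.
Qed.

Lemma jcont_slice F e : jcont F -> continuous (F e).
Proof.
move=> cF t; apply: (@continuous_comp _ _ _ (fun t : I => (e, t))
  (fun p : E * I => F p.1 p.2)); last exact: cF.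
by apply: (@for_continuous_pair _ _ _ (fun=> e) idfun);
  [exact: for_continuous_cst|exact: cvg_id].
Qed.

Lemma jder_is_derive F G e (x : R) : jder F G -> 0 < x < 1 ->
  is_derive x 1 (fun y => F e (clamp y)) (G e (clamp x)).
Proof.
move=> [cF [q [cq qF q']]] /andP[x0 x1].
have cqx : {for x, continuous (fun y : R => q e (clamp x) (clamp y))}.
  apply: (@continuous_comp _ _ _ (fun y : R => (e, (clamp x, clamp y)))
    (fun p : E * (I * I) => q p.1 p.2.1 p.2.2)); last exact: cq.
  apply: for_continuous_pair; first exact: cvg_cst.
  apply: for_continuous_pair; first exact: cvg_cst.
  exact: clamp_continuous.
have H : h^-1 *: (F e (clamp (h + x)) - F e (clamp x)) @[h --> 0^'] --> G e (clamp x).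
  rewrite -q'.
  have c1 : q e (clamp x) (clamp (h + x)) @[h --> (0:R)^'] --> q e (clamp x) (clamp x).
    apply: cvg_within_filter.
    have c0 : h + x @[h --> (0 : R)] --> x.
      by rewrite -{2}[x]add0r; apply: cvgD; [exact: cvg_id|exact: cvg_cst].
    exact: (cvg_comp _ _ c0 cqx).
  apply: cvg_trans c1; apply: near_eq_cvg; near=> h.
  have hx : 0 <= h + x <= 1.
    have : `|h| < Num.min x (1 - x).
      near: h; apply: dnbhs0_lt; rewrite lt_min x0 subr_gt0 x1 //.
    by rewrite lt_min !ltr_norml => /andP[/andP[? ?] /andP[? ?]]; apply/andP; split; lra.
  have h0 : h != 0 by near: h; exact: nbhs_dnbhs_neq.
  rewrite qF (val_clamp hx) val_clamp; last by rewrite !ltW.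
  by rewrite addrK /GRing.scale /= [_ * h]mulrC mulKf.
apply: DeriveDef.
- apply/cvg_ex; exists (G e (clamp x)).
  apply: cvg_trans H; apply: near_eq_cvg; near=> h => /=.
  by rewrite scaler1.
- apply/cvg_lim => //; apply: cvg_trans H; apply: near_eq_cvg; near=> h => /=.
  by rewrite scaler1.
Unshelve. all: by end_near.
Qed.

Lemma jder_MVT F G e (a b : I) : jder F G -> \val a < \val b ->
  exists c : I, \val a < \val c < \val b /\ F e b - F e a = G e c * (\val b - \val a).
Proof.
move=> dF ab.
have [||c] := @MVT R (fun y => F e (clamp y)) (fun y => G e (clamp y)) _ _ ab.
- move=> x; rewrite in_itv /= => /andP[ax xb]; apply: jder_is_derive => //.
  by rewrite (le_lt_trans (unitI_ge0 a) ax) (lt_le_trans xb (unitI_le1 b)).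
- apply: continuous_subspaceT => y.
  apply: (@continuous_comp _ _ _ clamp (F e)); first exact: clamp_continuous.
  exact: (@jcont_slice _ e dF.1).
rewrite in_itv /= => /andP[ac cb]; rewrite !clamp_val => ->.
exists (clamp c); rewrite val_clamp ?ac ?cb//.
by rewrite (ltW (le_lt_trans (unitI_ge0 a) ac)) (ltW (lt_le_trans cb (unitI_le1 b))).
Qed.

(** Off the diagonal the difference quotient is continuous as a quotient. On the diagonal it is
    squeezed: by hypothesis each quotient is a value of [G] between the two times, so joint
    continuity of [G] gives the limit. *)
Lemma jder_of_MVT F G : jcont F -> jcont G ->
  (forall e (a b : I), \val a < \val b -> exists c : I,
    \val a <= \val c <= \val b /\ F e b - F e a = G e c * (\val b - \val a)) ->
  jder F G.
Proof.
move=> cF cG mvt; split=> //.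
pose q e (a b : I) := if a == b then G e a else (F e b - F e a) / (\val b - \val a).
have mvt2 e (a b : I) : exists c : I, (\val a <= \val c <= \val b \/ \val b <= \val c <= \val a)
    /\ q e a b = G e c.
  rewrite /q; case: eqVneq => [->|ab].
    by exists b; split=> //; left; rewrite lexx.
  have vab : \val a != \val b by rewrite val_eqE.
  case: (ltgtP (\val a) (\val b)) vab => // vab _.
    have [c [cab ->]] := mvt e a b vab; exists c; split; first by left.
    by rewrite mulfK// subr_eq0 gt_eqF.
  have [c [cab H]] := mvt e b a vab; exists c; split; first by right.
  rewrite -opprB H -mulrN opprB mulfK// subr_eq0 lt_eqF//.
exists q; split; last by move=> e a; rewrite /q eqxx.
  move=> [e0 [a0 b0]]; rewrite /continuous_at /=.
  have [ab0|ab0] := eqVneq a0 b0; last first.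
    have vab0 : \val b0 - \val a0 != 0 by rewrite subr_eq0 val_eqE eq_sym.
    have H : {for (e0, (a0, b0)), continuous (fun p : E * (I * I) =>
       (F p.1 p.2.2 - F p.1 p.2.1) / ((\val p.2.2 : R) - \val p.2.1))}.
      apply: cvgM.
        by apply: cvgB; [exact: (jcont2_snd cF)|exact: (jcont2_fst cF)].
      apply: cvgV => //.
      by apply: cvgB; [exact: (jcont2_snd jcont_val)|exact: (jcont2_fst jcont_val)].
    have -> : q e0 a0 b0 = (F e0 b0 - F e0 a0) / (\val b0 - \val a0).
      by rewrite /q (negbTE ab0).
    apply: cvg_trans H; apply: near_eq_cvg.
    have : {for (e0, (a0, b0)), continuous (fun p : E * (I * I) => ((\val p.2.2 : R) - \val p.2.1))}.
      by apply: cvgB; [exact: (jcont2_snd jcont_val)|exact: (jcont2_fst jcont_val)].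
    move=> /(_ _ (open_nbhs_nbhs (conj (@open_neq _ 0) vab0))) H2.
    have {}H2 : nbhs (e0, (a0, b0))
      [set p : E * (I * I) | (\val p.2.2 : R) - \val p.2.1 != 0] := H2.
    apply: filterS H2 => -[e [a b]] /=; rewrite subr_eq0 /q => vab.
    by have [abE|//] := eqVneq a b; rewrite abE eqxx in vab.
  rewrite -{}ab0 {b0}.
  have -> : q e0 a0 a0 = G e0 a0 by rewrite /q eqxx.
  apply/cvgrPdist_lt => eps eps0.
  have /cvgrPdist_lt/(_ _ eps0) [[A B] /= [nA /nbhs_unitIP[d d0 dB]] AB] := cG (e0, a0).
  have nB : nbhs a0 [set s : I | `|\val s - \val a0| < d].
    by apply/nbhs_unitIP; exists d.
  exists (A, [set p : I * I | `|\val p.1 - \val a0| < d /\ `|\val p.2 - \val a0| < d]) => /=.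
    split=> //; exists ([set s : I | `|\val s - \val a0| < d], [set s : I | `|\val s - \val a0| < d]) => //=.
  move=> [e [a b]] /= [Ae [da db]].
  have [c [cab ->]] := mvt2 e a b.
  apply: (AB (e, c)); split=> //=; apply: dB.
  move: da db; rewrite !ltr_norml => /andP[? ?] /andP[? ?]; apply/andP.
  by case: cab => /= /andP[? ?]; split => /=; lra.
move=> e a b; rewrite /q; case: eqVneq => [->|ab]; first by rewrite !subrr mulr0.
by rewrite divfK// subr_eq0 val_eqE eq_sym.
Qed.

(** Class C^n in time, all derivatives being jointly continuous in parameter and time; nothing
    beyond continuity is asked in the parameter. *)
Fixpoint J (n : nat) F : Prop :=
  if n is m.+1 then exists G, jder F G /\ J m G else jcont F.

Lemma J_S n F : J n.+1 F -> J n F.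
Proof.
elim: n F => [|n IH] F [G [dF JG]]; first exact: dF.1.
by exists G; split => //; exact: IH.
Qed.

Lemma J_le m n F : (m <= n)%N -> J n F -> J m F.
Proof.
elim: n => [|n IH]; first by rewrite leqn0 => /eqP ->.
by rewrite leq_eqVlt => /predU1P[->//|]; rewrite ltnS => /IH {}IH /J_S.
Qed.

Lemma J_param n (f : E -> R) : continuous f -> J n (fun e _ => f e).
Proof.
elim: n f => [|n IH] f cf; first exact: jcont_param.
exists (fun _ _ => 0); split; first exact: jder_param.
by apply: (IH (fun=> 0)) => e; exact: cvg_cst.
Qed.

Lemma J_cst n (c : R) : J n (fun _ _ => c).
Proof. by apply: (@J_param n (fun=> c)) => e; exact: cvg_cst. Qed.

Lemma J_val n : J n (fun _ t => \val t).
Proof.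
case: n => [|n]; first exact: jcont_val.
by exists (fun _ _ => 1); split; [exact: jder_val|exact: J_cst].
Qed.

Lemma JD n F G : J n F -> J n G -> J n (fun e t => F e t + G e t).
Proof.
elim: n F G => [|n IH] F G; first exact: jcontD.
move=> [F' [dF JF]] [G' [dG JG]].
by exists (fun e t => F' e t + G' e t); split; [exact: jderD|exact: IH].
Qed.

Lemma JN n F : J n F -> J n (fun e t => - F e t).
Proof.
elim: n F => [|n IH] F; first exact: jcontN.
move=> [F' [dF JF]].
by exists (fun e t => - F' e t); split; [exact: jderN|exact: IH].
Qed.

Lemma JB n F G : J n F -> J n G -> J n (fun e t => F e t - G e t).
Proof. by move=> JF /JN JG; exact: JD. Qed.

Lemma JM n F G : J n F -> J n G -> J n (fun e t => F e t * G e t).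
Proof.
elim: n F G => [|n IH] F G; first exact: jcontM.
move=> JF JG; have [F' [dF JF']] := JF; have [G' [dG JG']] := JG.
exists (fun e t => F' e t * G e t + F e t * G' e t); split; first exact: jderM.
by apply: JD; apply: IH => //; exact: J_S.
Qed.

Lemma JV n F : (forall e t, F e t != 0) -> J n F -> J n (fun e t => (F e t)^-1).
Proof.
move=> F0; elim: n => [|n IH]; first exact: jcontV.
move=> JF; have [F' [dF JF']] := JF.
exists (fun e t => - F' e t * ((F e t)^-1 * (F e t)^-1)); split; first exact: jderV.
have JV := IH (J_S JF).
by apply: JM; [exact: JN|exact: JM].
Qed.

Lemma J_sqrt n F : (forall e t, 0 < F e t) -> J n F ->
  J n (fun e t => Num.sqrt (F e t)).
Proof.
move=> F0; elim: n => [|n IH]; first exact: jcont_sqrt.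
move=> JF; have [F' [dF JF']] := JF.
exists (fun e t => F' e t * (Num.sqrt (F e t) + Num.sqrt (F e t))^-1).
split; first exact: jder_sqrt.
have Jsq := IH (J_S JF).
apply: JM => //; apply: JV; last exact: JD.
by move=> e t; rewrite lt0r_neq0// addr_gt0// sqrtr_gt0.
Qed.

Lemma J_comp n F h : J n F -> J n (fun e t => \val (h e t)) ->
  J n (fun e t => F e (h e t)).
Proof.
elim: n F => [|n IH] F; first exact: jcont_comp.
move=> JF Jh; have [F' [dF JF']] := JF; have [h' [dh Jh']] := Jh.
exists (fun e t => F' e (h e t) * h' e t); split; first exact: jder_comp.
by apply: JM => //; apply: IH => //; exact: J_S.
Qed.

(** Inside (0, 1) both are the ordinary derivative, and continuity settles the ends. This is how
    identities between families get differentiated later. *)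
Lemma jder_uniq F G G' : jder F G -> jder F G' -> G = G'.
Proof.
move=> dG dG'; apply/funext => e; apply/funext => t.
have H : forall x, 0 < x < 1 -> G e (clamp x) - G' e (clamp x) = 0.
  move=> x x01; have [_ <-] := jder_is_derive e dG x01.
  by have [_ <-] := jder_is_derive e dG' x01; rewrite subrr.
have cD : continuous (fun t => G e t - G' e t).
  have cGe : continuous (G e) by apply: jcont_slice; exact: jder_jcontr dG.
  have cGe' : continuous (G' e) by apply: jcont_slice; exact: jder_jcontr dG'.
  move=> s; exact: (cvgB (cGe s) (cGe' s)).
apply/eqP; rewrite -subr_eq0.
case: eqP => // /eqP Dt0.
have H0 : nbhs t [set s | G e s - G' e s != 0].
  exact: (cD t _ (open_nbhs_nbhs (conj (@open_neq _ 0) Dt0))).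
have [s [s01 _ /=]] := nbhs_unitI_interior H0.
by rewrite -[s]clamp_val (H _ s01) eqxx.
Qed.

End Families.

Lemma jcont_reparam (R : realType) (E E' : topologicalType)
    (F : E -> unitI R -> R) (phi : E' -> E) :
  continuous phi -> jcont F -> jcont (fun e t => F (phi e) t).
Proof.
move=> cphi cF p; apply: (@continuous_comp _ _ _
  (fun p : E' * unitI R => (phi p.1, p.2)) (fun p => F p.1 p.2)); last exact: cF.
apply: for_continuous_pair; last exact: for_continuous_snd.
by apply: (@continuous_comp _ _ _ fst phi); [exact: for_continuous_fst|exact: cphi].
Qed.

Lemma jder_reparam (R : realType) (E E' : topologicalType)
    (F G : E -> unitI R -> R) (phi : E' -> E) :
  continuous phi -> jder F G ->
  jder (fun e t => F (phi e) t) (fun e t => G (phi e) t).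
Proof.
move=> cphi [cF [q [cq qF q']]]; split; first exact: jcont_reparam.
exists (fun e a b => q (phi e) a b); split=> // p.
apply: (@continuous_comp _ _ _ (fun p : E' * (unitI R * unitI R) => (phi p.1, p.2))
  (fun p => q p.1 p.2.1 p.2.2)); last exact: cq.
apply: for_continuous_pair; last exact: for_continuous_snd.
by apply: (@continuous_comp _ _ _ fst phi); [exact: for_continuous_fst|exact: cphi].
Qed.

(** * The space of curves *)

Lemma le_order_trans (i j : nat) k : (i <= j)%N -> le_order j k -> le_order i k.
Proof. by case: k => [m|] //= ij jm; exact: leq_trans jm. Qed.

Lemma cvg_colP (R : realType) (T : Type) (F : set_system T) (n : nat)
    (f : T -> 'cV[R]_n) (l : 'cV[R]_n) : Filter F ->
  (forall i, f x i 0 @[x --> F] --> l i 0) -> f x @[x --> F] --> l.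
Proof.
move=> FF cf A [P Pl PA].
have HP : F [set x | forall i j, P i j (f x i j)].
  have H : F [set x | forall i, P i 0 (f x i 0)].
    by apply: filter_forall => i; exact: (cf i _ (Pl i 0)).
  by apply: filterS H => x Hx i j; rewrite ord1.
suff : F (f @^-1` A) by [].
by apply: filterS HP => x Hx; exact: PA.
Qed.

Section Bridge.
Variable R : realType.
Local Notation I := (unitI R).

Lemma dnbhs_unitI_proper (t : I) : ProperFilter t^'.
Proof.
apply: Build_ProperFilter => H; have {H} : nbhs t [set s | s != t -> False] := H.
by move=> /nbhs_unitI_interior[s [_ st]]; apply.
Qed.

Lemma col_continuous_comp (T : topologicalType) (n : nat) (f : T -> 'cV[R]_n) (x : T) i :
  {for x, continuous f} -> {for x, continuous (fun y => f y i 0)}.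
Proof.
move=> cf; apply: (@continuous_comp _ _ _ f (fun M : 'cV[R]_n => M i 0)) => //.
exact: coord_continuous.
Qed.

Lemma diff_quot_cvg (f : I -> 'cV[R]_3) (t : I) :
  differentiableI f -> diff_quot f t s @[s --> t^'] --> derivI f t.
Proof. by move=> /(_ t). Qed.

(** * From coordinate functions with jointly continuous derivatives to maps into the space of
    curves *)

Section ToCurves.
Variables (E : topologicalType) (Phi : E -> I -> 'cV[R]_3).
Variables (F G : 'I_3 -> E -> I -> R).
Hypothesis PhiF : forall j e t, Phi e t j 0 = F j e t.
Hypothesis dF : forall j, jder (F j) (G j).

Lemma diff_quot_jder e t :
  diff_quot (Phi e) t s @[s --> t^'] --> (\col_j G j e t : 'cV[R]_3).
Proof.
apply: cvg_colP => j; rewrite mxE.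
have [cF [q [cq qF <-]]] := dF j.
have cq1 : q e t s @[s --> t] --> q e t t.
  apply: (@continuous_comp _ _ _ (fun s : I => (e, (t, s)))
    (fun p : E * (I * I) => q p.1 p.2.1 p.2.2)); last exact: cq.
  apply: for_continuous_pair; first exact: for_continuous_cst.
  apply: (@for_continuous_pair _ _ _ (fun=> t) idfun); first exact: for_continuous_cst.
  exact: cvg_id.
have cq2 : q e t s @[s --> t^'] --> q e t t by exact: cvg_within_filter.
apply: cvg_trans cq2; apply: near_eq_cvg.
have : \forall s \near t^', s != t by exact: nbhs_dnbhs_neq.
apply: filterS => s st.
rewrite /diff_quot !mxE !PhiF qF mulrC mulfK// subr_eq0.
by apply: contra st => /eqP/val_inj ->.
Qed.

Lemma jder_differentiableI e : differentiableI (Phi e).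
Proof.
move=> t; apply/cvg_ex; exists (\col_j G j e t); exact: diff_quot_jder.
Qed.

Lemma jder_derivI e t : derivI (Phi e) t = \col_j G j e t.
Proof.
have := dnbhs_unitI_proper t => PF.
rewrite /derivI; apply: (@cvg_lim 'cV[R]_3); last exact: diff_quot_jder.
exact: norm_hausdorff.
Qed.

End ToCurves.

(** A derivative provided by [J] is the actual one-sided limit by [jder_derivI], so each [derivI]
    costs exactly one order. *)
Lemma J_derivnI (E : topologicalType) (Phi : E -> I -> 'cV[R]_3) (i m : nat) :
  (forall j, J (i + m) (fun e t => Phi e t j 0)) ->
  forall j, J m (fun e t => derivnI i (Phi e) t j 0).
Proof.
elim: i m => [|i IH] m // JF j.
have /IH H : forall j, J (i + m.+1) (fun e t => Phi e t j 0).
  by move=> l; rewrite addnS; exact: JF.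
have {}H := fun j => cid (H j).
pose G j := sval (H j).
have dG j' : jder (fun e t => derivnI i (Phi e) t j' 0) (G j') by have [] := svalP (H j').
have := (svalP (H j)).2.
rewrite (_ : (fun e t => derivnI i.+1 (Phi e) t j 0) = sval (H j)) //.
apply/funext => e; apply/funext => t.
by rewrite [derivnI i.+1 _]/= (@jder_derivI _ (fun e => derivnI i (Phi e)) _ G (fun j e t => erefl) dG) mxE.
Qed.

Section Smooth.
Variables (E : topologicalType) (k : option nat) (Phi : E -> I -> 'cV[R]_3).
Hypothesis JPhi : forall n, le_order n k -> forall j, J n (fun e t => Phi e t j 0).

Let JPhi_deriv i m : le_order (i + m) k ->
  forall j, J m (fun e t => derivnI i (Phi e) t j 0).
Proof. by move=> ok; apply: J_derivnI; exact: JPhi. Qed.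

Lemma J_classC e : classC k (Phi e).
Proof.
split=> i ik.
- have := @JPhi_deriv i 1; rewrite addn1 => /(_ ik) H.
  have {}H := fun j => cid (H j).
  apply: (@jder_differentiableI _ (fun e => derivnI i (Phi e)) _ (fun j => sval (H j)) (fun j e t => erefl)).
  by move=> j; have [] := svalP (H j).
- have := @JPhi_deriv i 0; rewrite addn0 => /(_ ik) H t.
  have FF : Filter (nbhs t) by exact: nbhs_filter.
  by apply: (cvg_colP FF) => j; exact: (@jcont_slice _ _ _ e (H j) t).
Qed.

(** For the initial topology it suffices that each derivative converge uniformly in time, which
    follows from joint continuity and compactness of the interval. *)
Lemma J_continuous : continuous (Phi : E -> curves R k).
Proof.
apply: continuous_comp_initial => e0.
apply/cvg_sup => -[i ik] U [_ /= [[W oW <-] We WU]].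
have := open_nbhs_nbhs (conj oW We) => /uniform_nbhs[D [entD DW]].
have [eps /= eps0 epsD] : exists2 eps : R, 0 < eps &
    (forall v w : 'cV[R]_3, `|v - w| < eps -> D (v, w)).
  move: entD; rewrite -entourage_ballE => -[eps /= eps0 epsD]; exists eps => // v w vw.
  by apply: epsD; rewrite /= -ball_normE.
have H : \forall e \near e0, forall t : I, `|derivnI i (Phi e0) t - derivnI i (Phi e) t| < eps.
  have Jd : forall j, jcont (fun e t => derivnI i (Phi e) t j 0).
    by move=> j; apply: (@JPhi_deriv i 0); rewrite addn0.
  have eps2 : 0 < eps / 2 by lra.
  apply: (near_unitI_all (P := fun e t => `|derivnI i (Phi e0) t - derivnI i (Phi e) t| < eps)) => t.
  have cd : derivnI i (Phi p.1) p.2 @[p --> (e0, t)] --> derivnI i (Phi e0) t.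
    by apply: cvg_colP => j; exact: (Jd j (e0, t)).
  have cd0 : derivnI i (Phi e0) p.2 @[p --> (e0, t)] --> derivnI i (Phi e0) t.
    apply: cvg_colP => j.
    have ce0 : continuous (fun _ : E => e0) by move=> e; exact: for_continuous_cst.
    have H := jcont_reparam ce0 (Jd j).
    exact: (H (e0, t)).
  have H0 : (derivnI i (Phi e0) p.2 - derivnI i (Phi p.1) p.2) @[p --> (e0, t)]
      --> (0 : 'cV[R]_3).
    by rewrite -(subrr (derivnI i (Phi e0) t)); exact: (cvgB cd0 cd).
  exact: ((cvgr0Pnorm_lt _).1 H0).
have {}H : nbhs e0 [set e | W (derivnI i (Phi e))].
  apply: filterS H => e He; apply: DW => t _; exact: (epsD _ _ (He t)).
suff : nbhs e0 [set e | U (@jet R k (Phi e))] by [].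
apply: filterS H => e We'; exact: WU.
Qed.

End Smooth.

(** * From continuous maps into the space of curves back to jointly regular coordinates *)

Section FromCurves.
Variables (E : topologicalType) (k : option nat) (phi : E -> curves R k).
Hypothesis cphi : continuous phi.
Hypothesis phiC : forall e, classC k (phi e).

(** Uniform closeness of the derivatives of [phi e] and [phi e0], plus continuity in time of the
    derivative of [phi e0], each contribute half of the error. *)
Lemma jcont_derivnI i j : le_order i k -> jcont (fun e t => derivnI i (phi e) t j 0).
Proof.
move=> ik [e0 t0]; apply/cvgrPdist_lt => eps eps0.
have eps2 : 0 < eps / 2 by lra.
have /= := (phiC e0).2 _ ik t0 => /(@col_continuous_comp _ _ _ _ j)/cvgrPdist_lt/(_ _ eps2) H1.
have cjet : {for e0, continuous (fun e => derivnI i (phi e) : {uniform I -> 'cV[R]_3})}.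
  have cj : {for e0, continuous (@jet R k \o phi)}.
    by apply: continuous_comp; [exact: cphi|exact: initial_continuous].
  apply: (@continuous_comp _ _ _ (@jet R k \o phi) (fun f => f (exist _ i ik))) => //.
  exact: (@proj_continuous _ (fun _ : {i : nat | le_order i k} => {uniform I -> 'cV[R]_3}) (exist _ i ik)).
have H2 : \forall e \near e0, forall t : I, `|derivnI i (phi e0) t j 0 - derivnI i (phi e) t j 0| < eps / 2.
  apply: (cjet [set g : {uniform I -> 'cV[R]_3} | forall t : I, `|derivnI i (phi e0) t j 0 - g t j 0| < eps / 2]).
  apply/uniform_nbhs; exists [set p | ball p.1 (eps / 2) p.2]; split.
    by rewrite -entourage_ballE; exists (eps / 2) => //=.
  move=> h hb t; have /= := hb t Logic.I.
  rewrite -ball_normE /= => Hb; apply: le_lt_trans Hb.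
  have -> : derivnI i (phi e0) t j 0 - h t j 0 = (derivnI i (phi e0) t - h t) j 0.
    by rewrite !mxE.
  rewrite [leRHS]mx_normrE.
  by apply: (le_bigmax _ (fun ij : 'I_3 * 'I_1 => `|(derivnI i (phi e0) t - h t) ij.1 ij.2|) (j, 0)).
exists ([set e | forall t : I, `|derivnI i (phi e0) t j 0 - derivnI i (phi e) t j 0| < eps / 2],
        [set t | `|derivnI i (phi e0) t0 j 0 - derivnI i (phi e0) t j 0| < eps / 2]) => //.
move=> [e t] [/= /(_ t) He Ht].
rewrite (_ : _ - _ = (derivnI i (phi e0) t0 j 0 - derivnI i (phi e0) t j 0)
   + (derivnI i (phi e0) t j 0 - derivnI i (phi e) t j 0)); last by ring.
by rewrite (le_lt_trans (ler_normD _ _))// [eps]splitr ltrD.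
Qed.

Lemma differentiableI_is_derive (f : I -> 'cV[R]_3) j (x : R) :
  differentiableI f -> 0 < x < 1 ->
  is_derive x 1 (fun y => f (clamp y) j 0) (derivI f (clamp x) j 0).
Proof.
move=> df /andP[x0 x1].
have vx : \val (clamp x) = x by rewrite val_clamp// !ltW.
have H : (diff_quot f (clamp x) s) j 0 @[s --> (clamp x)^'] --> derivI f (clamp x) j 0.
  apply: (@cvg_comp _ _ _ (diff_quot f (clamp x)) (fun M : 'cV[R]_3 => M j 0)).
    exact: (@diff_quot_cvg f (clamp x) df).
  exact: (@coord_continuous R 3 1 j 0 (derivI f (clamp x))).
have nearx : \forall h \near (0 : R)^', 0 <= h + x <= 1 /\ h != 0.
  near=> h; split; last by near: h; exact: nbhs_dnbhs_neq.
  have : `|h| < Num.min x (1 - x).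
    near: h; apply: dnbhs0_lt; rewrite lt_min x0 subr_gt0 x1 //.
  by rewrite lt_min !ltr_norml => /andP[/andP[? ?] /andP[? ?]]; apply/andP; split; lra.
(* The limit defining [derivI] is over punctured neighbourhoods, so the shift must also avoid the
   point itself; near an interior [x] clamping does nothing and is injective. *)
have ch : clamp (h + x) @[h --> (0 : R)^'] --> (clamp x)^'.
  move=> U; rewrite /dnbhs /= /within /= => nU.
  have c0 : h + x @[h --> (0 : R)] --> x.
    by rewrite -{2}[x]add0r; apply: cvgD; [exact: cvg_id|exact: cvg_cst].
  have H1 : nbhs (0 : R)^' [set h | clamp (h + x) != clamp x -> U (clamp (h + x))].
    have cc : clamp (h + x) @[h --> (0 : R)] --> clamp x.
      exact: (cvg_comp _ _ c0 (@clamp_continuous R x)).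
    have H0 : nbhs (0 : R) [set h | clamp (h + x) != clamp x -> U (clamp (h + x))].
      exact: (cc _ nU).
    suff : nbhs (0 : R) [set h | h != 0 -> clamp (h + x) != clamp x -> U (clamp (h + x))] by [].
    by apply: filterS H0 => h Hh _.
  suff : nbhs (0 : R)^' [set h | U (clamp (h + x))] by [].
  apply: filterS2 nearx H1 => h [hx h0] H1; apply: H1.
  apply/eqP => /(congr1 val); rewrite (val_clamp hx) vx => /eqP.
  by rewrite -subr_eq0 addrK (negbTE h0).
have {}H : h^-1 *: (f (clamp (h + x)) j 0 - f (clamp x) j 0) @[h --> 0^']
    --> derivI f (clamp x) j 0.
  apply: cvg_trans (cvg_comp _ _ ch H); apply: near_eq_cvg.
  apply: filterS nearx => h [hx h0] /=.
  by rewrite /diff_quot !mxE (val_clamp hx) vx addrK.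
apply: DeriveDef.
- apply/cvg_ex; exists (derivI f (clamp x) j 0).
  apply: cvg_trans H; apply: near_eq_cvg; near=> h => /=.
  by rewrite scaler1.
- apply/cvg_lim => //; apply: cvg_trans H; apply: near_eq_cvg; near=> h => /=.
  by rewrite scaler1.
Unshelve. all: by end_near.
Qed.

Lemma jder_derivnI i j : le_order i.+1 k ->
  jder (fun e t => derivnI i (phi e) t j 0) (fun e t => derivnI i.+1 (phi e) t j 0).
Proof.
move=> ik; have ik' : le_order i k by apply: le_order_trans ik.
apply: jder_of_MVT; [exact: jcont_derivnI|exact: jcont_derivnI|].
move=> e a b ab.
have [||c] := @MVT R (fun y => derivnI i (phi e) (clamp y) j 0)
   (fun y => derivnI i.+1 (phi e) (clamp y) j 0) _ _ ab.
- move=> x; rewrite in_itv /= => /andP[ax xb]; apply: differentiableI_is_derive.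
    exact: (phiC e).1.
  by rewrite (le_lt_trans (unitI_ge0 a) ax) (lt_le_trans xb (unitI_le1 b)).
- apply: continuous_subspaceT => y.
  apply: (@continuous_comp _ _ _ clamp (fun s => derivnI i (phi e) s j 0)).
    exact: clamp_continuous.
  have Hc := @jcont_slice _ _ _ e (@jcont_derivnI i j ik').
  exact: (Hc (clamp y)).
rewrite in_itv /= => /andP[ac cb]; rewrite !clamp_val => ->.
exists (clamp c); rewrite val_clamp ?(ltW ac) ?(ltW cb)//.
by rewrite (ltW (le_lt_trans (unitI_ge0 a) ac)) (ltW (lt_le_trans cb (unitI_le1 b))).
Qed.

Lemma J_eval n j : le_order n k -> J n (fun e t => phi e t j 0).
Proof.
suff H i m : le_order (i + m) k -> J m (fun e t => derivnI i (phi e) t j 0) by exact: (H 0).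
elim: m i => [|m IH] i; first by rewrite addn0; exact: jcont_derivnI.
rewrite addnS => im; exists (fun e t => derivnI i.+1 (phi e) t j 0); split.
  by apply: jder_derivnI; apply: le_order_trans im; rewrite ltnS leq_addr.
by apply: IH; rewrite addSn.
Qed.

End FromCurves.
End Bridge.

(** * Sign lemmas *)

Section SignLemmas.
Variables (R : realType) (E : topologicalType).
Local Notation I := (unitI R).
Local Notation "0I" := (t0 R).
Local Notation "1I" := (t1 R).
Implicit Types (F G : E -> I -> R).

Lemma jder_eq F F' G G' : jder F F' -> (forall e t, F e t = G e t) ->
  (forall e t, F' e t = G' e t) -> jder G G'.
Proof.
move=> dF FG FG'; rewrite (_ : G = F); last by do 2 apply/funext => ?; rewrite FG.
by rewrite (_ : G' = F') //; do 2 apply/funext => ?; rewrite FG'.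
Qed.

Lemma jcont_param_slice F t : jcont F -> continuous (fun e => F e t).
Proof.
move=> cF e; apply: (@continuous_comp _ _ _ (fun e => (e, t)) (fun p : E * I => F p.1 p.2)).
  by apply: (@for_continuous_pair _ _ _ idfun (fun=> t)); [exact: cvg_id|exact: for_continuous_cst].
exact: cF.
Qed.

Lemma near_slice (e : E) (t : I) (P : E -> I -> Prop) :
  (\forall p \near (e, t), P p.1 p.2) -> \forall s \near t, P e s.
Proof.
move=> [[A B] /= [nA nB] AB]; apply: filterS nB => s Bs.
by apply: (AB (e, s)); split=> //=; exact: nbhs_singleton nA.
Qed.

Lemma jcont_near_gt0 F e t : jcont F -> 0 < F e t ->
  \forall p \near (e, t), 0 < F p.1 p.2.
Proof. by move=> cF Ft; exact: (cF (e, t) _ (open_nbhs_nbhs (conj (@open_gt _ 0) Ft))). Qed.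

Lemma jcont_near_lt0 F e t : jcont F -> F e t < 0 ->
  \forall p \near (e, t), F p.1 p.2 < 0.
Proof. by move=> cF Ft; exact: (cF (e, t) _ (open_nbhs_nbhs (conj (@open_lt _ 0) Ft))). Qed.

(** A neighbourhood of (e0, z) contains a product with an interval centered at [z], hence with (e,
    t) also all (e, c) for [c] between [z] and [t]. This makes mean value arguments at [z] uniform
    in the parameter. *)
Lemma near_between (e0 : E) (z : I) (P : E -> I -> Prop) (Q : E -> I -> Prop) :
  (\forall p \near (e0, z), p.2 != z -> P p.1 p.2) ->
  (forall e t, (forall c, (\val z < \val c < \val t) || (\val t < \val c < \val z) -> P e c) ->
     t != z -> Q e t) ->
  \forall p \near (e0, z), p.2 != z -> Q p.1 p.2.
Proof.
move=> [[A B] /= [nA /nbhs_unitIP[d d0 dB]] AB] H.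
have nB : nbhs z [set s : I | `|\val s - \val z| < d] by apply/nbhs_unitIP; exists d.
exists (A, [set s : I | `|\val s - \val z| < d]) => //= -[e t] /= [Ae td] tz.
apply: H => // c czt; apply: (AB (e, c)).
- split=> //=; apply: dB.
  move: td; rewrite !ltr_norml => /andP[? ?].
  by case/orP: czt => /= /andP[? ?]; apply/andP; split => /=; lra.
- by apply/eqP => /= cz; move: czt; rewrite cz !ltxx andbF.
Qed.

Lemma near_sign F F' (e0 : E) (z : I) : jder F F' -> (forall e, F e z = 0) ->
  (\forall p \near (e0, z), p.2 != z -> 0 < (\val p.2 - \val z) * F' p.1 p.2) ->
  \forall p \near (e0, z), p.2 != z -> 0 < F p.1 p.2.
Proof.
move=> dF Fz nF'.
apply: (near_between (P := fun e t => 0 < (\val t - \val z) * F' e t)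
  (Q := fun e t => 0 < F e t) nF') => e t H tz.
have vtz : \val t != \val z by rewrite val_eqE.
case: (ltgtP (\val t) (\val z)) vtz => // tz' _.
- have [c [cab]] := jder_MVT e dF tz'; rewrite Fz sub0r => /eqP.
  rewrite eqr_oppLR => /eqP ->.
  have := H c; rewrite cab orbT => /(_ isT); move: cab => /andP[? ?].
  rewrite nmulr_rgt0 ?subr_lt0// => F'c; rewrite -mulrN opprB nmulr_rgt0//.
  by rewrite subr_lt0.
- have [c [cab]] := jder_MVT e dF tz'; rewrite Fz subr0 => ->.
  have := H c; rewrite cab => /(_ isT); move: cab => /andP[? ?].
  by rewrite pmulr_rgt0 ?subr_gt0// => F'c; rewrite mulr_gt0// subr_gt0.
Qed.

Lemma near_sign2 F F' F'' (e0 : E) (z : I) : jder F F' -> jder F' F'' ->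
  (forall e, F e z = 0) -> (forall e, F' e z = 0) -> 0 < F'' e0 z ->
  \forall p \near (e0, z), p.2 != z -> 0 < F p.1 p.2.
Proof.
move=> dF dF' Fz F'z F''z; apply: (near_sign dF Fz).
have n2 := jcont_near_gt0 (jder_jcontr dF') F''z.
have {}n2 : \forall p \near (e0, z), p.2 != z -> 0 < F'' p.1 p.2.
  by apply: filterS n2.
apply: (near_between (P := fun e t => 0 < F'' e t)
  (Q := fun e t => 0 < (\val t - \val z) * F' e t) n2) => e t H tz.
have vtz : \val t != \val z by rewrite val_eqE.
case: (ltgtP (\val t) (\val z)) vtz => // tz' _.
- have [c [cab]] := jder_MVT e dF' tz'; rewrite F'z sub0r => /eqP.
  rewrite eqr_oppLR => /eqP ->.
  rewrite mulrN -mulNr opprB mulrC -mulrA pmulr_rgt0; last first.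
    by apply: H; rewrite cab orbT.
  by rewrite mulr_gt0// subr_gt0.
- have [c [cab]] := jder_MVT e dF' tz'; rewrite F'z subr0 => ->.
  rewrite mulrC -mulrA pmulr_rgt0; last by apply: H; rewrite cab.
  by rewrite mulr_gt0// subr_gt0.
Qed.

(** The Wronskian vanishes to second order at [z], and a Taylor expansion would need third
    derivatives. Instead [Y] and [Z] are written as t - z times their difference quotients from [z]:
    the derivative Y Z'' - Z Y'' is then t - z times a continuous function, positive at (e0, z). *)
Lemma near_sign_wronskian Y Y' Y'' Z Z' Z'' (e0 : E) (z : I) :
  jder Y Y' -> jder Y' Y'' -> jder Z Z' -> jder Z' Z'' ->
  (forall e, Y e z = 0) -> (forall e, Z e z = 0) ->
  0 < Y' e0 z * Z'' e0 z - Z' e0 z * Y'' e0 z ->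
  \forall p \near (e0, z), p.2 != z ->
    0 < Y p.1 p.2 * Z' p.1 p.2 - Z p.1 p.2 * Y' p.1 p.2.
Proof.
move=> dY dY' dZ dZ' Yz Zz W0.
have dm : jder (fun e t => Y e t * Z' e t - Z e t * Y' e t)
               (fun e t => Y e t * Z'' e t - Z e t * Y'' e t).
  by apply: (jder_eq (jderB (jderM dY dZ') (jderM dZ dY'))) => // e t; ring.
apply: (near_sign dm); first by move=> e; rewrite Yz Zz !mul0r subrr.
have [_ [qY [cqY qYE qYz]]] := dY; have [_ [qZ [cqZ qZE qZz]]] := dZ.
have cz (q : E -> I -> I -> R) : jcont2 q -> jcont (fun e (t : I) => q e z t).
  move=> cq p; apply: (@continuous_comp _ _ _ (fun p : E * I => (p.1, (z, p.2)))
    (fun p : E * (I * I) => q p.1 p.2.1 p.2.2)); last exact: cq.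
  apply: for_continuous_pair; first exact: for_continuous_fst.
  apply: (@for_continuous_pair _ _ _ (fun=> z) snd); first exact: for_continuous_cst.
  exact: for_continuous_snd.
have cB : jcont (fun e t => qY e z t * Z'' e t - qZ e z t * Y'' e t).
  apply: jcontB; apply: jcontM.
  - exact: cz.
  - exact: jder_jcontr dZ'.
  - exact: cz.
  - exact: jder_jcontr dY'.
have B0 : 0 < qY e0 z z * Z'' e0 z - qZ e0 z z * Y'' e0 z by rewrite qYz qZz.
have := jcont_near_gt0 cB B0; apply: filterS => -[e t] /= Bt tz.
have Yt : Y e t = qY e z t * (\val t - \val z) by rewrite -qYE Yz subr0.
have Zt : Z e t = qZ e z t * (\val t - \val z) by rewrite -qZE Zz subr0.
rewrite Yt Zt.
rewrite (_ : _ * _ = (\val t - \val z) ^+ 2 * (qY e z t * Z'' e t - qZ e z t * Y'' e t)).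
  by rewrite mulr_gt0// exprn_even_gt0//= subr_eq0 val_eqE.
by rewrite /=; ring.
Qed.

Lemma near_min_right F F' e (z : I) : jder F F' -> F e z = 0 ->
  (\forall t \near z, 0 <= F e t) -> 0 < \val z -> F' e z <= 0.
Proof.
move=> dF Fz nF z0; rewrite leNgt; apply/negP => F'z.
have nF' := near_slice (P := fun e t => 0 < F' e t) (jcont_near_gt0 (jder_jcontr dF) F'z).
have /nbhs_unitIP[d d0 dF'] := nF'.
have H : \forall t \near z, 0 <= F e t /\ `|\val t - \val z| < d.
  by apply: filterI => //; apply/nbhs_unitIP; exists d.
have [s [sz _ [Fs sd]]] := nbhs_unitI_left H z0.
have [c [/andP[sc cz]]] := jder_MVT e dF sz; rewrite Fz sub0r => FE.
have : 0 < F' e c * (\val z - \val s).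
  apply: mulr_gt0; last by rewrite subr_gt0.
  apply: dF'; move: sd; rewrite !ltr_norml => /andP[? ?]; apply/andP; split; lra.
by rewrite -FE oppr_gt0 ltNge Fs.
Qed.

Lemma near_min_left F F' e (z : I) : jder F F' -> F e z = 0 ->
  (\forall t \near z, 0 <= F e t) -> \val z < 1 -> 0 <= F' e z.
Proof.
move=> dF Fz nF z1; rewrite leNgt; apply/negP => F'z.
have nF' := near_slice (P := fun e t => F' e t < 0) (jcont_near_lt0 (jder_jcontr dF) F'z).
have /nbhs_unitIP[d d0 dF'] := nF'.
have H : \forall t \near z, 0 <= F e t /\ `|\val t - \val z| < d.
  by apply: filterI => //; apply/nbhs_unitIP; exists d.
have [s [sz _ [Fs sd]]] := nbhs_unitI_right H z1.
have [c [/andP[sc cz]]] := jder_MVT e dF sz; rewrite Fz subr0 => FE.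
have : F' e c * (\val s - \val z) < 0.
  rewrite nmulr_rlt0 ?subr_gt0//.
  apply: dF'; move: sd; rewrite !ltr_norml => /andP[? ?]; apply/andP; split; lra.
by rewrite -FE ltNge Fs.
Qed.

Lemma near_min_interior F F' e (z : I) : jder F F' -> F e z = 0 ->
  (\forall t \near z, 0 <= F e t) -> 0 < \val z < 1 -> F' e z = 0.
Proof.
move=> dF Fz nF /andP[z0 z1]; apply/eqP; rewrite eq_le.
by rewrite (near_min_right dF)//= (near_min_left dF).
Qed.

(** K / m is strictly increasing on [a, b], its derivative having the sign of K' m - K m'; the
    conclusion is cleared of denominators. *)
Lemma quotient_lt (K K' m m' : E -> I -> R) e (a b : I) : jder K K' -> jder m m' -> \val a < \val b ->
  (forall t, \val a <= \val t <= \val b -> 0 < m e t) ->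
  (forall t, \val a < \val t < \val b -> 0 < K' e t * m e t - K e t * m' e t) ->
  K e a * m e b < K e b * m e a.
Proof.
move=> dK dm ab m0 W0.
have a0 := unitI_ge0 a; have b1 := unitI_le1 b.
have a_le (t : I) : 0 <= (\val b - \val a) * \val t :> R.
  by rewrite mulr_ge0 ?unitI_ge0// subr_ge0 ltW.
have b_ge (t : I) : (\val b - \val a) * \val t <= \val b - \val a :> R.
  by rewrite -[leRHS]mulr1 ler_wpM2l ?unitI_le1// subr_ge0 ltW.
(* [jderV] wants a denominator that vanishes nowhere, whereas [m] is controlled only on [a, b] and
   for this [e]: the parameter is frozen and the whole interval is mapped affinely onto [a, b]. *)
pose h (_ : E) (t : I) := clamp (\val a + (\val b - \val a) * \val t).
have hE e' t : \val (h e' t) = \val a + (\val b - \val a) * \val t.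
  by rewrite val_clamp//; have := a_le t; have := b_ge t; move=> ? ?; apply/andP; split; lra.
have dh : jder (fun e t => \val (h e t)) (fun _ _ => \val b - \val a).
  have H : jder (fun (e : E) (t : I) => \val a + (\val b - \val a) * \val t)
                (fun _ _ => 0 + (0 * _ + (\val b - \val a) * 1)) :=
    jderD (jder_cst E (\val a : R)) (jderM (jder_cst E (\val b - \val a)) (jder_val R E)).
  by apply: (jder_eq H) => // e' t; rewrite ?hE//; ring.
have ce : continuous (fun _ : E => e) by move=> ?; exact: for_continuous_cst.
have dK2 := jder_comp (jder_reparam ce dK) dh.
have dm2 := jder_comp (jder_reparam ce dm) dh.
have m2 (e' : E) t : m e (h e' t) != 0.
  by rewrite lt0r_neq0// m0// hE; have := a_le t; have := b_ge t; move=> ? ?; apply/andP; split; lra.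
have dq := jderM dK2 (jderV m2 dm2).
have h01 : \val (t0 R) < \val (t1 R) by exact: ltr01.
have [c [/andP[c0 c1]]] := jder_MVT e dq h01.
have -> : h e (t0 R) = a by apply: val_inj; rewrite hE mulr0 addr0.
have -> : h e (t1 R) = b by apply: val_inj; rewrite hE mulr1 addrC subrK.
have mc := W0 (h e c); rewrite hE in mc.
have {}mc : 0 < K' e (h e c) * m e (h e c) - K e (h e c) * m' e (h e c).
  have ba : 0 < \val b - \val a by rewrite subr_gt0.
  have hc0 : 0 < (\val b - \val a) * \val c by rewrite mulr_gt0.
  have hc1 : (\val b - \val a) * \val c < \val b - \val a by rewrite gtr_pMr.
  by apply: mc; apply/andP; split; lra.
have m0c : m e (h e c) != 0 by exact: m2.
have ma : 0 < m e a by apply: m0; rewrite lexx ltW.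
have mb : 0 < m e b by apply: m0; rewrite lexx ltW.
move=> FE.
have : 0 < K e b / m e b - K e a / m e a.
  rewrite FE mulr_gt0 ?subr_gt0//.
  have -> : forall k k' n n' l : R, n != 0 ->
      k' * l * n^-1 + k * (- (n' * l) * (n^-1 * n^-1)) = l * ((k' * n - k * n') / (n * n)).
    by move=> k k' n n' l n0; field.
    rewrite mulr_gt0 ?subr_gt0// divr_gt0//.
    by rewrite -expr2 exprn_even_gt0.
  exact: m0c.
rewrite subr_gt0 ltr_pdivrMr// => H.
by move: H; rewrite mulrAC ltr_pdivlMr.
Qed.

End SignLemmas.

(** * Arcs in a chart *)

(** The 3 by 3 determinant by rows, expanded so that [ring] proves the determinant identities
    below. *)
Definition d3 (R : pzRingType) (a b c a' b' c' a'' b'' c'' : R) : R :=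
  a * (b' * c'' - c' * b'') - b * (a' * c'' - c' * a'') + c * (a' * b'' - b' * a'').

(* A family of locally convex curves (X, Y, Z) issued from the flag (e1, e2),
   with a common final flag.  In the chart (X / Z, Y / Z) a curve satisfying
   [positive_arc] is a convex graph over the decreasing coordinate Y / Z. *)
Section Arcs.
Variables (R : realType) (E : topologicalType).
Local Notation I := (unitI R).
Local Notation "0I" := (t0 R).
Local Notation "1I" := (t1 R).
Variables X X' X'' Y Y' Y'' Z Z' Z'' : E -> I -> R.
Hypotheses (dX : jder X X') (dX' : jder X' X'') (dY : jder Y Y') (dY' : jder Y' Y'')
  (dZ : jder Z Z') (dZ' : jder Z' Z'').
Hypothesis D_gt0 : forall e t, 0 < d3 (X e t) (Y e t) (Z e t)
  (X' e t) (Y' e t) (Z' e t) (X'' e t) (Y'' e t) (Z'' e t).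
Hypotheses (X0 : forall e, X e 0I = 1) (Y0 : forall e, Y e 0I = 0)
  (Z0 : forall e, Z e 0I = 0) (Y'0 : forall e, 0 < Y' e 0I)
  (Z'0 : forall e, Z' e 0I = 0).
Variables b c a' b' c' : R.
Hypotheses (Y1 : forall e, Y e 1I = b) (Z1 : forall e, Z e 1I = c).
Hypothesis flag1 : forall e, exists2 c1, 0 < c1 &
  [/\ X' e 1I = c1 * a', Y' e 1I = c1 * b' & Z' e 1I = c1 * c'].

(** This is the determinant of g, g' and e1: it places the starting point relative to the tangent
    plane at [t]. It is also - Z^2 times the derivative of Y / Z. *)
Definition arc_m e t := Y e t * Z' e t - Z e t * Y' e t.
Definition arc_m' e t := Y e t * Z'' e t - Z e t * Y'' e t.
Definition tangent_det e t s := d3 (X e t) (Y e t) (Z e t)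
  (X' e t) (Y' e t) (Z' e t) (X e s) (Y e s) (Z e s).
Definition positive_arc e := forall t : I, 0 < \val t < 1 -> 0 < Z e t /\ 0 < arc_m e t.

Lemma jder_arc_m : jder arc_m arc_m'.
Proof.
apply: (jder_eq (jderB (jderM dY dZ') (jderM dZ dY'))) => // e t.
rewrite /arc_m'; ring.
Qed.

Lemma jder_d3_param (F F' G G' H H' : E -> I -> R) (f1 f2 f3 f4 f5 f6 : E -> R) :
  jder F F' -> jder G G' -> jder H H' -> continuous f1 -> continuous f2 ->
  continuous f3 -> continuous f4 -> continuous f5 -> continuous f6 ->
  jder (fun e s => d3 (f1 e) (f2 e) (f3 e) (f4 e) (f5 e) (f6 e) (F e s) (G e s) (H e s))
   (fun e s => d3 (f1 e) (f2 e) (f3 e) (f4 e) (f5 e) (f6 e) (F' e s) (G' e s) (H' e s)).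
Proof.
move=> dF dG dH /jder_param p1 /jder_param p2 /jder_param p3.
move=> /jder_param p4 /jder_param p5 /jder_param p6.
have K := jderD (jderB
  (jderM p1 (jderB (jderM p5 dH) (jderM p6 dG)))
  (jderM p2 (jderB (jderM p4 dH) (jderM p6 dF))))
  (jderM p3 (jderB (jderM p4 dG) (jderM p5 dF))).
apply: (jder_eq K) => // e s; rewrite /d3; ring.
Qed.

Lemma jder_tangent_det t : jder (fun e => tangent_det e t)
  (fun e s => d3 (X e t) (Y e t) (Z e t)
    (X' e t) (Y' e t) (Z' e t) (X' e s) (Y' e s) (Z' e s)).
Proof.
have ct (F F' : E -> I -> R) (dF : jder F F') := @jcont_param_slice _ _ F t dF.1.
by apply: jder_d3_param => //;
  [exact: ct dX|exact: ct dY|exact: ct dZ|exact: ct dX'|exact: ct dY'|exact: ct dZ'].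
Qed.

(** At the start the determinant reduces to Y' Z'', so Z'' > 0 there: [Z] has a strict minimum of
    order two, and the Wronskian of [Y] and [Z] has leading coefficient Y' Z''. This holds for every
    member of the family, convex or not. *)
Lemma start_near (e0 : E) : \forall p \near (e0, 0I), p.2 != 0I ->
  0 < Z p.1 p.2 /\ 0 < arc_m p.1 p.2.
Proof.
have D0 := D_gt0 e0 0I.
rewrite /d3 X0 Y0 Z0 Z'0 !mul0r mul1r !subr0 addr0 in D0.
have Z''0 : 0 < Z'' e0 0I by move: D0; rewrite pmulr_rgt0.
have H1 := near_sign2 dZ dZ' Z0 Z'0 Z''0.
have H2 : \forall p \near (e0, 0I), p.2 != 0I -> 0 < arc_m p.1 p.2.
  apply: (near_sign_wronskian dY dY' dZ dZ' Y0 Z0).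
  by rewrite Z'0 mul0r subr0.
by apply: filterS2 H1 H2 => p H1 H2 p0; split; [exact: H1|exact: H2].
Qed.

(** The hypotheses put e1 in the span of g, g' and in that of g, g''. Since g, g', g'' are
    independent, these planes meet in the line of g, so g is a multiple of e1. *)
Lemma arc_m_degenerate e t : arc_m e t = 0 -> arc_m' e t = 0 -> Y e t = 0 /\ Z e t = 0.
Proof.
rewrite /arc_m /arc_m' => m0 m'0.
have D0 := D_gt0 e t.
split; apply/eqP.
- have : Y e t * d3 (X e t) (Y e t) (Z e t)
    (X' e t) (Y' e t) (Z' e t) (X'' e t) (Y'' e t) (Z'' e t) =
    (Y e t * Z' e t - Z e t * Y' e t) * (Y e t * X'' e t - X e t * Y'' e t)
    + (Y e t * Z'' e t - Z e t * Y'' e t) * (X e t * Y' e t - X' e t * Y e t).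
    by rewrite /d3; ring.
  by rewrite m0 m'0 !mul0r addr0 => /eqP; rewrite mulf_eq0 (gt_eqF D0) orbF.
- have : Z e t * d3 (X e t) (Y e t) (Z e t)
    (X' e t) (Y' e t) (Z' e t) (X'' e t) (Y'' e t) (Z'' e t) =
    (Y e t * Z' e t - Z e t * Y' e t) * (Z e t * X'' e t - X e t * Z'' e t)
    + (Y e t * Z'' e t - Z e t * Y'' e t) * (X e t * Z' e t - X' e t * Z e t).
    by rewrite /d3; ring.
  by rewrite m0 m'0 !mul0r addr0 => /eqP; rewrite mulf_eq0 (gt_eqF D0) orbF.
Qed.

Section OnePositive.
Variable e : E.
Hypothesis Pe : positive_arc e.

Lemma arc_Z_ge0 t : 0 <= Z e t.
Proof.
apply: (@ge0_of_interior _ (Z e)) => [|s s01]; last by have [/ltW] := Pe s01.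
exact: jcont_slice dZ.1.
Qed.

Lemma arc_m_ge0 t : 0 <= arc_m e t.
Proof.
apply: (@ge0_of_interior _ (arc_m e)) => [|s s01]; last by have [_ /ltW] := Pe s01.
exact: jcont_slice jder_arc_m.1.
Qed.

(** Y / Z is strictly decreasing, since its derivative has the sign of [- arc_m]. Asking for
    positivity of [Z] at [u] lets [u] be the final time. *)
Lemma arc_YZ_gt (s u : I) : 0 < \val s -> \val s < \val u -> 0 < Z e u ->
  0 < Y e s * Z e u - Z e s * Y e u.
Proof.
move=> s0 su Zu.
have u1 := unitI_le1 u.
have H : - Y e s * Z e u < - Y e u * Z e s.
  apply: (quotient_lt (jderN dY) dZ su) => t /andP[st tu].
    have [tu'|tu'] := ltP (\val t) (\val u).
      by have [] := @Pe t _ => //; rewrite (lt_le_trans s0 st) (lt_le_trans tu' u1).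
    by rewrite (_ : t = u) //; apply: val_inj; apply/eqP; rewrite eq_le tu tu'.
  have [] := @Pe t _; first by rewrite (lt_trans s0 st) (lt_le_trans tu u1).
  by rewrite /arc_m => _; rewrite mulNr mulNr opprK addrC [Y' e t * _]mulrC.
by move: H; rewrite !mulNr ltrN2 -subr_gt0 [Y e u * _]mulrC.
Qed.

(** A strictly convex graph lies on one side of its tangents. In the chart the slope of X / Z over Y
    / Z is - V / [arc_m], and the Wronskian of V and [arc_m] is Z times the positive determinant of
    g, g', g''. *)
Lemma tangent_det_gt0 (t s : I) : 0 < \val t < 1 -> 0 < \val s < 1 -> t != s ->
  0 < tangent_det e t s.
Proof.
move=> t01 s01 ts.
pose al := arc_m e t.
pose be := Z e t * X' e t - X e t * Z' e t.
pose w s := tangent_det e t s.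
pose w' s := d3 (X e t) (Y e t) (Z e t)
    (X' e t) (Y' e t) (Z' e t) (X' e s) (Y' e s) (Z' e s).
have [Zt al0] := Pe t01; have [Zs ms] := Pe s01.
pose V f t := Z f t * X' f t - Z' f t * X f t.
pose V' f t := Z f t * X'' f t - Z'' f t * X f t.
have dV : jder V V'.
  apply: (jder_eq (jderB (jderM dZ dX') (jderM dZ' dX))) => // f r.
  rewrite /V'; ring.
(* The left side has the sign of the derivative of w / Z. The right side compares V / [arc_m] at [r]
   and at [t], so monotonicity makes it negative before [t] and positive after: w / Z has its strict
   minimum, zero, at [t]. *)
have KE r : w' r * Z e r - w r * Z' e r = al * V e r - be * arc_m e r.
  by rewrite /w /w' /tangent_det /al /be /V /arc_m /d3; ring.
have Kt : al * V e t - be * arc_m e t = 0.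
  by rewrite /al /be /V /arc_m; ring.
have Vmono (p q : I) : 0 < \val p -> \val p < \val q -> \val q < 1 ->
    V e p * arc_m e q < V e q * arc_m e p.
  move=> p0 pq q1; apply: (quotient_lt dV jder_arc_m pq) => r /andP[pr rq].
    by have [] := @Pe r _ => //; rewrite (lt_le_trans p0 pr) (le_lt_trans rq q1).
  have r01 : 0 < \val r < 1 by rewrite (lt_trans p0 pr) (lt_trans rq q1).
  have [Zr _] := Pe r01.
  have -> : V' e r * arc_m e r - V e r * arc_m' e r = Z e r *
      d3 (X e r) (Y e r) (Z e r) (X' e r) (Y' e r) (Z' e r) (X'' e r) (Y'' e r) (Z'' e r).
    by rewrite /V /V' /arc_m /arc_m' /d3; ring.
  exact: mulr_gt0.
have Kpos (r : I) : \val t < \val r < 1 -> 0 < w' r * Z e r - w r * Z' e r.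
  move=> /andP[tr r1]; rewrite KE.
  have t0 : 0 < \val t by case/andP: t01.
  have H := Vmono t r t0 tr r1.
  rewrite -(pmulr_rgt0 _ al0).
  have -> : al * (al * V e r - be * arc_m e r) = al * (V e r * arc_m e t - V e t * arc_m e r)
     + arc_m e r * (al * V e t - be * arc_m e t) by rewrite /al; ring.
  by rewrite Kt mulr0 addr0 mulr_gt0// subr_gt0.
have Kneg (r : I) : 0 < \val r < \val t -> w' r * Z e r - w r * Z' e r < 0.
  move=> /andP[r0 rt]; rewrite KE.
  have t1 : \val t < 1 by case/andP: t01.
  have H := Vmono r t r0 rt t1.
  rewrite -(pmulr_rlt0 _ al0).
  have -> : al * (al * V e r - be * arc_m e r) = - (al * (V e t * arc_m e r - V e r * arc_m e t))
     + arc_m e r * (al * V e t - be * arc_m e t) by rewrite /al; ring.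
  by rewrite Kt mulr0 addr0 oppr_lt0 mulr_gt0// subr_gt0.
have wt : w t = 0 by rewrite /w /tangent_det /d3; ring.
have dw := jder_tangent_det t.
have ts' : \val t != \val s by rewrite val_eqE.
case/andP: (t01) => t0 t1; case/andP: (s01) => s0 s1.
case: (ltgtP (\val t) (\val s)) ts' => // ts' _.
- have : w t * Z e s < w s * Z e t.
    apply: (quotient_lt dw dZ ts') => r /andP[tr rs].
      by have [] := @Pe r _ => //; rewrite (lt_le_trans t0 tr) (le_lt_trans rs s1).
    by apply: Kpos; rewrite tr (lt_trans rs s1).
  by rewrite wt mul0r pmulr_lgt0.
- have : - w s * Z e t < - w t * Z e s.
    apply: (quotient_lt (jderN dw) dZ ts') => r /andP[sr rt].
      by have [] := @Pe r _ => //; rewrite (lt_le_trans s0 sr) (le_lt_trans rt t1).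
    have := @Kneg r; rewrite (lt_trans s0 sr) rt => /(_ isT).
    rewrite -oppr_gt0 => H.
    rewrite (_ : _ - _ = - (w' r * Z e r - w r * Z' e r)) //.
    by rewrite /w /w'; ring.
  by rewrite wt oppr0 mul0r mulNr oppr_lt0 pmulr_lgt0.
Qed.

Lemma tangent_det_ge0 t s : 0 <= tangent_det e t s.
Proof.
apply: (@ge0_of_interior _ (fun t => tangent_det e t s)) => [|r r01].
  have H : jcont (fun e t => tangent_det e t s).
    have ct (F F' : E -> I -> R) : jder F F' -> jcont (fun e _ => F e s).
      move=> dF; apply: (jcont_comp (h := fun _ _ => s) dF.1).
      exact: jcont_cst.
    have cX := ct _ _ dX; have cY := ct _ _ dY; have cZ := ct _ _ dZ.
    exact: (jcontD (jcontB
      (jcontM dX.1 (jcontB (jcontM dY'.1 cZ) (jcontM dZ'.1 cY)))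
      (jcontM dY.1 (jcontB (jcontM dX'.1 cZ) (jcontM dZ'.1 cX))))
      (jcontM dZ.1 (jcontB (jcontM dX'.1 cY) (jcontM dY'.1 cX)))).
  exact: jcont_slice H.
apply: (@ge0_of_interior _ (tangent_det e r)) => [|q q01].
  exact: jcont_slice (jder_tangent_det r).1.
have [->|rq] := eqVneq r q; last by rewrite ltW// tangent_det_gt0.
suff -> : tangent_det e q q = 0 by [].
by rewrite /tangent_det /d3; ring.
Qed.

(** The final flag fixes Z at the end, and Z' up to a positive factor, for the whole family. Either
    Z > 0; or Z = 0 and Z' < 0; or both vanish, and then Z'' is nonzero by local convexity and
    positive because [Z] is nonnegative along the positive arc [e]. *)
Lemma end_near_Z : \forall p \near (e, 1I), p.2 != 1I -> 0 < Z p.1 p.2.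
Proof.
have nZ : \forall t \near 1I, 0 <= Z e t by apply: filterE => t; exact: arc_Z_ge0.
have i0 : 0 < \val 1I by exact: ltr01.
have := arc_Z_ge0 1I; rewrite le_eqVlt => /predU1P[Z10|Z10]; last first.
  by have := jcont_near_gt0 dZ.1 Z10; apply: filterS.
have Zz f : Z f 1I = 0 by rewrite Z1 -(Z1 e).
have := near_min_right dZ (Zz e) nZ i0.
rewrite le_eqVlt => /predU1P[Z'10|Z'10]; last first.
  apply: (near_sign dZ Zz).
  have := jcont_near_lt0 (jder_jcontr dZ) Z'10; apply: filterS => -[f t] /= Z't tz.
  rewrite nmulr_rgt0// subr_lt0 lt_neqAle unitI_le1 andbT.
  by apply: contra tz => /eqP H; apply/eqP/val_inj.
have c'0 : c' = 0.
  have [c1 c10 [_ _]] := flag1 e; rewrite Z'10 => /esym/eqP.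
  by rewrite mulf_eq0 gt_eqF//= => /eqP.
have Z'z f : Z' f 1I = 0 by have [? _ [_ _ ->]] := flag1 f; rewrite c'0 mulr0.
have D1 := D_gt0 e 1I; rewrite /d3 Zz Z'z !mul0r !subr0 addr0 in D1.
case: (ltgtP (Z'' e 1I) 0) => [Z2|Z2|Z2].
- have H : \forall p \near (e, 1I), p.2 != 1I -> 0 < - Z p.1 p.2.
    apply: (near_sign2 (jderN dZ) (jderN dZ')) => [f|f|]; rewrite ?Zz ?Z'z ?oppr0//.
    by rewrite oppr_gt0.
  have [t [_ t1]] := nbhs_unitI_interior (near_slice (P := fun e t => t != 1I -> 0 < - Z e t) H).
  by move=> /(_ t1); rewrite oppr_gt0 ltNge arc_Z_ge0.
- exact: (near_sign2 dZ dZ').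
- by move: D1; rewrite Z2 !mulr0 subr0 ltxx.
Qed.

(** Same scheme as for [Z]. If [arc_m] and its derivative both vanish, the final point lies on the
    line of e1, [Y] and [Z] vanish there for the whole family, and the Wronskian estimate takes
    over; nonnegativity along [e] fixes its sign. *)
Lemma end_near_m : \forall p \near (e, 1I), p.2 != 1I -> 0 < arc_m p.1 p.2.
Proof.
have nm : \forall t \near 1I, 0 <= arc_m e t by apply: filterE => t; exact: arc_m_ge0.
have i0 : 0 < \val 1I by exact: ltr01.
have := arc_m_ge0 1I; rewrite le_eqVlt => /predU1P[m10|m10]; last first.
  by have := jcont_near_gt0 jder_arc_m.1 m10; apply: filterS.
have m1 f : arc_m f 1I = 0.
  have [c1 c10 [_ Y'1 Z'1]] := flag1 e; have [c2 _ [_ Y'2 Z'2]] := flag1 f.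
  have : c1 * (b * c' - c * b') = 0.
    by rewrite m10 /arc_m Y1 Z1 Y'1 Z'1; ring.
  move=> /eqP; rewrite mulf_eq0 gt_eqF//= => /eqP H.
  have -> : arc_m f 1I = c2 * (b * c' - c * b').
    by rewrite /arc_m Y1 Z1 Y'2 Z'2; ring.
  by rewrite H mulr0.
have := near_min_right jder_arc_m (esym m10) nm i0.
rewrite le_eqVlt => /predU1P[m'10|m'10]; last first.
  apply: (near_sign jder_arc_m m1).
  have := jcont_near_lt0 (jder_jcontr jder_arc_m) m'10; apply: filterS => -[f t] /= Z't tz.
  rewrite nmulr_rgt0// subr_lt0 lt_neqAle unitI_le1 andbT.
  by apply: contra tz => /eqP H; apply/eqP/val_inj.
have [Y10 Z10] := arc_m_degenerate (esym m10) m'10.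
have Yz f : Y f 1I = 0 by rewrite Y1 -(Y1 e).
have Zz f : Z f 1I = 0 by rewrite Z1 -(Z1 e).
have D1 := D_gt0 e 1I; rewrite /d3 Yz Zz !mul0r subr0 addr0 in D1.
set W := Y' e 1I * Z'' e 1I - Z' e 1I * Y'' e 1I in D1.
case: (ltgtP W 0) => [W0|W0|W0].
- have H : \forall p \near (e, 1I), p.2 != 1I ->
      0 < Z p.1 p.2 * Y' p.1 p.2 - Y p.1 p.2 * Z' p.1 p.2.
    apply: (near_sign_wronskian dZ dZ' dY dY' Zz Yz).
    by rewrite -opprB oppr_gt0 -/W.
  have [t [_ t1]] := nbhs_unitI_interior (near_slice
    (P := fun e t => t != 1I -> 0 < Z e t * Y' e t - Y e t * Z' e t) H).
  by move=> /(_ t1); rewrite -opprB oppr_gt0 ltNge arc_m_ge0.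
- exact: (near_sign_wronskian dY dY' dZ dZ' Yz Zz).
- by move: D1; rewrite W0 mulr0 ltxx.
Qed.

Lemma positive_arc_open : \forall f \near e, positive_arc f.
Proof.
apply: (near_unitI_all (P := fun f t => 0 < \val t < 1 -> 0 < Z f t /\ 0 < arc_m f t)) => t.
have [->|t0] := eqVneq t 0I.
  have := start_near e; apply: filterS => -[f s] /= H /andP[s0 _]; apply: H.
  by apply/eqP => s0'; move: s0; rewrite s0' /= ltxx.
have [->|t1] := eqVneq t 1I.
  apply: filterS2 end_near_Z end_near_m => -[f s] /= H1 H2 /andP[_ s1].
  have s1' : s != 1I by apply/eqP => s1'; move: s1; rewrite s1' /= ltxx.
  by split; [exact: H1|exact: H2].
have t01 : 0 < \val t < 1.
  rewrite !lt_neqAle unitI_ge0 unitI_le1 !andbT; apply/andP; split.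
    by apply: contra t0 => /eqP H; apply/eqP/val_inj; rewrite -H.
  by apply: contra t1 => /eqP H; apply/eqP/val_inj; rewrite H.
have [Zt mt] := Pe t01.
by apply: filterS2 (jcont_near_gt0 dZ.1 Zt) (jcont_near_gt0 jder_arc_m.1 mt) => -[f s].
Qed.

End OnePositive.

(** A limit keeps only weak inequalities. An interior zero is then a minimum, so a derivative
    vanishes as well, and [arc_m_degenerate] puts the point on the line of e1; the weak form of
    [arc_YZ_gt] excludes that. *)
Lemma positive_arc_closed (e0 : E) : closure positive_arc e0 -> positive_arc e0.
Proof.
move=> cl.
have lim (f : E -> R) : continuous f -> (forall e, positive_arc e -> 0 <= f e) -> 0 <= f e0.
  move=> cf f0; rewrite leNgt; apply/negP => fe0.
  have H : nbhs e0 [set e | f e < 0] := cf e0 _ (open_nbhs_nbhs (conj (@open_lt _ 0) fe0)).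
  have [e [Pe /=]] := cl _ H.
  by rewrite ltNge f0.
have ct (F : E -> I -> R) t (cF : jcont F) := @jcont_param_slice _ _ F t cF.
have Z_ge0 t : 0 <= Z e0 t.
  by apply: (lim (fun e => Z e t)); [exact: ct dZ.1|move=> e Pe; exact: arc_Z_ge0].
have m_ge0 t : 0 <= arc_m e0 t.
  by apply: (lim (fun e => arc_m e t)); [exact: ct jder_arc_m.1|move=> e Pe; exact: arc_m_ge0].
have N_ge0 (s u : I) : 0 < \val s -> \val s < \val u -> \val u < 1 ->
    0 <= Y e0 s * Z e0 u - Z e0 s * Y e0 u.
  move=> s0 su u1; apply: (lim (fun e => Y e s * Z e u - Z e s * Y e u)).
    move=> e; apply: cvgB; apply: cvgM;
      [exact: (ct _ _ dY.1)|exact: (ct _ _ dZ.1)|exact: (ct _ _ dZ.1)|exact: (ct _ _ dY.1)].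
  move=> e Pe; apply/ltW/arc_YZ_gt => //.
  by have [] := Pe u => //; rewrite u1 (lt_trans s0 su).
move=> t t01; case/andP: (t01) => tgt0 tlt1.
have Zt : 0 < Z e0 t.
  rewrite lt_neqAle Z_ge0 andbT; apply/eqP => /esym Zt0.
  have Z't : Z' e0 t = 0.
    apply: (near_min_interior dZ Zt0) => //; apply: filterE => s; exact: Z_ge0.
  have mt : arc_m e0 t = 0 by rewrite /arc_m Zt0 Z't mulr0 mul0r subr0.
  have m't : arc_m' e0 t = 0.
    apply: (near_min_interior jder_arc_m mt) => //; apply: filterE => s; exact: m_ge0.
  have [Yt _] := arc_m_degenerate mt m't.
  have [d d0 dn] := (nbhs_unitIP _ _).1 (near_slice
    (P := fun e t => t != 0I -> 0 < Z e t /\ 0 < arc_m e t) (start_near e0)).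
  have nd : \forall s \near 0I, (s != 0I -> 0 < Z e0 s) /\ `|\val s - \val 0I| < Num.min d (\val t).
    apply/nbhs_unitIP; exists (Num.min d (\val t)); first by rewrite lt_min d0.
    move=> s sdt; split=> // s0; move: sdt; rewrite lt_min => /andP[sd _].
    by have [] := dn s sd s0.
  have [s [s01 s0 [/(_ s0) Zs]]] := nbhs_unitI_interior nd.
  rewrite lt_min => /andP[_]; rewrite [\val 0I]/= subr0 => st.
  have s_gt0 : 0 < \val s by case/andP: s01.
  rewrite gtr0_norm// in st.
  (* With [s] early and Z > 0 at [s], [F] is nonnegative around [t] and vanishes at [t], so its
     derivative vanishes there. As Z' = 0 at [t], this forces Y' = 0: g and g' would both lie on the
     line of e1, against local convexity. *)
  pose F e u := Y e0 s * Z e u - Z e0 s * Y e u.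
  have dF : jder F (fun e u => Y e0 s * Z' e u - Z e0 s * Y' e u).
    have cst (k : R) := jder_cst E k.
    apply: (jder_eq (jderB (jderM (cst (Y e0 s)) dZ) (jderM (cst (Z e0 s)) dY))) => // e u.
    by rewrite /=; ring.
  have Ft : F e0 t = 0 by rewrite /F Zt0 Yt !mulr0 subr0.
  have nF : \forall u \near t, 0 <= F e0 u.
    apply/nbhs_unitIP; exists (Num.min (\val t - \val s) (1 - \val t)).
      by rewrite lt_min !subr_gt0 st.
    move=> u; rewrite lt_min !ltr_norml opprB ltrD2r => /andP[/andP[su _] /andP[_]].
    by rewrite ltrD2r => u1; exact: N_ge0.
  have := near_min_interior dF Ft nF t01.
  rewrite Z't mulr0 sub0r => /eqP; rewrite oppr_eq0 mulf_eq0 (gt_eqF Zs) /= => /eqP Y't.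
  by have := D_gt0 e0 t; rewrite /d3 Yt Zt0 Z't Y't !(mul0r, mulr0, subr0, addr0) ltxx.
split=> //; rewrite lt_neqAle m_ge0 andbT; apply/eqP => /esym mt.
have m't : arc_m' e0 t = 0.
  apply: (near_min_interior jder_arc_m mt) => //; apply: filterE => s; exact: m_ge0.
by have [_ Zt0] := arc_m_degenerate mt m't; rewrite Zt0 ltxx in Zt.
Qed.

End Arcs.

(** * Convex curves *)

Definition o2 : 'I_3 := @Ordinal 3 2 isT.

Lemma ord3P (P : 'I_3 -> Prop) : P 0 -> P 1 -> P o2 -> forall i, P i.
Proof.
move=> P0 P1 P2 [[|[|[|//]]] i3].
- by rewrite (_ : Ordinal i3 = 0)//; apply: val_inj.
- by rewrite (_ : Ordinal i3 = 1)//; apply: val_inj.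
- by rewrite (_ : Ordinal i3 = o2)//; apply: val_inj.
Qed.

Lemma sum_ord3 (V : zmodType) (F : 'I_3 -> V) : \sum_i F i = F 0 + F 1 + F o2.
Proof.
rewrite !big_ord_recl big_ord0 addr0 addrA; congr (_ + F _ + F _); exact: val_inj.
Qed.

Section Vectors.
Variable R : realType.
Implicit Types u v w : 'cV[R]_3.

Definition omega u v w : R := d3 (u 0 0) (u 1 0) (u o2 0) (v 0 0) (v 1 0) (v o2 0)
  (w 0 0) (w 1 0) (w o2 0).

Lemma det3E u v w : det3 u v w = omega u v w.
Proof.
have l1 : lift 0 (0 : 'I_2) = 1 :> 'I_3 by exact: val_inj.
have l2 : lift 0 (lift 0 (0 : 'I_1)) = o2 :> 'I_3 by exact: val_inj.
rewrite /det3 (expand_det_row _ 0) sum_ord3 /cofactor.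
rewrite !(@expand_det_row _ 2 _ 0) !big_ord_recl !big_ord0 /cofactor !det_mx11 !mxE /=.
by rewrite l1 l2 /omega /d3 /bump /= !(expr0, expr1, exprS); ring.
Qed.

Lemma omegaD u v w1 w2 : omega u v (w1 + w2) = omega u v w1 + omega u v w2.
Proof. by rewrite /omega /d3 !mxE; ring. Qed.

Lemma omegaZ u v w (l : R) : omega u v (l *: w) = l * omega u v w.
Proof. by rewrite /omega /d3 !mxE; ring. Qed.

Lemma omega_continuous u v : continuous (omega u v).
Proof.
move=> w.
have c i : {for w, continuous (fun w : 'cV[R]_3 => w i 0)} by exact: coord_continuous.
have k (x : R) : {for w, continuous (fun _ : 'cV[R]_3 => x)} by exact: for_continuous_cst.
have K (x : R) i : {for w, continuous (fun w : 'cV[R]_3 => x * w i 0)}.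
  exact: (cvgM (k x) (c i)).
exact: (cvgD (cvgB
  (cvgM (k (u 0 0)) (cvgB (K (v 1 0) o2) (K (v o2 0) 1)))
  (cvgM (k (u 1 0)) (cvgB (K (v 0 0) o2) (K (v o2 0) 0))))
  (cvgM (k (u o2 0)) (cvgB (K (v 0 0) 1) (K (v 1 0) 0)))).
Qed.

Lemma omegaC u v w : omega u v w = omega v w u.
Proof. by rewrite /omega /d3; ring. Qed.

Lemma omega_swap u v w : omega u v w = - omega v u w.
Proof. by rewrite /omega /d3; ring. Qed.

(** Cramer's rule: lying in the open cone spanned by three vectors becomes a matter of signs of
    determinants. *)
Lemma omega_cramer p q r v : omega p q r != 0 ->
  v = (omega v q r / omega p q r) *: p + (omega p v r / omega p q r) *: q
    + (omega p q v / omega p q r) *: r.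
Proof.
move=> D0; apply/matrixP => i j; rewrite ord1 !mxE {j}.
apply: (mulfI D0).
have H (x y z a b c : R) : x = y + z + a -> b * (y / b * 1 + z / b + a / b) = x -> True by [].
transitivity (omega v q r * p i 0 + omega p v r * q i 0 + omega p q v * r i 0).
  by elim/ord3P: i; rewrite /omega /d3; ring.
by field.
Qed.

End Vectors.

Section XQFamily.
Variables (R : realType) (E : topologicalType) (k : option nat) (Q : 'M[R]_3).
Variable phi : E -> curves R k.
Local Notation I := (unitI R).
Local Notation "0I" := (t0 R).
Local Notation "1I" := (t1 R).
Hypothesis k2 : le_order 2 k.
Hypothesis cphi : continuous phi.
Hypothesis phiX : forall e, XQ k Q (phi e).

Definition crd (i : nat) (j : 'I_3) (e : E) (t : I) : R := derivnI i (phi e) t j 0.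

Lemma XQ_classC e : classC k (phi e).
Proof. by have [] := phiX e. Qed.

Lemma jder_crd0 j : jder (crd 0 j) (crd 1 j).
Proof. by apply: (jder_derivnI cphi XQ_classC); exact: le_order_trans k2. Qed.

Lemma jder_crd1 j : jder (crd 1 j) (crd 2 j).
Proof. exact: (jder_derivnI cphi XQ_classC). Qed.

Lemma crd_det_gt0 e t : 0 < d3 (crd 0 0 e t) (crd 0 1 e t) (crd 0 o2 e t)
  (crd 1 0 e t) (crd 1 1 e t) (crd 1 o2 e t)
  (crd 2 0 e t) (crd 2 1 e t) (crd 2 o2 e t).
Proof. by have [_ _ /(_ t)] := phiX e; rewrite det3E. Qed.

Lemma crd00 e : crd 0 0 e 0I = 1.
Proof. by have [_ _ _ [H _] _] := phiX e; rewrite /crd /= H mxE. Qed.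
Lemma crd01 e : crd 0 1 e 0I = 0.
Proof. by have [_ _ _ [H _] _] := phiX e; rewrite /crd /= H mxE. Qed.
Lemma crd02 e : crd 0 o2 e 0I = 0.
Proof. by have [_ _ _ [H _] _] := phiX e; rewrite /crd /= H mxE. Qed.
Lemma crd10 e : crd 1 0 e 0I = 0.
Proof. by have [_ _ _ [_ [c _ H]] _] := phiX e; rewrite /crd /= H !mxE mulr0. Qed.
Lemma crd11 e : 0 < crd 1 1 e 0I.
Proof. by have [_ _ _ [_ [c c0 H]] _] := phiX e; rewrite /crd /= H !mxE mulr1. Qed.
Lemma crd12 e : crd 1 o2 e 0I = 0.
Proof. by have [_ _ _ [_ [c _ H]] _] := phiX e; rewrite /crd /= H !mxE mulr0. Qed.

Lemma crd_end j e : crd 0 j e 1I = Q j 0.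
Proof. by have [_ _ _ _ [H _]] := phiX e; rewrite /crd /= H -colE mxE. Qed.

Lemma crd_end_flag e : exists2 c1, 0 < c1 &
  [/\ crd 1 0 e 1I = c1 * Q 0 1, crd 1 1 e 1I = c1 * Q 1 1 & crd 1 o2 e 1I = c1 * Q o2 1].
Proof.
have [_ _ _ _ [_ [c c0 H]]] := phiX e; exists c => //.
by rewrite /crd /= H -colE; split; rewrite !mxE.
Qed.

Definition arcP (e : E) : Prop := positive_arc (crd 0 1) (crd 1 1) (crd 0 o2) (crd 1 o2) e.

Lemma omega_tangent e t s : omega (phi e t) (derivI (phi e) t) (phi e s) =
  tangent_det (crd 0 0) (crd 1 0) (crd 0 1) (crd 1 1) (crd 0 o2) (crd 1 o2) e t s.
Proof. by []. Qed.

Lemma phi_inj e (s t : I) : (forall j, crd 0 j e s = crd 0 j e t) -> phi e s = phi e t.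
Proof. by move=> H; apply/matrixP => i j; rewrite ord1; exact: H. Qed.

Lemma t0P (s : I) : ~~ (0 < \val s) -> s = 0I.
Proof.
by rewrite -leNgt => s0; apply/val_inj/eqP; rewrite /= eq_le s0 unitI_ge0.
Qed.

Lemma t1P (s : I) : ~~ (\val s < 1) -> s = 1I.
Proof.
by rewrite -leNgt => s0; apply/val_inj/eqP; rewrite /= eq_le s0 unitI_le1.
Qed.

(** A repeated value at s < t with [s] positive contradicts the strict decrease of Y / Z, even for
    [t] final. With [s] the initial time, Z = 0 at [t], which leaves only the final time. *)
Lemma arcP_simple e : arcP e -> simple_curve (phi e).
Proof.
move=> Pe s t st gst.
have H j : crd 0 j e s = crd 0 j e t by rewrite /crd /= gst.
have s0 : s = 0I.
  apply: t0P; apply/negP => s0.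
  have s1 : \val s < 1 := lt_le_trans st (unitI_le1 t).
  have [Zs _] := Pe s (introT andP (conj s0 s1)).
  have := arc_YZ_gt (jder_crd0 1) (jder_crd0 o2) Pe s0 st.
  by rewrite -!H => /(_ Zs); rewrite mulrC subrr ltxx.
split=> //; apply: t1P; apply/negP => t1.
have t0 : 0 < \val t by move: st; rewrite s0.
have [Zt _] := Pe t (introT andP (conj t0 t1)).
by move: Zt; rewrite -H s0 crd02 ltxx.
Qed.

(** The tangent plane supports the cone: the linear form [om] is nonnegative on [Vcone], zero at the
    point and positive on the second derivative, so moving from the point against that derivative
    leaves the cone at once. *)
Lemma tangent_ge0_boundary e t : (forall s, 0 <= omega (phi e t) (derivI (phi e) t) (phi e s)) ->
  (closure (Vcone (phi e)) `\` interior (Vcone (phi e))) (phi e t).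
Proof.
move=> H.
set om := omega (phi e t) (derivI (phi e) t).
split.
  apply: subset_closure; apply: subset_closure.
  exists 0%N, (fun=> 1), (fun=> t); split; first by [].
  by rewrite big_ord1 scale1r.
move=> nV.
have omV v : Vcone (phi e) v -> 0 <= om v.
  move=> cv; rewrite leNgt; apply/negP => ov.
  have nv : nbhs v [set w | om w < 0].
    exact: (@omega_continuous _ _ _ _ _ (open_nbhs_nbhs (conj (@open_lt _ 0) ov))).
  have [w [[n [a [tt [a0 wE]]]] /=]] := cv _ nv.
  rewrite wE ltNge => /negP; apply.
  apply: (big_ind (fun w => 0 <= om w)).
  - suff -> : om 0 = 0 by [].
    by rewrite /om /omega /d3 !mxE; ring.
  - by move=> x y x0 y0; rewrite /om omegaD addr_ge0.
  - by move=> i _; rewrite /om omegaZ mulr_ge0// ltW.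
pose g := derivnI 2 (phi e) t.
have og : 0 < om g by have [_ _ /(_ t)] := phiX e; rewrite det3E.
have ot : om (phi e t) = 0 by rewrite /om /omega /d3; ring.
have cl : (phi e t - h *: g) @[h --> (0 : R)] --> phi e t.
  rewrite -[X in _ --> X]subr0 -(scale0r g).
  apply: cvgB; first exact: cvg_cst.
  by apply: cvgZ; [exact: cvg_id|exact: cvg_cst].
have nh : nbhs (0 : R) [set h | Vcone (phi e) (phi e t - h *: g)] := cl _ nV.
have [d /= d0 dV] := (nbhs_ballP _ _).1 nh.
have d2 : 0 < d / 2 by rewrite divr_gt0.
have : Vcone (phi e) (phi e t - (d / 2) *: g).
  apply: dV; rewrite /ball /= sub0r normrN gtr0_norm//.
  by rewrite ltr_pdivrMr// ltr_pMr// ltr1n.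
move=> /omV; rewrite -scaleNr /om omegaD omegaZ -/om ot add0r mulNr oppr_ge0 leNgt.
by rewrite mulr_gt0.
Qed.

Lemma convex_of_arcP e : arcP e -> convex_curve (phi e).
Proof.
move=> Pe; split; first exact: arcP_simple.
move=> t; apply: tangent_ge0_boundary => s; rewrite omega_tangent.
by apply: (tangent_det_ge0 (jder_crd0 0) (jder_crd1 0) (jder_crd0 1) (jder_crd1 1)
  (jder_crd0 o2) (jder_crd1 o2) crd_det_gt0) => //.
Qed.

(* If some point of the curve lies strictly on the wrong side of the tangent
   at t, then two neighbours of t and that point span a cone whose interior
   contains the point of parameter t. *)
Lemma convex_tangent_ge0_interior e (t s : I) : convex_curve (phi e) ->
  0 < \val t < 1 -> 0 <= omega (phi e t) (derivI (phi e) t) (phi e s).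
Proof.
move=> [_ /(_ t)[_ nV]] /andP[tgt0 tlt1]; rewrite leNgt; apply/negP => G0.
set u := phi e t in G0; set u' := derivI (phi e) t in G0; set b := phi e s in G0.
have ct (i : nat) j (ik : le_order i k) :=
  @jcont_param_slice _ _ _ t (@jcont_derivnI _ _ _ _ cphi XQ_classC i j ik).
have k0 : le_order 0 k by exact: le_order_trans k2.
have k1 : le_order 1 k by exact: le_order_trans k2.
have nz : \forall p \near (e, t), p.2 != t ->
    0 < omega (phi p.1 t) (derivI (phi p.1) t) (phi p.1 p.2).
  have c0 j := ct 0 j k0; have c1 j := ct 1 j k1.
  apply: (near_sign2
   (jder_d3_param (jder_crd0 0) (jder_crd0 1) (jder_crd0 o2) (c0 0) (c0 1) (c0 o2) (c1 0) (c1 1) (c1 o2))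
   (jder_d3_param (jder_crd1 0) (jder_crd1 1) (jder_crd1 o2) (c0 0) (c0 1) (c0 o2) (c1 0) (c1 1) (c1 o2))).
  - by move=> f; rewrite /crd /d3 /=; ring.
  - by move=> f; rewrite /crd /d3 /=; ring.
  - exact: crd_det_gt0.
have {}nz : \forall r \near t, r != t -> 0 < omega u u' (phi e r).
  exact: (near_slice (P := fun f r => r != t -> 0 < omega (phi f t) (derivI (phi f) t) (phi f r)) nz).
have kc (x : R) : continuous (fun _ : E => x) by move=> f; exact: for_continuous_cst.
(* In the basis u, u', b, whose determinant is negative, a point of the curve has coordinates
   proportional to [x], [p] and [omega u u']. Near [t], [x] keeps its sign, [p] changes sign at [t],
   and [omega u u'] is positive off [t]. *)
pose p r := omega b u (phi e r).
pose x r := omega u' b (phi e r).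
have dp := jder_d3_param (jder_crd0 0) (jder_crd0 1) (jder_crd0 o2)
  (kc (b 0 0)) (kc (b 1 0)) (kc (b o2 0)) (kc (u 0 0)) (kc (u 1 0)) (kc (u o2 0)).
have dx := jder_d3_param (jder_crd0 0) (jder_crd0 1) (jder_crd0 o2)
  (kc (u' 0 0)) (kc (u' 1 0)) (kc (u' o2 0)) (kc (b 0 0)) (kc (b 1 0)) (kc (b o2 0)).
have p'0 : omega b u (derivI (phi e) t) < 0 by rewrite omegaC.
have x0 : x t < 0 by rewrite /x omegaC omegaC.
have np' := near_slice (P := fun f r => omega b u (derivI (phi f) r) < 0) (jcont_near_lt0 (jder_jcontr dp) p'0).
have nx := near_slice (P := fun f r => omega u' b (phi f r) < 0) (jcont_near_lt0 dx.1 x0).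
have pt : p t = 0 by rewrite /p /omega /d3 -/u; ring.
have pE (r q : I) : p r = d3 (b 0 0) (b 1 0) (b o2 0) (u 0 0) (u 1 0) (u o2 0)
  (crd 0 0 e r) (crd 0 1 e r) (crd 0 o2 e r) by [].
have [d d0 dH] := (nbhs_unitIP _ _).1 (filterI np' (filterI nx nz)).
have nd : nbhs t [set r : I | `|\val r - \val t| < d] by apply/nbhs_unitIP; exists d.
have [s1 [s1t _ /= s1d]] := nbhs_unitI_left nd tgt0.
have [s2 [s2t _ /= s2d]] := nbhs_unitI_right nd tlt1.
have [_ [/= x1 z1]] := dH _ s1d; have [_ [/= x2 z2]] := dH _ s2d.
have {}z1 : 0 < omega u u' (phi e s1).
  by apply: z1; apply/eqP => st; move: s1t; rewrite st ltxx.
have {}z2 : 0 < omega u u' (phi e s2).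
  by apply: z2; apply/eqP => st; move: s2t; rewrite st ltxx.
have p1 : 0 < p s1.
  have [c [/andP[sc ct'] pc]] := jder_MVT e dp s1t.
  have {pc} : p t - p s1 = omega b u (derivI (phi e) c) * (\val t - \val s1) := pc.
  rewrite pt sub0r => /eqP; rewrite eqr_oppLR => /eqP ->.
  have cd : `|\val c - \val t| < d.
    move: s1d; rewrite !ltr0_norm ?subr_lt0// => s1d.
    by apply: lt_trans s1d; rewrite ltrN2 ltrD2r.
  have [/= c0 _] := dH c cd.
  by rewrite -mulrN opprB nmulr_rgt0// subr_lt0.
have p2 : p s2 < 0.
  have [c [/andP[sc ct'] pc]] := jder_MVT e dp s2t.
  have {pc} : p s2 - p t = omega b u (derivI (phi e) c) * (\val s2 - \val t) := pc.
  rewrite pt subr0 => ->.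
  have cd : `|\val c - \val t| < d.
    move: s2d; rewrite !gtr0_norm ?subr_gt0// => s2d.
    by apply: lt_trans s2d; rewrite ltrD2r.
  have [/= c0 _] := dH c cd.
  by rewrite nmulr_rlt0// subr_gt0.
set v1 := phi e s1 in x1 z1; set v2 := phi e s2 in x2 z2.
have Gneg v : 0 < omega u u' b * v -> v < 0 by rewrite nmulr_rgt0.
have D0 : omega v1 v2 b < 0.
  apply: Gneg.
  have -> : omega u u' b * omega v1 v2 b =
      omega u' b v1 * omega b u v2 - omega u' b v2 * omega b u v1.
    by rewrite /omega /d3; ring.
  rewrite subr_gt0 (lt_trans (y := 0))//; first by rewrite nmulr_rlt0.
  by rewrite nmulr_rgt0.
have c3 : omega v1 v2 u < 0.
  apply: Gneg.
  have -> : omega u u' b * omega v1 v2 u =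
      omega b u v1 * omega u u' v2 - omega u u' v1 * omega b u v2.
    by rewrite /omega /d3; ring.
  rewrite subr_gt0 (lt_trans (y := 0))//; first by rewrite pmulr_rlt0.
  by rewrite mulr_gt0.
have c1 : omega u v2 b < 0 by rewrite omegaC omegaC.
have c2 : omega v1 u b < 0 by rewrite omega_swap omegaC omegaC oppr_lt0.
(* The determinant of v1, v2, b and the three Cramer numerators of u are all negative. The
   numerators stay negative near u, so a full neighbourhood of u has positive coordinates. *)
apply: nV; rewrite /interior /=.
have n1 : \forall v \near u, omega v2 b v < 0.
  rewrite omegaC in c1.
  exact: (@omega_continuous _ _ _ _ _ (open_nbhs_nbhs (conj (@open_lt _ 0) c1))).
have n2 : \forall v \near u, omega b v1 v < 0.
  rewrite -omegaC in c2.
  exact: (@omega_continuous _ _ _ _ _ (open_nbhs_nbhs (conj (@open_lt _ 0) c2))).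
have n3 : \forall v \near u, omega v1 v2 v < 0.
  exact: (@omega_continuous _ _ _ _ _ (open_nbhs_nbhs (conj (@open_lt _ 0) c3))).
apply: filterS3 n1 n2 n3 => v m1 m2 m3.
apply: subset_closure.
rewrite -omegaC in m1; rewrite omegaC in m2.
exists 2%N, (fun i => [:: omega v v2 b / omega v1 v2 b; omega v1 v b / omega v1 v2 b;
   omega v1 v2 v / omega v1 v2 b]`_i), (fun i => nth s1 [:: s1; s2; s] i).
split; last by rewrite sum_ord3 /= -omega_cramer// lt_eqF.
by elim/ord3P => /=; rewrite -mulrNN -invrN divr_gt0// oppr_gt0.
Qed.

Lemma convex_tangent_ge0 e (t s : I) : convex_curve (phi e) ->
  0 <= omega (phi e t) (derivI (phi e) t) (phi e s).
Proof.
move=> cvx.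
apply: (@ge0_of_interior _ (fun t => omega (phi e t) (derivI (phi e) t) (phi e s))); last first.
  by move=> r r01; exact: convex_tangent_ge0_interior.
have c0 j : jcont (crd 0 j) := (jder_crd0 j).1.
have c1 j : jcont (crd 1 j) := (jder_crd1 j).1.
have ks j : jcont (fun (_ : E) (_ : I) => phi e s j 0) by exact: jcont_cst.
have H := jcontD (jcontB
  (jcontM (c0 0) (jcontB (jcontM (c1 1) (ks o2)) (jcontM (c1 o2) (ks 1))))
  (jcontM (c0 1) (jcontB (jcontM (c1 0) (ks o2)) (jcontM (c1 o2) (ks 0)))))
  (jcontM (c0 o2) (jcontB (jcontM (c1 0) (ks 1)) (jcontM (c1 1) (ks 0)))).
exact: (@jcont_slice _ _ _ e H).
Qed.

(** The weak inequalities are two instances of the supporting tangent planes: the plane at [t]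
    tested on the starting point gives [arc_m], and the plane at the start tested on [t] gives Y'(0)
    Z. Strictness comes from the degenerate cases, where the curve would meet e1 or - e1 inside. *)
Lemma arcP_of_convex e : convex_curve (phi e) -> arcP e.
Proof.
move=> cvx; have [simp _] := cvx.
pose m := arc_m (crd 0 1) (crd 1 1) (crd 0 o2) (crd 1 o2).
have dm := jder_arc_m (jder_crd0 1) (jder_crd1 1) (jder_crd0 o2) (jder_crd1 o2).
have mE t : m e t = omega (phi e t) (derivI (phi e) t) (phi e 0I).
  have := crd00 e; have := crd01 e; have := crd02 e.
  rewrite /m /arc_m /omega /d3 /crd /= => -> -> ->; ring.
have m_ge0 t : 0 <= m e t by rewrite mE; exact: convex_tangent_ge0.
have Z_ge0 t : 0 <= crd 0 o2 e t.
  have := convex_tangent_ge0 0I t cvx.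
  have -> : omega (phi e 0I) (derivI (phi e) 0I) (phi e t) = crd 1 1 e 0I * crd 0 o2 e t.
    have := crd00 e; have := crd01 e; have := crd02 e; have := crd12 e.
    rewrite /omega /d3 /crd /= => -> -> -> ->; ring.
  by rewrite pmulr_rge0// crd11.
have m_gt0 (t : I) : 0 < \val t < 1 -> 0 < m e t.
  move=> t01; rewrite lt_neqAle m_ge0 andbT; apply/eqP => /esym mt.
  have m't : arc_m' (crd 0 1) (crd 2 1) (crd 0 o2) (crd 2 o2) e t = 0.
    by apply: (near_min_interior dm mt) => //; apply: filterE.
  have [Yt Zt] := arc_m_degenerate crd_det_gt0 mt m't.
  have [_ /(_ t) + _ _ _] := phiX e.
  rewrite /sphere /= sum_ord3 [phi e t 1 0]Yt [phi e t o2 0]Zt expr0n /= !addr0 => /eqP.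
  rewrite sqrf_eq1 => /orP[/eqP Xt|/eqP Xt].
    (* Passing through e1 again before the final time contradicts simplicity. *)
    have t0 : \val 0I < \val t by case/andP: t01.
    have := simp 0I t t0; case=> [|_ t1].
      apply: phi_inj; apply: ord3P;
        by rewrite ?crd00 ?crd01 ?crd02 ?Yt ?Zt// -Xt.
    by move: t01; rewrite t1 /= ltxx andbF.
  (* Passing through - e1: every tangent plane has both e1 and - e1 on its nonnegative side, so [m]
     vanishes identically, against its positivity just after the start. *)
  have m0 s : m e s = 0.
    apply/eqP; rewrite eq_le m_ge0 andbT.
    have := convex_tangent_ge0 s t cvx.
    have -> : omega (phi e s) (derivI (phi e) s) (phi e t) = - m e s.
      by rewrite /omega /d3 [phi e t 1 0]Yt [phi e t o2 0]Zt Xt /m /arc_m /crd /=; ring.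
    by rewrite oppr_ge0.
  have [r [_ r0 /(_ r0)[_]]] := nbhs_unitI_interior (near_slice
    (P := fun e t => t != 0I -> 0 < crd 0 o2 e t /\ 0 < m e t)
    (start_near (jder_crd0 1) (jder_crd1 1) (jder_crd0 o2) (jder_crd1 o2)
      crd_det_gt0 crd00 crd01 crd02 crd11 crd12 e)).
  by rewrite m0 ltxx.
move=> t t01; split; last exact: m_gt0.
rewrite lt_neqAle Z_ge0 andbT; apply/eqP => /esym Zt.
have Z't : crd 1 o2 e t = 0.
  by apply: (near_min_interior (jder_crd0 o2) Zt) => //; apply: filterE.
by have := m_gt0 t t01; rewrite /m /arc_m Zt Z't mulr0 mul0r subrr ltxx.
Qed.

Lemma arcP_open e : arcP e -> \forall f \near e, arcP f.
Proof.
exact: (positive_arc_open (jder_crd0 1) (jder_crd1 1) (jder_crd0 o2) (jder_crd1 o2)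
  crd_det_gt0 crd00 crd01 crd02 crd11 crd12 (crd_end 1) (crd_end o2) crd_end_flag).
Qed.

Lemma arcP_closed e : closure arcP e -> arcP e.
Proof.
exact: (positive_arc_closed (jder_crd0 1) (jder_crd1 1) (jder_crd0 o2) (jder_crd1 o2)
  crd_det_gt0 crd00 crd01 crd02 crd11 crd12).
Qed.

End XQFamily.

(** * Reparametrization *)

Lemma unitI_connected (R : realType) : connected [set: unitI R].
Proof.
have -> : [set: unitI R] = clamp @` `[0, 1]%classic.
  apply/esym/seteqP; split=> // t _; exists (\val t); last exact: clamp_val.
  by rewrite /= in_itv /= unitI_ge0 unitI_le1.
apply: connected_continuous_connected; first exact: segment_connected.
apply: continuous_subspaceT; exact: clamp_continuous.
Qed.

Lemma IVT_unitI (R : realType) (f : unitI R -> R) (a b : unitI R) (v : R) :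
  continuous f -> \val a <= \val b -> f a <= v <= f b ->
  exists c : unitI R, \val a <= \val c <= \val b /\ f c = v.
Proof.
move=> cf ab /andP[av vb].
have [| |c] := @IVT R (fun x => f (clamp x)) _ _ v ab.
- apply: continuous_subspaceT => x.
  by apply: (@continuous_comp _ _ _ clamp f); [exact: clamp_continuous|exact: cf].
- by rewrite !clamp_val ge_min av le_max vb orbT.
rewrite in_itv /= => /andP[ac cb] fc; exists (clamp c).
rewrite val_clamp ?ac//.
by rewrite (le_trans (unitI_ge0 a) ac) (le_trans cb (unitI_le1 b)).
Qed.

Lemma primitive_unitI (R : realType) (w : unitI R -> R) : continuous w ->
  exists th : unitI R -> R, [/\ th (t0 R) = 0, continuous th &
    forall a b : unitI R, \val a < \val b -> exists c : unitI R,
      \val a <= \val c <= \val b /\ th b - th a = w c * (\val b - \val a)].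
Proof.
move=> cw; pose f x := w (clamp x).
have cf : continuous f.
  by move=> x; apply: (@continuous_comp _ _ _ clamp w); [exact: clamp_continuous|exact: cw].
(* Integrating the clamped extension over a larger interval makes 0 and 1 interior points, so the
   fundamental theorem and continuity apply there too. *)
have intf : (@lebesgue_measure R).-integrable `[-1, 2] (EFin \o f).
  apply: continuous_compact_integrable; first exact: segment_compact.
  by apply: continuous_subspaceT.
pose F (x : R) : R := (\int[@lebesgue_measure R]_(t in [set` `[-1, x]]) (f t))%R.
have dF (x : R) : -1 < x -> x < 2 -> is_derive x 1 F (f x).
  move=> x1 x2; have [dF fx] := continuous_FTC1_closed x2 intf x1 (cf x).
  by apply: DeriveDef; [exact: dF|rewrite -derive1E].
have cF (x : R) : -1 < x -> x < 2 -> {for x, continuous F}.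
  move=> x1 x2; have [dFx _] := dF x x1 x2.
  exact/differentiable_continuous/derivable1_diffP.
have b0 (t : unitI R) : -1 < (\val t : R) by apply: lt_le_trans (unitI_ge0 t); rewrite ltrN10.
have b1 (t : unitI R) : (\val t : R) < 2 by apply: le_lt_trans (unitI_le1 t) _; rewrite ltr1n.
exists (fun t : unitI R => F (\val t) - F 0); split.
- by rewrite /= subrr.
- move=> t; have H : {for t, continuous (fun t : unitI R => F (\val t))}.
    apply: (@continuous_comp _ _ _ (fun t : unitI R => \val t : R) F).
      exact: val_unitI_continuous.
    exact: cF.
  have K : {for t, continuous (fun _ : unitI R => F 0)} by exact: for_continuous_cst.
  exact: (cvgB H K).
- move=> a b ab.
  have [||c] := @MVT R F f _ _ ab.
  + move=> x; rewrite in_itv /= => /andP[ax xb].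
    by apply: dF; [exact: lt_trans (b0 a) ax|exact: lt_trans xb (b1 b)].
  + apply: continuous_in_subspaceT => x; rewrite inE /= in_itv /= => /andP[ax xb].
    by apply: cF; [exact: lt_le_trans (b0 a) ax|exact: le_lt_trans xb (b1 b)].
  rewrite in_itv /= => /andP[/ltW ac /ltW cb] FE; exists (clamp c).
  rewrite val_clamp ?ac ?cb//; last first.
    by rewrite (le_trans (unitI_ge0 a) ac) (le_trans cb (unitI_le1 b)).
  by split=> //; rewrite opprB addrA subrK FE.
Qed.

Section Tools.
Variables (R : realType) (E : topologicalType).
Local Notation I := (unitI R).
Local Notation "0I" := (t0 R).
Local Notation "1I" := (t1 R).
Implicit Types (F G W th : E -> I -> R).

Lemma jder_incr F F' e (a b : I) : jder F F' -> (forall t, 0 < F' e t) ->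
  \val a < \val b -> F e a < F e b.
Proof.
move=> dF F'0 ab; have [c [_ FE]] := jder_MVT e dF ab.
by rewrite -subr_gt0 FE mulr_gt0// subr_gt0.
Qed.

Lemma jder_const F F' e : jder F F' -> (forall t, F' e t = 0) ->
  forall t, F e t = F e 0I.
Proof.
move=> dF F'0 t; have [->//|t0] := eqVneq t 0I.
have t_gt0 : \val 0I < \val t.
  by rewrite lt_neqAle unitI_ge0 andbT; apply: contra t0 => /eqP H; apply/eqP/val_inj.
have [c [_ FE]] := jder_MVT e dF t_gt0.
by apply/eqP; rewrite -subr_eq0 FE F'0 mul0r.
Qed.

(** Primitives are chosen for each parameter separately. Joint continuity follows because, by the
    mean value theorem, two of them differ by at most the uniform distance of their integrands. *)
Lemma jder_primitive W : jcont W -> exists th, jder th W /\ forall e, th e 0I = 0.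
Proof.
move=> cW; have H e := cid (primitive_unitI (@jcont_slice _ _ _ e cW)).
pose th e := sval (H e).
have th0 e : th e 0I = 0 by have [] := svalP (H e).
have cth e : continuous (th e) by have [] := svalP (H e).
have mvt e (a b : I) : \val a < \val b -> exists c : I,
    \val a <= \val c <= \val b /\ th e b - th e a = W e c * (\val b - \val a).
  by have [_ _] := svalP (H e); apply.
exists th; split=> //.
suff cJ : jcont th by apply: jder_of_MVT.
have dth e : jder (fun (_ : E) t => th e t) (fun _ t => W e t).
  apply: jder_of_MVT.
  - move=> p; apply: (@continuous_comp _ _ _ (snd : E * I -> I) (th e)).
      exact: for_continuous_snd.
    exact: cth.
  - move=> p; apply: (@continuous_comp _ _ _ (snd : E * I -> I) (W e)).
      exact: for_continuous_snd.
    exact: jcont_slice.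
  - by move=> _; exact: mvt.
move=> [e0 s0]; apply/cvgrPdist_lt => eps eps0.
have eps2 : 0 < eps / 2 by rewrite divr_gt0.
have nW : \forall e \near e0, forall t, `|W e0 t - W e t| < eps / 2.
  apply: (near_unitI_all (P := fun e t => `|W e0 t - W e t| < eps / 2)) => t.
  have c0 : jcont (fun (_ : E) t => W e0 t) := jder_jcontr (dth e0).
  have := jcontB c0 cW (x := (e0, t)).
  by rewrite /continuous_at /= subrr => /cvgr0Pnorm_lt/(_ _ eps2).
have nth : \forall t \near s0, `|th e0 s0 - th e0 t| < eps / 2.
  by have /cvgrPdist_lt/(_ _ eps2) := cth e0 s0.
exists ([set e | forall t, `|W e0 t - W e t| < eps / 2],
        [set t | `|th e0 s0 - th e0 t| < eps / 2]) => //.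
move=> [e t] [/= He Ht].
have D : `|th e0 t - th e t| <= eps / 2.
  have [->|t0] := eqVneq t 0I; first by rewrite !th0 subrr normr0 ltW.
  have t_gt0 : \val 0I < \val t.
    by rewrite lt_neqAle unitI_ge0 andbT; apply: contra t0 => /eqP Ht0; apply/eqP/val_inj.
  have [c [_]] := jder_MVT e0 (jderB (dth e0) (dth e)) t_gt0.
  rewrite !th0 subrr !subr0 => ->.
  rewrite normrM -[leRHS]mulr1 ler_pM//; first exact/ltW/He.
  by rewrite ger0_norm ?unitI_ge0 ?unitI_le1.
rewrite (_ : _ - _ = (th e0 s0 - th e0 t) + (th e0 t - th e t)); last by ring.
by rewrite (le_lt_trans (ler_normD _ _))// [eps]splitr ltr_leD.
Qed.

Lemma jder_comp_smooth (f f' : R -> R) th W : (forall x : R, is_derive x 1 f (f' x)) ->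
  continuous f' -> jder th W -> jder (fun e t => f (th e t)) (fun e t => f' (th e t) * W e t).
Proof.
move=> df cf' dth.
have cf : continuous f.
  move=> x; have [dfx _] := df x.
  exact/differentiable_continuous/derivable1_diffP.
have cc g : continuous g -> jcont (fun e t => g (th e t)).
  move=> cg p; apply: (@continuous_comp _ _ _ (fun p : E * I => th p.1 p.2) g).
    exact: dth.1.
  exact: cg.
apply: jder_of_MVT; [exact: cc|exact: jcontM (cc _ cf') (jder_jcontr dth)|].
move=> e a b ab.
have [||c] := @MVT R (fun y => f (th e (clamp y)))
   (fun y => f' (th e (clamp y)) * W e (clamp y)) _ _ ab.
- move=> x; rewrite in_itv /= => /andP[ax xb].
  have x01 : 0 < x < 1 by rewrite (le_lt_trans (unitI_ge0 a) ax) (lt_le_trans xb (unitI_le1 b)).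
  have dx := jder_is_derive e dth x01.
  exact: (@is_derive1_comp R f (fun y => th e (clamp y)) x).
- apply: continuous_subspaceT => y.
  apply: (@continuous_comp _ _ _ (fun y => th e (clamp y)) f); last exact: cf.
  apply: (@continuous_comp _ _ _ clamp (th e)); first exact: clamp_continuous.
  exact: (@jcont_slice _ _ _ e dth.1).
rewrite in_itv /= => /andP[ac cb]; rewrite !clamp_val => ->.
exists (clamp c); rewrite val_clamp ?(ltW ac) ?(ltW cb)//.
by rewrite (ltW (le_lt_trans (unitI_ge0 a) ac)) (ltW (lt_le_trans cb (unitI_le1 b))).
Qed.

Section Reparam.
Variables th W th0 W0 : E -> I -> R.
Hypotheses (dth : jder th W) (dth0 : jder th0 W0).
Hypotheses (W_gt0 : forall e t, 0 < W e t) (W0_gt0 : forall e t, 0 < W0 e t).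
Hypotheses (th_0 : forall e, th e 0I = th0 e 0I) (th_1 : forall e, th e 1I = th0 e 1I).

(** [h] is the inverse of [th0] composed with [th]. Its derivative W / W0(h) contains no derivative
    of [W] or [W0], hence the gain of one order. *)
Lemma monotone_reparam : exists h : E -> I -> I, exists h' : E -> I -> R,
  [/\ forall e t, th0 e (h e t) = th e t, jder (fun e t => \val (h e t)) h',
      forall e t, 0 < h' e t, forall e, h e 0I = 0I /\ h e 1I = 1I
    & forall n, J n W -> J n W0 -> J n.+1 (fun e t => \val (h e t))].
Proof.
have ex e t : exists s : I, th0 e s = th e t.
  have i01 : \val 0I <= \val 1I :> R by exact: ler01.
  have le_th (a b : I) : \val a <= \val b -> th e a <= th e b.
    rewrite le_eqVlt => /predU1P[/val_inj ->//|ab].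
    by rewrite ltW// (jder_incr dth).
  have [||s [_ <-]] := @IVT_unitI R (th0 e) _ _ (th e t) _ i01; last by exists s.
    exact: jcont_slice dth0.1.
  by rewrite -th_0 -th_1 !le_th// ?unitI_ge0 ?unitI_le1.
pose h e t := sval (cid (ex e t)).
have hE e t : th0 e (h e t) = th e t by rewrite /h; case: cid.
have th0_lt e (a b : I) : th0 e a < th0 e b -> \val a < \val b.
  move=> ab; rewrite ltNge; apply/negP; rewrite le_eqVlt => /predU1P[/val_inj ba|ba].
    by rewrite ba ltxx in ab.
  by have := lt_trans ab (jder_incr dth0 (W0_gt0 e) ba); rewrite ltxx.
have th0_inj e (a b : I) : th0 e a = th0 e b -> a = b.
  move=> ab; apply: val_inj; apply/eqP; rewrite eq_le !leNgt; apply/andP; split; apply/negP => lt_ab;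
    by have := jder_incr dth0 (W0_gt0 e) lt_ab; rewrite ab ltxx.
have h0 e : h e 0I = 0I by apply: (th0_inj e); rewrite hE th_0.
have h1 e : h e 1I = 1I by apply: (th0_inj e); rewrite hE th_1.
have ch : jcont (fun e t => \val (h e t)).
  move=> [e0 s0]; apply/cvgrPdist_lt => eps eps0.
  have cmp (z : I) : jcont (fun e t => th0 e z - th e t).
    have cz : jcont (fun (e : E) (t : I) => \val ((fun _ _ => z) e t : I) : R) by exact: jcont_cst.
    exact: jcontB (jcont_comp dth0.1 cz) dth.1.
  (* With z the time [h e0 s0] + eps, the strict inequality between [th] and [th0 e z] persists
     nearby, and monotonicity of [th0] reads it as h < z. A barrier beyond 1 needs no argument. *)
  have up : \forall p \near (e0, s0), \val (h p.1 p.2) < \val (h e0 s0) + eps.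
    have [le1|gt1] := leP (\val (h e0 s0) + eps) 1; last first.
      by apply: filterE => p; apply: le_lt_trans gt1; exact: unitI_le1.
    have vz : \val (clamp (\val (h e0 s0) + eps)) = \val (h e0 s0) + eps.
      by rewrite val_clamp// le1 andbT addr_ge0 ?unitI_ge0// ltW.
    have pos : 0 < th0 e0 (clamp (\val (h e0 s0) + eps)) - th e0 s0.
      by rewrite subr_gt0 -hE (jder_incr dth0)// vz ltrDl.
    have := jcont_near_gt0 (cmp (clamp (\val (h e0 s0) + eps))) pos.
    apply: filterS => -[e t] /=; rewrite subr_gt0 -hE => /th0_lt.
    by rewrite vz.
  have dn : \forall p \near (e0, s0), \val (h e0 s0) - eps < \val (h p.1 p.2).
    have [ge0|lt0] := leP 0 (\val (h e0 s0) - eps); last first.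
      by apply: filterE => p; apply: lt_le_trans lt0 _; exact: unitI_ge0.
    have vz : \val (clamp (\val (h e0 s0) - eps)) = \val (h e0 s0) - eps.
      rewrite val_clamp// ge0 lerBlDr /=.
      by rewrite (le_trans (unitI_le1 _))// lerDl ltW.
    have neg : th0 e0 (clamp (\val (h e0 s0) - eps)) - th e0 s0 < 0.
      by rewrite subr_lt0 -hE (jder_incr dth0)// vz ltrBlDr ltrDl.
    have := jcont_near_lt0 (cmp (clamp (\val (h e0 s0) - eps))) neg.
    apply: filterS => -[e t] /=; rewrite subr_lt0 -hE => /th0_lt.
    by rewrite vz.
  apply: filterS2 up dn => -[e t] /= up dn.
  by rewrite distrC ltr_norml ltrBrDr addrC dn ltrBlDr addrC up.
have [_ [q [cq qE qd]]] := dth; have [_ [q0 [cq0 q0E q0d]]] := dth0.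
have q0_gt0 e (a b : I) : 0 < q0 e a b.
  have [->|ab] := eqVneq a b; first by rewrite q0d.
  have vab : \val a != \val b by rewrite val_eqE.
  case: (ltgtP (\val a) (\val b)) vab => // lt_ab _.
    have := jder_incr dth0 (W0_gt0 e) lt_ab; rewrite -subr_gt0 q0E.
    by rewrite pmulr_lgt0// subr_gt0.
  have := jder_incr dth0 (W0_gt0 e) lt_ab; rewrite -subr_lt0 q0E.
  by rewrite nmulr_llt0// subr_lt0.
pose h' e t := W e t * (W0 e (h e t))^-1.
have dh : jder (fun e t => \val (h e t)) h'.
  split=> //; exists (fun e a b => q e a b * (q0 e (h e a) (h e b))^-1); split.
  - move=> p; apply: cvgM; first exact: cq.
    apply: cvgV; first by rewrite lt0r_neq0.
    exact: (jcont2_comp cq0 ch).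
  - move=> e a b; rewrite [RHS]mulrAC -qE -!hE q0E.
    by rewrite [RHS]mulrC mulKf// lt0r_neq0.
  - by move=> e a; rewrite qd q0d.
exists h, h'; split=> //.
  by move=> e t; rewrite divr_gt0.
(* Bootstrap: [h'] depends on [h] through [W0 e (h e t)], so each order of regularity of [h] yields
   the next one. *)
move=> n JW JW0; have : forall m, (m <= n)%N -> J m.+1 (fun e t => \val (h e t)).
  elim=> [|m IH] mn.
    by exists h'; split=> //; exact: jder_jcontr dh.
  exists h'; split=> //.
  apply: JM; first exact: J_le JW.
  apply: JV; first by move=> e t; rewrite lt0r_neq0.
  by apply: J_comp; [exact: J_le JW0|exact: IH (ltnW mn)].
exact.
Qed.

End Reparam.

(** The minimum over time is continuous in the parameter: upper bounds come from testing at the old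
    minimizer, lower bounds from compactness. It provides thresholds that vary continuously with the
    curve. *)
Lemma positive_minimum F : jcont F -> (forall e t, 0 < F e t) ->
  exists f : E -> R, [/\ continuous f, forall e, 0 < f e & forall e t, f e <= F e t].
Proof.
move=> cF F0.
have ex e : exists c : I, forall t, F e c <= F e t.
  have [||c _ H] := @compact_EVT_min I R (F e) setT _ (@unitI_compact R).
  - by exists 0I.
  - by apply: continuous_subspaceT; exact: jcont_slice.
  - by exists c => t; apply: H; rewrite inE.
pose c e := sval (cid (ex e)).
have cH e t : F e (c e) <= F e t by rewrite /c; case: cid.
exists (fun e => F e (c e)); split=> // e0.
apply/cvgrPdist_lt => eps eps0.
have up : \forall e \near e0, F e (c e0) < F e0 (c e0) + eps.
  have := @jcont_param_slice _ _ F (c e0) cF e0 => /cvgrPdist_lt/(_ _ eps0).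
  apply: filterS => e; rewrite ltr_norml => /andP[H _].
  by move: H; rewrite ltrNl opprB ltrBlDl.
have dn : \forall e \near e0, forall t, F e0 (c e0) - eps < F e t.
  apply: (near_unitI_all (P := fun e t => F e0 (c e0) - eps < F e t)) => t.
  pose l : R := F e0 (c e0) - eps.
  have H : jcont (fun e t => F e t - l) := jcontB cF (@jcont_cst R E l).
  have pos : 0 < F e0 t - l.
    by rewrite subr_gt0 (lt_le_trans _ (cH e0 t))// ltrBlDr ltrDl.
  by have := jcont_near_gt0 H pos; apply: filterS => p; rewrite subr_gt0.
apply: filterS2 up dn => e up dn.
rewrite distrC ltr_norml ltrBrDr addrC dn ltrBlDr addrC /=.
exact: le_lt_trans (cH e _) up.
Qed.

End Tools.

(** The cosine of y - x is 1, while half of a positive difference would lie in (0, pi), where the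
    sine is positive. Excluding 0 from the interval keeps it from being confused with 2 pi. *)
Lemma cos_sin_inj (R : realType) (x y : R) : 0 < x <= pi *+ 2 -> 0 < y <= pi *+ 2 ->
  cos x = cos y -> sin x = sin y -> x = y.
Proof.
wlog xy : x y / x <= y.
  move=> H xI yI cxy sxy; case: (leP x y) => [/H|/ltW /H] E; first exact: E.
  by apply/esym/E.
move=> /andP[x0 x2] /andP[y0 y2] cxy sxy.
apply/eqP; rewrite eq_le xy /= leNgt; apply/negP => lt_xy.
pose z := (y - x) / 2.
have zE : y - x = z *+ 2 by rewrite /z -mulr_natr divfK// pnatr_eq0.
have : cos (y - x) = 1 by rewrite cosB cxy sxy -!expr2 cos2Dsin2.
rewrite zE cos_mulr2n cos2sin2 => /eqP.
have sz : 0 < sin z.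
  apply: sin_gt0_pi; rewrite divr_gt0 ?subr_gt0//= ltr_pdivrMr//.
  rewrite mulr_natr; apply: lt_le_trans y2.
  by rewrite ltrBlDr ltrDl.
rewrite -subr_eq0 => /eqP H.
have : sin z ^+ 2 *+ 2 = 0 by move: H; rewrite !mulr2n; lra.
by move/eqP; rewrite mulrn_eq0 /= expf_eq0 /= gt_eqF.
Qed.

(** * Polar angle *)

Section Angle.
Variables (R : realType) (E : topologicalType).
Local Notation I := (unitI R).
Local Notation "0I" := (t0 R).
Local Notation "1I" := (t1 R).
Variables (P1 P1' P2 P2' : E -> I -> R).
Hypotheses (dP1 : jder P1 P1') (dP2 : jder P2 P2').
Hypothesis W_gt0 : forall e t, 0 < P1 e t * P2' e t - P2 e t * P1' e t.
Hypotheses (P10 : forall e, P1 e 0I = 1) (P20 : forall e, P2 e 0I = 0).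

Definition polar_radius e t := Num.sqrt (P1 e t * P1 e t + P2 e t * P2 e t).

Lemma polar_radius2_gt0 e t : 0 < P1 e t * P1 e t + P2 e t * P2 e t.
Proof.
rewrite -!expr2 lt_neqAle addr_ge0 ?sqr_ge0// andbT eq_sym paddr_eq0 ?sqr_ge0//.
rewrite !expf_eq0 /=; apply/negP => /andP[/eqP H1 /eqP H2].
by have := W_gt0 e t; rewrite H1 H2 !mul0r subrr ltxx.
Qed.

Lemma polar_radius_gt0 e t : 0 < polar_radius e t.
Proof. by rewrite sqrtr_gt0 polar_radius2_gt0. Qed.

Lemma polar_radius_sq e t : polar_radius e t * polar_radius e t = P1 e t * P1 e t + P2 e t * P2 e t.
Proof. by rewrite -expr2 sqr_sqrtr// ltW// polar_radius2_gt0. Qed.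

Lemma J_polar_radius n : J n P1 -> J n P2 -> J n polar_radius.
Proof.
move=> J1 J2; apply: J_sqrt; first exact: polar_radius2_gt0.
by apply: JD; exact: JM.
Qed.

Definition angular_speed e t :=
  (P1 e t * P2' e t - P2 e t * P1' e t) * (P1 e t * P1 e t + P2 e t * P2 e t)^-1.

Lemma angular_speed_gt0 e t : 0 < angular_speed e t.
Proof. by rewrite mulr_gt0// invr_gt0 polar_radius2_gt0. Qed.

Lemma J_angular_speed n : J n P1 -> J n P1' -> J n P2 -> J n P2' -> J n angular_speed.
Proof.
move=> J1 J1' J2 J2'; apply: JM; first by apply: JB; exact: JM.
apply: JV; first by move=> e t; rewrite lt0r_neq0// polar_radius2_gt0.
by apply: JD; exact: JM.
Qed.

Lemma unit_direction_der : 
  jder (fun e t => P1 e t * (polar_radius e t)^-1)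
       (fun e t => - (angular_speed e t * (P2 e t * (polar_radius e t)^-1))) /\
  jder (fun e t => P2 e t * (polar_radius e t)^-1)
       (fun e t => angular_speed e t * (P1 e t * (polar_radius e t)^-1)).
Proof.
have dr := jder_sqrt polar_radius2_gt0 (jderD (jderM dP1 dP1) (jderM dP2 dP2)).
have r0 e t : polar_radius e t != 0 by rewrite lt0r_neq0// polar_radius_gt0.
have dV := jderV r0 dr.
have aux (p p' q q' r : R) : r != 0 -> r * r = p * p + q * q ->
    p' * r^-1 + p * (- ((p' * p + p * p' + (q' * q + q * q')) * (r + r)^-1) * (r^-1 * r^-1))
    = - ((p * q' - q * p') * (p * p + q * q)^-1 * (q * r^-1)).
  move=> rn0 rr; rewrite -rr.
  have rr0 : r + r != 0 by rewrite -mulr2n mulrn_eq0.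
  transitivity ((p' * (r * r) - p * (p * p' + q * q')) / (r * r * r)).
    by field; rewrite ?rn0 ?rr0.
  have -> : p' * (r * r) - p * (p * p' + q * q') = - ((p * q' - q * p') * q).
    by rewrite rr; ring.
  by field.
split.
- apply: (jder_eq (jderM dP1 dV)) => // e t.
  exact: aux (r0 e t) (polar_radius_sq e t).
- apply: (jder_eq (jderM dP2 dV)) => // e t.
  have rr : polar_radius e t * polar_radius e t = P2 e t * P2 e t + P1 e t * P1 e t.
    by rewrite polar_radius_sq addrC.
  have H := aux _ (P2' e t) _ (P1' e t) _ (r0 e t) rr.
  have -> : angular_speed e t * (P1 e t / polar_radius e t) =
      - ((P2 e t * P1' e t - P1 e t * P2' e t) / (P2 e t * P2 e t + P1 e t * P1 e t)
         * (P1 e t / polar_radius e t)).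
    by rewrite /angular_speed [P2 e t * P2 e t + _]addrC; ring.
  rewrite -H; congr (_ + _ * (- (_ / _) * _)); exact: addrC.
Qed.

(** Take the primitive of the angular speed. The scalar and cross products of (cos th, sin th) with
    the unit direction have zero derivative, so they keep their initial values 1 and 0. *)
Lemma angle_exists : exists th, [/\ jder th angular_speed, forall e, th e 0I = 0,
  forall e t, P1 e t = polar_radius e t * cos (th e t) &
  forall e t, P2 e t = polar_radius e t * sin (th e t)].
Proof.
have [d1 d2] := unit_direction_der.
have cW : jcont angular_speed.
  have [c1 c1'] := (dP1.1, jder_jcontr dP1); have [c2 c2'] := (dP2.1, jder_jcontr dP2).
  exact: (@J_angular_speed 0).
have [th [dth th0]] := jder_primitive cW.
have dC : jder (fun e t => cos (th e t)) (fun e t => - sin (th e t) * angular_speed e t).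
  apply: (jder_comp_smooth (@is_derive_cos R)) => // x.
  by apply: cvgN; exact: continuous_sin.
have dS := jder_comp_smooth (@is_derive_sin R) (@continuous_cos R) dth.
have r00 e : polar_radius e 0I = 1 by rewrite /polar_radius P10 P20 mulr1 mulr0 addr0 sqrtr1.
have A1 e t : P1 e t * (polar_radius e t)^-1 * cos (th e t) + P2 e t * (polar_radius e t)^-1 * sin (th e t) = 1.
  rewrite (jder_const (jderD (jderM d1 dC) (jderM d2 dS))) => [|s]; last by ring.
  by rewrite th0 cos0 sin0 P10 r00 invr1; ring.
have B0 e t : P2 e t * (polar_radius e t)^-1 * cos (th e t) - P1 e t * (polar_radius e t)^-1 * sin (th e t) = 0.
  rewrite (jder_const (jderB (jderM d2 dC) (jderM d1 dS))) => [|s]; last by ring.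
  by rewrite th0 cos0 sin0 P20; ring.
have r0 e t : polar_radius e t != 0 by rewrite lt0r_neq0// polar_radius_gt0.
exists th; split=> // e t.
- transitivity (polar_radius e t * (P1 e t * (polar_radius e t)^-1)); first by field; exact: r0.
  congr (_ * _); set p1 := P1 e t / polar_radius e t; set p2 := P2 e t / polar_radius e t.
  have H1 : p1 * cos (th e t) + p2 * sin (th e t) = 1 := A1 e t.
  have H2 : p2 * cos (th e t) - p1 * sin (th e t) = 0 := B0 e t.
  have -> : p1 = p1 * (cos (th e t) ^+ 2 + sin (th e t) ^+ 2) by rewrite cos2Dsin2 mulr1.
  transitivity (cos (th e t) * (p1 * cos (th e t) + p2 * sin (th e t))
     - sin (th e t) * (p2 * cos (th e t) - p1 * sin (th e t))); first by ring.
  by rewrite H1 H2; ring.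
- transitivity (polar_radius e t * (P2 e t * (polar_radius e t)^-1)); first by field; exact: r0.
  congr (_ * _); set p1 := P1 e t / polar_radius e t; set p2 := P2 e t / polar_radius e t.
  have H1 : p1 * cos (th e t) + p2 * sin (th e t) = 1 := A1 e t.
  have H2 : p2 * cos (th e t) - p1 * sin (th e t) = 0 := B0 e t.
  have -> : p2 = p2 * (cos (th e t) ^+ 2 + sin (th e t) ^+ 2) by rewrite cos2Dsin2 mulr1.
  transitivity (sin (th e t) * (p1 * cos (th e t) + p2 * sin (th e t))
     + cos (th e t) * (p2 * cos (th e t) - p1 * sin (th e t))); first by ring.
  by rewrite H1 H2; ring.
Qed.

(** If the angle exceeded 2 pi, it would equal 3 pi / 2 and then 2 pi at interior times: [P2] would
    be negative before an interior zero, which the last hypothesis forbids. *)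
Lemma angle_le_2pi th e : jder th angular_speed -> th e 0I = 0 ->
  (forall t, P2 e t = polar_radius e t * sin (th e t)) ->
  (forall s t : I, 0 < \val s -> \val s < \val t -> \val t < 1 -> P2 e t = 0 -> 0 < P2 e s) ->
  0 < th e 1I <= pi *+ 2.
Proof.
move=> dth th0 P2E sgn.
have i01 : \val 0I < \val 1I by exact: ltr01.
have th_incr (a b : I) : \val a < \val b -> th e a < th e b.
  by move=> ab; rewrite (jder_incr dth)// => t; exact: angular_speed_gt0.
have th_lt (a b : I) : th e a < th e b -> \val a < \val b.
  move=> ab; rewrite ltNge; apply/negP; rewrite le_eqVlt => /predU1P[/val_inj ba|ba].
    by rewrite ba ltxx in ab.
  by have := lt_trans ab (th_incr _ _ ba); rewrite ltxx.
apply/andP; split; first by rewrite -th0 th_incr.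
rewrite leNgt; apply/negP => th1.
have p0 : 0 < pi :> R by exact: pi_gt0.
have ivt (v : R) : 0 <= v <= th e 1I -> exists c : I, th e c = v.
  move=> v01; have [||c [_ <-]] := @IVT_unitI R (th e) _ _ v _ (ltW i01).
  - exact: jcont_slice dth.1.
  - by rewrite th0.
  - by exists c.
have [t tE] : exists t : I, th e t = pi *+ 2.
  by apply: ivt; rewrite mulrn_wge0 ?ltW.
have [s sE] : exists s : I, th e s = pi + pi / 2.
  apply: ivt; apply/andP; split; first by rewrite addr_ge0 ?divr_ge0// ltW.
  apply: le_trans (ltW th1).
  by rewrite [pi *+ 2]mulr2n {4}[pi]splitr addrA lerDl divr_ge0// ltW.
have := sgn s t.
have -> : 0 < \val s.
  by apply: (th_lt 0I s); rewrite th0 sE addr_gt0 ?divr_gt0.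
have -> : \val s < \val t.
  by apply: th_lt; rewrite sE tE [pi *+ 2]mulr2n {4}[pi]splitr addrA ltrDl divr_gt0.
have -> : \val t < 1 by apply: (th_lt t 1I); rewrite tE.
rewrite P2E tE sin2pi mulr0 P2E sE addrC sinDpi sin_pihalf mulrN1 => /(_ isT isT isT erefl).
by rewrite oppr_gt0 ltNge ltW ?polar_radius_gt0.
Qed.

End Angle.

(** * A common center of projection *)

Section Rotation.
Variables (R : realType) (Q : 'M[R]_3).
Hypothesis SQ : SO3 Q.

Lemma SO3_cols i j : Q 0 i * Q 0 j + Q 1 i * Q 1 j + Q o2 i * Q o2 j = (i == j)%:R.
Proof.
have [/matrixP/(_ i j) + _] := SQ.
by rewrite !mxE sum_ord3 !mxE.
Qed.

Lemma SO3_rows i j : Q i 0 * Q j 0 + Q i 1 * Q j 1 + Q i o2 * Q j o2 = (i == j)%:R.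
Proof.
have [/mulmx1C/matrixP/(_ i j) + _] := SQ.
by rewrite !mxE sum_ord3 !mxE.
Qed.

Lemma SO3_det : d3 (Q 0 0) (Q 1 0) (Q o2 0) (Q 0 1) (Q 1 1) (Q o2 1)
  (Q 0 o2) (Q 1 o2) (Q o2 o2) = 1.
Proof.
have [_ <-] := SQ.
transitivity (det3 (col 0 Q) (col 1 Q) (col o2 Q)); first by rewrite det3E /omega !mxE.
rewrite /det3; congr (\det _); apply/matrixP => i j; rewrite !mxE.
by elim/ord3P: j; rewrite /= mxE.
Qed.

(** Third coordinate of the identity Q e1 x Q e2 = Q e3; orthonormality of the rows isolates it from
    the determinant. *)
Lemma SO3_cofactor : Q 0 0 * Q 1 1 - Q 1 0 * Q 0 1 = Q o2 o2.
Proof.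
have r0 := SO3_rows o2 0; have r1 := SO3_rows o2 1; have r2 := SO3_rows o2 o2.
rewrite /= ?mulr0n ?mulr1n in r0 r1 r2.
have d := SO3_det.
pose w0 := Q 1 0 * Q o2 1 - Q o2 0 * Q 1 1.
pose w1 := Q o2 0 * Q 0 1 - Q 0 0 * Q o2 1.
pose w2 := Q 0 0 * Q 1 1 - Q 1 0 * Q 0 1.
transitivity (w0 * 0 + w1 * 0 + w2 * 1); first by rewrite /w2; ring.
rewrite -{1}r0 -r1 -r2.
transitivity (Q o2 o2 * d3 (Q 0 0) (Q 1 0) (Q o2 0) (Q 0 1) (Q 1 1) (Q o2 1)
  (Q 0 o2) (Q 1 o2) (Q o2 o2)).
  by rewrite /w0 /w1 /w2 /d3; ring.
by rewrite d mulr1.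
Qed.

Lemma SO3_last_row : Q o2 o2 = -1 -> Q o2 0 = 0 /\ Q o2 1 = 0.
Proof.
move=> Q22; have := SO3_rows o2 o2; rewrite eqxx Q22 mulrNN mulr1.
move=> /(canRL (addrK _))/eqP; rewrite mulr1n subrr -!expr2 paddr_eq0 ?sqr_ge0// !expf_eq0 /=.
by move=> /andP[/eqP -> /eqP ->].
Qed.

Lemma SO3_ge_N1 : -1 <= Q o2 o2.
Proof.
have := SO3_rows o2 o2; rewrite eqxx -!expr2 => H.
rewrite leNgt; apply/negP => lt.
have : 1 < Q o2 o2 ^+ 2.
  by rewrite expr2; nra.
by rewrite -[X in X < _](mulr1n 1) -H gtrDr; rewrite ltNge addr_ge0// sqr_ge0.
Qed.

End Rotation.

Lemma pos_add_mul (R : realType) (s a m : R) : 0 < s -> s * (2 * (1 - m)) <= a ->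
  0 <= a -> 0 < a + s * m.
Proof. by move=> s0 H a0; nra. Qed.

(* A direction seen positively by a convex curve together with all its
   tangents is e1 + Q e1 + s (e3 + Q e3) for small s > 0.  For s = 0 it is
   seen positively except at the two ends, where the summand e3 + Q e3 is
   seen positively because Q e3 <> - e3. *)
Section Center.
Variables (R : realType) (E : topologicalType) (k : option nat) (Q : 'M[R]_3).
Variable phi : E -> curves R k.
Local Notation I := (unitI R).
Local Notation "0I" := (t0 R).
Local Notation "1I" := (t1 R).
Hypothesis SQ : SO3 Q.
Hypothesis k2 : le_order 2 k.
Hypothesis cphi : continuous phi.
Hypothesis phiX : forall e, XQ k Q (phi e).
Hypothesis arcs : forall e, arcP phi e.

Local Notation c := (crd phi).
Let d0 j := jder_crd0 k2 cphi phiX j.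
Let d1 j := jder_crd1 k2 cphi phiX j.

Lemma Q20_ge0 : E -> 0 <= Q o2 0.
Proof. by move=> e; rewrite -(crd_end phiX o2 e); exact: (arc_Z_ge0 (d0 o2) (arcs e) 1I). Qed.

(** If Q e3 = - e3, then Z and Z' vanish at the end and local convexity gives Z'' < 0 there, so [Z]
    would be negative just before. The argument in [E] supplies the convex curve that this
    contradicts. *)
Lemma Q22_gt : E -> 0 < 1 + Q o2 o2.
Proof.
move=> e; rewrite -ltrBlDl sub0r lt_neqAle SO3_ge_N1// andbT eq_sym.
apply/eqP => Q22; have [Q20 Q21] := SO3_last_row SQ Q22.
have Z1 f : c 0%N o2 f 1I = 0 by rewrite (crd_end phiX).
have Z'1 f : c 1%N o2 f 1I = 0.
  by have [c1 _ [_ _ ->]] := crd_end_flag phiX f; rewrite Q21 mulr0.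
have Z''1 : c 2 o2 e 1I < 0.
  have := crd_det_gt0 phiX e 1I; have [c1 c10 [-> -> ->]] := crd_end_flag phiX e.
  rewrite !(crd_end phiX) Q20 Q21.
  rewrite (_ : d3 _ _ _ _ _ _ _ _ _ =
    c1 * (Q 0 0 * Q 1 1 - Q 1 0 * Q 0 1) * c 2 o2 e 1I); last by rewrite /d3; ring.
  by rewrite SO3_cofactor// Q22 mulrN1 mulNr oppr_gt0 pmulr_rlt0.
have H : \forall p \near (e, 1I), p.2 != 1I -> 0 < - c 0%N o2 p.1 p.2.
  apply: (near_sign2 (jderN (d0 o2)) (jderN (d1 o2))) => [f|f|].
  - by rewrite Z1 oppr0.
  - by rewrite Z'1 oppr0.
  - by rewrite oppr_gt0.
have [t [_ tn1 /(_ tn1)]] := nbhs_unitI_interior (near_slice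
  (P := fun e t => t != 1I -> 0 < - c 0%N o2 e t) H).
by rewrite oppr_gt0 ltNge (arc_Z_ge0 (d0 o2) (arcs e)).
Qed.

(** [A] and [M] are the determinants of g, g' against e1 + Q e1 and e3 + Q e3. As e1 and Q e1 are
    the end points of the curve, [A] is the sum of two tangent determinants. *)
Let A e t := d3 (c 0%N 0 e t) (c 0%N 1 e t) (c 0%N o2 e t)
  (c 1%N 0 e t) (c 1%N 1 e t) (c 1%N o2 e t) (1 + Q 0 0) (Q 1 0) (Q o2 0).
Let M e t := d3 (c 0%N 0 e t) (c 0%N 1 e t) (c 0%N o2 e t)
  (c 1%N 0 e t) (c 1%N 1 e t) (c 1%N o2 e t) (Q 0 o2) (Q 1 o2) (1 + Q o2 o2).

Let jcont_det (x y z : R) : jcont (fun e t => d3 (c 0%N 0 e t) (c 0%N 1 e t) (c 0%N o2 e t)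
  (c 1%N 0 e t) (c 1%N 1 e t) (c 1%N o2 e t) x y z).
Proof.
have c0 j : jcont (c 0%N j) := (d0 j).1.
have c1 j : jcont (c 1%N j) := (d1 j).1.
have kc := @jcont_cst R E.
exact: (jcontD (jcontB
  (jcontM (c0 0) (jcontB (jcontM (c1 1) (kc z)) (jcontM (c1 o2) (kc y))))
  (jcontM (c0 1) (jcontB (jcontM (c1 0) (kc z)) (jcontM (c1 o2) (kc x)))))
  (jcontM (c0 o2) (jcontB (jcontM (c1 0) (kc y)) (jcontM (c1 1) (kc x))))).
Qed.

Let AE e t : A e t = arc_m (c 0%N 1) (c 1%N 1) (c 0%N o2) (c 1%N o2) e t +
  tangent_det (c 0%N 0) (c 1%N 0) (c 0%N 1) (c 1%N 1) (c 0%N o2) (c 1%N o2) e t 1I.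
Proof. by rewrite /A /arc_m /tangent_det !(crd_end phiX) /d3; ring. Qed.

Let tan_ge0 e t : 0 <= tangent_det (c 0%N 0) (c 1%N 0) (c 0%N 1) (c 1%N 1) (c 0%N o2) (c 1%N o2) e t 1I.
Proof.
exact: (tangent_det_ge0 (d0 0) (d1 0) (d0 1) (d1 1) (d0 o2) (d1 o2)
  (crd_det_gt0 phiX) (arcs e)).
Qed.

Let A_ge0 e t : 0 <= A e t.
Proof.
by rewrite AE addr_ge0// (arc_m_ge0 (d0 1) (d1 1) (d0 o2) (d1 o2) (arcs e)).
Qed.

Let A_gt0 e (t : I) : 0 < \val t < 1 -> 0 < A e t.
Proof. by move=> t01; rewrite AE ltr_pwDl//; have [_] := arcs e t01. Qed.

Let M0 e : 0 < M e 0I.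
Proof.
rewrite /M (crd00 phiX) (crd01 phiX) (crd02 phiX) (crd10 phiX) (crd12 phiX).
rewrite (_ : d3 _ _ _ _ _ _ _ _ _ = c 1%N 1 e 0I * (1 + Q o2 o2)).
  by rewrite mulr_gt0 ?(crd11 phiX)// Q22_gt.
by rewrite /d3; ring.
Qed.

Let M1 e : 0 < M e 1I.
Proof.
rewrite /M !(crd_end phiX); have [c1 c10 [-> -> ->]] := crd_end_flag phiX e.
rewrite (_ : d3 _ _ _ _ _ _ _ _ _ = c1 * (d3 (Q 0 0) (Q 1 0) (Q o2 0) (Q 0 1) (Q 1 1) (Q o2 1)
  (Q 0 o2) (Q 1 o2) (Q o2 o2) + (Q 0 0 * Q 1 1 - Q 1 0 * Q 0 1))).
  by rewrite SO3_det// SO3_cofactor// mulr_gt0// Q22_gt.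
by rewrite /d3; ring.
Qed.

Lemma center_exists : exists f : E -> R, [/\ continuous f, forall e, 0 < f e &
  forall e t s, 0 < s -> s <= f e ->
  0 < d3 (c 0%N 0 e t) (c 0%N 1 e t) (c 0%N o2 e t)
    (c 1%N 0 e t) (c 1%N 1 e t) (c 1%N o2 e t)
    (1 + Q 0 0 + s * Q 0 o2) (Q 1 0 + s * Q 1 o2) (Q o2 0 + s * (1 + Q o2 o2))].
Proof.
(* Where M < 0 this is A / (2 (1 + |M|)), so s <= F makes s |M| smaller than A. Where M >= 0 no
   bound on s is required; the term M + |M| keeps [F] positive at the ends, where [A] may vanish. *)
pose F e t := (A e t + (M e t + `|M e t|)) * (2 * (1 + `|M e t|))^-1.
have den e t : 0 < 2 * (1 + `|M e t|) by rewrite mulr_gt0// ltr_pwDl.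
have cM := @jcont_det (Q 0 o2) (Q 1 o2) (1 + Q o2 o2).
have cA := @jcont_det (1 + Q 0 0) (Q 1 0) (Q o2 0).
have cN : jcont (fun e t => `|M e t|) by move=> p; apply: cvg_norm; exact: cM.
have kc := @jcont_cst R E.
have cF : jcont F.
  have c2 : jcont (fun e t => (2 * (1 + `|M e t|))^-1).
    apply: jcontV; first by move=> e t; rewrite lt0r_neq0.
    exact: (jcontM (kc 2) (jcontD (kc 1) cN)).
  exact: (jcontM (jcontD cA (jcontD cM cN)) c2).
have pos (a m : R) : 0 <= a -> 0 < m -> 0 < a + (m + `|m|).
  by move=> a0 m0; rewrite ltr_wpDl// addr_gt0// normr_gt0 gt_eqF.
have num e t : 0 < A e t + (M e t + `|M e t|).
  have N0 : 0 <= M e t + `|M e t| by rewrite -lerBlDl sub0r -normrN ler_norm.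
  have [->|t0] := eqVneq t 0I; first exact: pos (A_ge0 e 0I) (M0 e).
  have [->|t1] := eqVneq t 1I; first exact: pos (A_ge0 e 1I) (M1 e).
  rewrite ltr_pwDl//; apply: A_gt0; rewrite !lt_neqAle unitI_ge0 unitI_le1 !andbT.
  apply/andP; split.
    by apply: contra t0 => /eqP H; apply/eqP/val_inj; rewrite -H.
  by apply: contra t1 => /eqP H; apply/eqP/val_inj; rewrite H.
have F0 e t : 0 < F e t by rewrite divr_gt0.
have [f [cf f0 fF]] := positive_minimum cF F0.
exists f; split=> // e t s s0 sf.
have -> : forall a b c' a' b' c'' : R, d3 a b c' a' b' c''
   (1 + Q 0 0 + s * Q 0 o2) (Q 1 0 + s * Q 1 o2) (Q o2 0 + s * (1 + Q o2 o2)) =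
   d3 a b c' a' b' c'' (1 + Q 0 0) (Q 1 0) (Q o2 0) + s * d3 a b c' a' b' c'' (Q 0 o2) (Q 1 o2) (1 + Q o2 o2).
  by move=> *; rewrite /d3; ring.
rewrite -/(A e t) -/(M e t).
have sF := le_trans sf (fF e t).
have := A_ge0 e t; have := num e t; move: sF.
rewrite /F ler_pdivlMr//; move: (A e t) (M e t) => a m.
have [m0|m0] := leP 0 m.
  rewrite ger0_norm// => _ am a0.
  have [m_0|am0] := eqVneq m 0; first by move: am; rewrite m_0 mulr0 !addr0.
  by rewrite ltr_wpDl// mulr_gt0// lt_neqAle eq_sym am0.
rewrite ltr0_norm// subrr addr0 => H _ a0.
exact: pos_add_mul.
Qed.

End Center.

(** * Normalization *)

Section DetIdentities.
Variable R : comPzRingType.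
Implicit Types a b c : 'I_3 -> R.

Definition d3v a b c : R := d3 (a 0) (a 1) (a o2) (b 0) (b 1) (b o2) (c 0) (c 1) (c o2).

Lemma d3v_scale (u u' u'' : R) a a' a'' :
  d3v (fun j => u * a j) (fun j => u' * a j + u * a' j)
      (fun j => (u'' * a j + u' * a' j) + (u' * a' j + u * a'' j)) =
  u * u * u * d3v a a' a''.
Proof. by rewrite /d3v /d3; ring. Qed.

Lemma d3v_reparam (l m : R) a a' a'' :
  d3v a (fun j => a' j * l) (fun j => (a'' j * l) * l + a' j * m) =
  l * l * l * d3v a a' a''.
Proof. by rewrite /d3v /d3; ring. Qed.

(** All three rows move along the same vector [n], a perturbation of rank one, so the terms of
    degree two and three in [s] vanish. *)
Lemma d3v_affine (s x x' x'' : R) (n : 'I_3 -> R) a a' a'' b b' b'' :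
  (forall j, b j = a j + x * n j) -> (forall j, b' j = a' j + x' * n j) ->
  (forall j, b'' j = a'' j + x'' * n j) ->
  d3v (fun j => (1 - s) * a j + s * b j) (fun j => (1 - s) * a' j + s * b' j)
      (fun j => (1 - s) * a'' j + s * b'' j) =
  (1 - s) * d3v a a' a'' + s * d3v b b' b''.
Proof. by move=> H H' H''; rewrite /d3v !H !H' !H'' /d3; ring. Qed.

End DetIdentities.

Section Normalize.
Variables (R : realType) (E : topologicalType) (k : option nat) (Q : 'M[R]_3).
Local Notation I := (unitI R).
Local Notation "0I" := (t0 R).
Local Notation "1I" := (t1 R).
Variables g g' g'' : 'I_3 -> E -> I -> R.
Hypothesis SQ : SO3 Q.
Hypothesis k2 : le_order 2 k.
Hypotheses (dg : forall j, jder (g j) (g' j)) (dg' : forall j, jder (g' j) (g'' j)).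
Hypothesis Jg : forall n, le_order n k -> forall j, J n (g j).
Hypothesis g_neq0 : forall e t,
  0 < g 0 e t * g 0 e t + g 1 e t * g 1 e t + g o2 e t * g o2 e t.
Hypothesis g_det : forall e t,
  0 < d3v (fun j => g j e t) (fun j => g' j e t) (fun j => g'' j e t).
Hypothesis g_start : forall e, (forall j, g j e 0I = (1%:M : 'M[R]_3) j 0) /\
  exists x y, 0 < y /\ forall j, g' j e 0I = x * (1%:M : 'M[R]_3) j 0 + y * (1%:M : 'M[R]_3) j 1.
Hypothesis g_end : forall e, (forall j, g j e 1I = Q j 0) /\
  exists x y, 0 < y /\ forall j, g' j e 1I = x * Q j 0 + y * Q j 1.

Definition normalized (e : E) (t : I) : 'cV[R]_3 :=
  \col_j ((Num.sqrt (g 0 e t * g 0 e t + g 1 e t * g 1 e t + g o2 e t * g o2 e t))^-1 * g j e t).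

Let N e t := g 0 e t * g 0 e t + g 1 e t * g 1 e t + g o2 e t * g o2 e t.
Let U e t := (Num.sqrt (N e t))^-1.

Let JU n : le_order n k -> J n U.
Proof.
move=> nk; apply: JV; first by move=> e t; rewrite lt0r_neq0// sqrtr_gt0; exact: g_neq0.
apply: J_sqrt => //.
have H j := JM (Jg nk j) (Jg nk j).
exact: (JD (JD (H 0) (H 1)) (H o2)).
Qed.

Let J_normalized n : le_order n k -> forall j, J n (fun e t => normalized e t j 0).
Proof.
move=> nk j.
rewrite (_ : (fun e t => normalized e t j 0) = (fun e t => U e t * g j e t)).
  exact: JM (JU nk) (Jg nk j).
by apply/funext => e; apply/funext => t; rewrite mxE.
Qed.

Let U_gt0 e t : 0 < U e t.
Proof. by rewrite invr_gt0 sqrtr_gt0; exact: g_neq0. Qed.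

Let UU e t : U e t * U e t * N e t = 1.
Proof.
rewrite -[N e t]sqr_sqrtr; last exact/ltW/g_neq0.
have : Num.sqrt (N e t) != 0 by rewrite lt0r_neq0// sqrtr_gt0; exact: g_neq0.
by rewrite /U => H; field.
Qed.

Let derivatives : exists U' U'' : E -> I -> R, jder U U' /\ jder U' U''.
Proof. by have [U' [dU [U'' [dU' _]]]] := JU k2; exists U', U''. Qed.

Lemma normalized_continuous : continuous (normalized : E -> curves R k).
Proof. exact: J_continuous. Qed.

Let unit_end (Q' : 'M[R]_3) e (z : I) : SO3 Q' -> (forall j, g j e z = Q' j 0) -> U e z = 1.
Proof.
move=> SQ' gz; have H := SO3_cols SQ' 0 0.
by rewrite /U /N !gz H eqxx sqrtr1 invr1.
Qed.

Let SO31 : SO3 (1%:M : 'M[R]_3).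
Proof. by split; [rewrite mulmx1 trmx1|rewrite det1]. Qed.

(** Multiplying a curve by a positive function multiplies the determinant by its cube, so local
    convexity survives. At the ends, normalizing removes the component of the derivative along the
    position, which is why the hypotheses allow an arbitrary [x]. *)
Lemma normalized_XQ e : XQ k Q (normalized e).
Proof.
have [U' [U'' [dU dU']]] := derivatives.
pose G1 j e t := U' e t * g j e t + U e t * g' j e t.
pose G2 j e t := (U'' e t * g j e t + U' e t * g' j e t) + (U' e t * g' j e t + U e t * g'' j e t).
have dF j : jder (fun e t => U e t * g j e t) (G1 j) by exact: jderM dU (dg j).
have dF1 j : jder (G1 j) (G2 j) by exact: jderD (jderM dU' (dg j)) (jderM dU (dg' j)).
have nE j f t : normalized f t j 0 = U f t * g j f t by rewrite mxE.
have D1 f t : derivI (normalized f) t = \col_j G1 j f t by exact: (jder_derivI nE dF).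
have nE1 j f t : derivI (normalized f) t j 0 = G1 j f t by rewrite D1 mxE.
have D2 f t : derivnI 2 (normalized f) t = \col_j G2 j f t.
  exact: (jder_derivI (Phi := fun f => derivI (normalized f)) nE1 dF1).
have sph f t : U f t * g 0 f t * (U f t * g 0 f t) + U f t * g 1 f t * (U f t * g 1 f t)
    + U f t * g o2 f t * (U f t * g o2 f t) = 1.
  by rewrite -(UU f t) /N; ring.
have orth f t : U f t * g 0 f t * G1 0 f t + U f t * g 1 f t * G1 1 f t
    + U f t * g o2 f t * G1 o2 f t = 0.
  have H1 := jderD (jderD (jderM (dF 0) (dF 0)) (jderM (dF 1) (dF 1))) (jderM (dF o2) (dF o2)).
  have H2 := jder_eq (jder_cst E (1 : R)) (fun f t => esym (sph f t)) (fun _ _ => erefl).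
  have /(congr1 (fun F => F f t)) /= H := jder_uniq H1 H2.
  apply/eqP; rewrite -[_ == 0]orFb -(mulrn_eq0 _ 2) mulr2n; apply/eqP; rewrite -[RHS]H.
  by ring.
(* One argument for both ends, the start using the identity matrix: the normalized curve is
   orthogonal to its derivative, so only the multiple of Q' e2 remains. *)
have frame (Q' : 'M[R]_3) (z : I) x y : SO3 Q' -> (forall j, g j e z = Q' j 0) ->
    (forall j, g' j e z = x * Q' j 0 + y * Q' j 1) ->
    normalized e z = Q' *m e1 R /\ derivI (normalized e) z = y *: (Q' *m e2 R).
  move=> SQ' gz g'z; have Uz := unit_end SQ' gz.
  have := orth e z; rewrite Uz !mul1r /G1 Uz !mul1r !gz !g'z => O.
  have c00 := SO3_cols SQ' 0 0; have c01 := SO3_cols SQ' 0 1.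
  rewrite eqxx /= mulr1n in c00; rewrite /= mulr0n in c01.
  have x0 : U' e z + x = 0.
    rewrite -[LHS]mulr1 -{1}c00 -[RHS]O -[LHS]addr0 -(mulr0 y) -{1}c01.
    by ring.
  rewrite -!colE; split; apply/matrixP => i j; rewrite ord1 !mxE.
    by rewrite -/(N e z) -/(U e z) Uz mul1r gz.
  rewrite D1 mxE /G1 Uz mul1r gz g'z addrA -mulrDl x0 mul0r add0r //.
split.
- exact: J_classC.
- move=> t; rewrite /sphere /= sum_ord3 !nE !expr2; exact: sph.
- move=> t; rewrite det3E D2 D1 /omega !mxE.
  rewrite -/(N e t) -/(U e t).
  have := d3v_scale (U e t) (U' e t) (U'' e t) (fun j => g j e t) (fun j => g' j e t) (fun j => g'' j e t).
  rewrite /d3v /= => ->; apply: mulr_gt0; last exact: g_det.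
  by do 2 apply: mulr_gt0 => //.
- have [g0 [x [y [y0 g'0]]]] := g_start e.
  have [n0 n1] := frame 1%:M 0I x y SO31 g0 g'0.
  split; first by rewrite n0 mul1mx.
  by exists y => //; rewrite n1 mul1mx.
- have [g0 [x [y [y0 g'0]]]] := g_end e.
  have [n0 n1] := frame Q 1I x y SQ g0 g'0.
  by split=> //; exists y.
Qed.

End Normalize.

(** * Matching two convex curves *)

Lemma J_crd (R : realType) (E : topologicalType) (k : option nat) (Q : 'M[R]_3)
    (phi : E -> curves R k) (cphi : continuous phi) (phiX : forall e, XQ k Q (phi e)) i n j :
  le_order (i + n) k -> J n (crd phi i j).
Proof.
move=> ink; apply: J_derivnI => j'.
by apply: (J_eval cphi) => // e; exact: XQ_classC phiX e.
Qed.

Section Direction.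
Variables (R : realType) (E : topologicalType) (k : option nat) (Q : 'M[R]_3).
Variable phi : E -> curves R k.
Local Notation I := (unitI R).
Local Notation "0I" := (t0 R).
Local Notation "1I" := (t1 R).
Hypothesis k2 : le_order 2 k.
Hypothesis cphi : continuous phi.
Hypothesis phiX : forall e, XQ k Q (phi e).
Hypothesis arcs : forall e, arcP phi e.
Variables nu1 nu2 : E -> R.
Hypotheses (cnu1 : continuous nu1) (cnu2 : continuous nu2).
Local Notation c := (crd phi).
Hypothesis inside : forall e t, 0 < d3 (c 0%N 0 e t) (c 0%N 1 e t) (c 0%N o2 e t)
    (c 1%N 0 e t) (c 1%N 1 e t) (c 1%N o2 e t) (nu1 e) (nu2 e) 1.

(* The projection along (nu1, nu2, 1) onto the plane Z = 0. *)
Definition cproj1 e t := c 0%N 0 e t - nu1 e * c 0%N o2 e t.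
Definition cproj2 e t := c 0%N 1 e t - nu2 e * c 0%N o2 e t.
Definition cproj1' e t := c 1%N 0 e t - nu1 e * c 1%N o2 e t.
Definition cproj2' e t := c 1%N 1 e t - nu2 e * c 1%N o2 e t.

Let d0 j := jder_crd0 k2 cphi phiX j.

Lemma jder_cproj1 : jder cproj1 cproj1'.
Proof.
apply: (jder_eq (jderB (d0 0) (jderM (jder_param cnu1) (d0 o2)))) => // e t.
by rewrite mul0r add0r.
Qed.

Lemma jder_cproj2 : jder cproj2 cproj2'.
Proof.
apply: (jder_eq (jderB (d0 1) (jderM (jder_param cnu2) (d0 o2)))) => // e t.
by rewrite mul0r add0r.
Qed.

(** Clearing the third column with the row (nu1, nu2, 1) turns the determinant in [inside] into this
    Wronskian: the projection turns counterclockwise around the origin. *)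
Lemma cproj_turns e t : 0 < cproj1 e t * cproj2' e t - cproj2 e t * cproj1' e t.
Proof.
rewrite (_ : _ - _ = d3 (c 0%N 0 e t) (c 0%N 1 e t) (c 0%N o2 e t)
    (c 1%N 0 e t) (c 1%N 1 e t) (c 1%N o2 e t) (nu1 e) (nu2 e) 1) //.
by rewrite /cproj1 /cproj2 /cproj1' /cproj2' /d3; ring.
Qed.

Lemma cproj1_start e : cproj1 e 0I = 1.
Proof. by rewrite /cproj1 (crd00 phiX) (crd02 phiX) mulr0 subr0. Qed.

Lemma cproj2_start e : cproj2 e 0I = 0.
Proof. by rewrite /cproj2 (crd01 phiX) (crd02 phiX) mulr0 subr0. Qed.

Lemma J_cproj n : le_order n k -> J n cproj1 /\ J n cproj2.
Proof.
move=> nk; have H j : J n (c 0%N j) by apply: (J_crd cphi phiX).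
split; apply: JB => //; apply: JM => //; exact: J_param.
Qed.

Lemma J_cproj' n : le_order n.+1 k -> J n cproj1' /\ J n cproj2'.
Proof.
move=> nk; have H j : J n (c 1%N j) by apply: (J_crd cphi phiX).
split; apply: JB => //; apply: JM => //; exact: J_param.
Qed.

Lemma J_cproj_speed n : le_order n.+1 k -> J n (angular_speed cproj1 cproj1' cproj2 cproj2').
Proof.
move=> nk; have [J1 J2] := J_cproj (le_order_trans (leqnSn n) nk).
have [J1' J2'] := J_cproj' nk.
exact: J_angular_speed (cproj_turns) _ J1 J1' J2 J2'.
Qed.

(** For the bound 2 pi: if the second projected coordinate vanishes at an interior [t], then Y = nu2
    Z there, and [arc_YZ_gt] says exactly that this coordinate is positive at every earlier positive
    time. *)
Lemma polar_angle : exists th, [/\ jder th (angular_speed cproj1 cproj1' cproj2 cproj2'),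
  forall e, th e 0I = 0,
  forall e t, cproj1 e t = polar_radius cproj1 cproj2 e t * cos (th e t),
  forall e t, cproj2 e t = polar_radius cproj1 cproj2 e t * sin (th e t) &
  forall e, 0 < th e 1I <= pi *+ 2].
Proof.
have [th [dth th0 P1E P2E]] :=
  angle_exists jder_cproj1 jder_cproj2 cproj_turns cproj1_start cproj2_start.
exists th; split=> // e.
apply: (angle_le_2pi cproj_turns dth (th0 e) (P2E e)) => s t s0 st t1.
have t0 : 0 < \val t := lt_trans s0 st.
have [Zt _] := arcs e (introT andP (conj t0 t1)).
have := arc_YZ_gt (d0 1) (d0 o2) (arcs e) s0 st Zt.
rewrite /cproj2 => H /eqP; rewrite subr_eq0 => /eqP Yt.
move: H; rewrite Yt (_ : _ - _ = c 0%N o2 e t * (c 0%N 1 e s - nu2 e * c 0%N o2 e s)).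
  by rewrite pmulr_rgt0.
by ring.
Qed.

End Direction.

Section Pair.
Variables (R : realType) (E : topologicalType) (k : option nat) (Q : 'M[R]_3).
Variables phi psi : E -> curves R k.
Local Notation I := (unitI R).
Local Notation "0I" := (t0 R).
Local Notation "1I" := (t1 R).
Hypothesis SQ : SO3 Q.
Hypothesis k2 : le_order 2 k.
Hypothesis cphi : continuous phi.
Hypothesis phiX : forall e, XQ k Q (phi e).
Hypothesis arcs : forall e, arcP phi e.
Hypothesis cpsi : continuous psi.
Hypothesis psiX : forall e, XQ k Q (psi e).
Hypothesis arcs' : forall e, arcP psi e.
Local Notation c := (crd phi).
Local Notation b := (crd psi).

Lemma common_center : exists nu1 nu2 : E -> R, [/\ continuous nu1, continuous nu2,
  forall e t, 0 < d3 (c 0%N 0 e t) (c 0%N 1 e t) (c 0%N o2 e t)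
    (c 1%N 0 e t) (c 1%N 1 e t) (c 1%N o2 e t) (nu1 e) (nu2 e) 1 &
  forall e t, 0 < d3 (b 0%N 0 e t) (b 0%N 1 e t) (b 0%N o2 e t)
    (b 1%N 0 e t) (b 1%N 1 e t) (b 1%N o2 e t) (nu1 e) (nu2 e) 1].
Proof.
have [f [cf f0 fE]] := center_exists SQ k2 cphi phiX arcs.
have [g [cg g0 gE]] := center_exists SQ k2 cpsi psiX arcs'.
(* Every positive value below a threshold is admissible, so the minimum suits both families.
   Dividing by the positive third coordinate then normalizes the direction. *)
pose s e := Num.min (f e) (g e).
have cs : continuous s by move=> e; apply: (@continuous_min R E f g); [exact: cf|exact: cg].
have s0 e : 0 < s e by rewrite lt_min f0 g0.
have sf e : s e <= f e by rewrite ge_min lexx.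
have sg e : s e <= g e by rewrite ge_min lexx orbT.
have n3 e : 0 < Q o2 0 + s e * (1 + Q o2 o2).
  rewrite ltr_wpDl ?(Q20_ge0 k2 cphi phiX arcs e)//.
  by rewrite mulr_gt0// (Q22_gt SQ k2 cphi phiX arcs e).
have clin (x y : R) : continuous (fun e => x + s e * y).
  move=> e; have K (z : R) : {for e, continuous (fun _ : E => z)} by exact: for_continuous_cst.
  exact: (cvgD (K x) (cvgM (cs e) (K y))).
have cq (x y : R) : continuous (fun e => (x + s e * y) * (Q o2 0 + s e * (1 + Q o2 o2))^-1).
  move=> e; apply: cvgM; first exact: clin.
  by apply: cvgV; [rewrite lt0r_neq0|exact: clin].
exists (fun e => (1 + Q 0 0 + s e * Q 0 o2) * (Q o2 0 + s e * (1 + Q o2 o2))^-1).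
exists (fun e => (Q 1 0 + s e * Q 1 o2) * (Q o2 0 + s e * (1 + Q o2 o2))^-1).
have scale (x y z x' y' z' n1 n2 n : R) : 0 < n -> 0 < d3 x y z x' y' z' n1 n2 n ->
    0 < d3 x y z x' y' z' (n1 * n^-1) (n2 * n^-1) 1.
  move=> n0; have -> : d3 x y z x' y' z' n1 n2 n = n * d3 x y z x' y' z' (n1 * n^-1) (n2 * n^-1) 1.
    by rewrite /d3; field; rewrite lt0r_neq0.
  by rewrite pmulr_rgt0.
split; [exact: cq|exact: cq|..] => e t; apply: scale => //.
- exact: fE.
- exact: gE.
Qed.

(* psi is reparametrized by h and rescaled by rho so that it has, at every
   time, the same projection as phi along the common center. *)
Lemma matching : exists (nu1 nu2 : E -> R) (h : E -> I -> I) (h' rho : E -> I -> R),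
  [/\ [/\ forall e t, 0 < c 0%N 0 e t - nu1 e * c 0%N o2 e t \/
            c 0%N 0 e t - nu1 e * c 0%N o2 e t < 0 \/ c 0%N 1 e t - nu2 e * c 0%N o2 e t != 0,
          continuous nu1, continuous nu2 &
          forall e t, 0 < rho e t],
      [/\ jder (fun e t => \val (h e t)) h', forall e t, 0 < h' e t,
          forall e, h e 0I = 0I /\ h e 1I = 1I &
          forall n, le_order n k -> J n (fun e t => \val (h e t))],
      forall e, rho e 0I = 1 /\ rho e 1I = 1,
      forall n, le_order n k -> J n rho &
      forall e t, rho e t * (b 0%N 0 e (h e t) - nu1 e * b 0%N o2 e (h e t)) =
                    c 0%N 0 e t - nu1 e * c 0%N o2 e t /\
                  rho e t * (b 0%N 1 e (h e t) - nu2 e * b 0%N o2 e (h e t)) =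
                    c 0%N 1 e t - nu2 e * c 0%N o2 e t].
Proof.
have [nu1 [nu2 [cnu1 cnu2 inP inS]]] := common_center.
have tP := cproj_turns inP; have tS := cproj_turns inS.
have [th [dth th0 P1E P2E thI]] := polar_angle k2 cphi phiX arcs cnu1 cnu2 inP.
have [ta [dta ta0 S1E S2E taI]] := polar_angle k2 cpsi psiX arcs' cnu1 cnu2 inS.
set rP := polar_radius _ _ in P1E P2E; set rS := polar_radius _ _ in S1E S2E.
have rP0 e t : 0 < rP e t := polar_radius_gt0 tP e t.
have rS0 e t : 0 < rS e t := polar_radius_gt0 tS e t.
have end1 e : cproj1 phi nu1 e 1I = cproj1 psi nu1 e 1I.
  by rewrite /cproj1 !(crd_end phiX) !(crd_end psiX).
have end2 e : cproj2 phi nu2 e 1I = cproj2 psi nu2 e 1I.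
  by rewrite /cproj2 !(crd_end phiX) !(crd_end psiX).
have rend e : rP e 1I = rS e 1I by rewrite /rP /rS /polar_radius end1 end2.
(* Both curves end at the same point, so the two angles share cosine and sine; since both lie in (0,
   2 pi], they agree. *)
have tend e : th e 1I = ta e 1I.
  apply: cos_sin_inj => //.
  - by apply: (mulfI (lt0r_neq0 (rP0 e 1I))); rewrite -P1E end1 S1E rend.
  - by apply: (mulfI (lt0r_neq0 (rP0 e 1I))); rewrite -P2E end2 S2E rend.
have [h [h' [hE dh h'0 hends Jh]]] := monotone_reparam dth dta
  (angular_speed_gt0 tP) (angular_speed_gt0 tS)
  (fun e => etrans (th0 e) (esym (ta0 e))) tend.
have Jh' n : le_order n k -> J n (fun e t => \val (h e t)).
  case: n => [|n] nk; first exact: dh.1.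
  by apply: Jh; [exact: (J_cproj_speed cphi phiX)|exact: (J_cproj_speed cpsi psiX)].
(* The ratio of the radii at equal angles; it is 1 at the ends, where the two projections
   coincide. *)
pose rho e t := rP e t * (rS e (h e t))^-1.
exists nu1, nu2, h, h', rho; split.
- split=> //; last by move=> e t; rewrite divr_gt0.
  (* The disjunction expresses that the projection of [phi] avoids the origin. *)
  move=> e t; have := polar_radius2_gt0 tP e t; rewrite /cproj1 /cproj2 => H.
  case: (ltgtP (c 0%N 0 e t - nu1 e * c 0%N o2 e t) 0) => [_|_|H0]; [by right; left|by left|].
  right; right; apply/eqP => H1; move: H; rewrite H0 H1 !mul0r addr0 ltxx //.
- by split.
- move=> e; have [h0 h1] := hends e; rewrite /rho h0 h1 rend; split.
    rewrite /rP /rS /polar_radius !(cproj1_start phiX) !(cproj2_start phiX).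
    by rewrite !(cproj1_start psiX) !(cproj2_start psiX) divff// lt0r_neq0// sqrtr_gt0 mulr1 mulr0 addr0.
  by rewrite divff// lt0r_neq0.
- move=> n nk; apply: JM.
    by have [J1 J2] := J_cproj cphi phiX cnu1 cnu2 nk; exact: (J_polar_radius tP).
  apply: JV; first by move=> e t; rewrite lt0r_neq0.
  apply: J_comp; last exact: Jh'.
  by have [J1 J2] := J_cproj cpsi psiX cnu1 cnu2 nk; exact: (J_polar_radius tS).
- move=> e t; have := S1E e (h e t); have := S2E e (h e t).
  rewrite hE /cproj1 /cproj2 => -> ->.
  have rn : rS e (h e t) != 0 by rewrite lt0r_neq0.
  have := P1E e t; have := P2E e t; rewrite /cproj1 /cproj2 => -> ->.
  by rewrite /rho; split; field.
Qed.

End Pair.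

(** * The deformation *)

Lemma ord3_cases (j : 'I_3) : j = 0 \/ j = 1 \/ j = o2.
Proof. by elim/ord3P: j; [left|right; left|right; right]. Qed.

Lemma along_center (R : comPzRingType) (a b c d n : R) :
  a - n * b = c - n * d -> a = c + (b - d) * n.
Proof. by move=> H; rewrite -[LHS](subrK (n * b)) H; ring. Qed.

(* As long as v = 0, the two curves that are blended differ by a multiple of
   the fixed vector nu, so the determinant is affine in u; afterwards u = 1
   and only the parametrization of psi still moves. *)
Section Blend.
Variables (R : realType) (E : topologicalType) (k : option nat) (Q : 'M[R]_3).
Variables phi psi : E -> curves R k.
Local Notation I := (unitI R).
Local Notation "0I" := (t0 R).
Local Notation "1I" := (t1 R).
Hypothesis SQ : SO3 Q.
Hypothesis k2 : le_order 2 k.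
Hypothesis cphi : continuous phi.
Hypothesis phiX : forall e, XQ k Q (phi e).
Hypothesis cpsi : continuous psi.
Hypothesis psiX : forall e, XQ k Q (psi e).
Local Notation c := (crd phi).
Local Notation b := (crd psi).
Variables (nu : 'I_3 -> E -> R) (h : E -> I -> I) (h' h'' rho rho' rho'' : E -> I -> R).
Hypothesis cnu : forall j, continuous (nu j).
Hypothesis proj_neq0 : forall e t, exists j, c 0%N j e t - nu j e * c 0%N o2 e t != 0.
Hypotheses (rho_gt0 : forall e t, 0 < rho e t) (rho_start : forall e, rho e 0I = 1)
  (rho_end : forall e, rho e 1I = 1).
Hypotheses (drho : jder rho rho') (drho' : jder rho' rho'').
Hypothesis Jrho : forall n, le_order n k -> J n rho.
Hypotheses (h'_gt0 : forall e t, 0 < h' e t) (h_start : forall e, h e 0I = 0I)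
  (h_end : forall e, h e 1I = 1I).
Hypotheses (dh : jder (fun e t => \val (h e t)) h') (dh' : jder h' h'').
Hypothesis Jh : forall n, le_order n k -> J n (fun e t => \val (h e t)).
Hypothesis same_proj : forall j e t,
  rho e t * b 0%N j e (h e t) - nu j e * (rho e t * b 0%N o2 e (h e t)) =
  c 0%N j e t - nu j e * c 0%N o2 e t.
Variables u v : E -> R.
Hypotheses (cu : continuous u) (cv : continuous v).
Hypotheses (u01 : forall e, 0 <= u e <= 1) (v01 : forall e, 0 <= v e <= 1).
Hypothesis uv : forall e, u e = 1 \/ v e = 0.

Section Scaled.
Variables (l : E -> I -> I) (l' l'' : E -> I -> R).
Hypotheses (dl : jder (fun e t => \val (l e t)) l') (dl' : jder l' l'').

Definition scaled j e t : R := rho e t * b 0%N j e (l e t).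
Definition scaled' j e t : R :=
  rho' e t * b 0%N j e (l e t) + rho e t * (b 1%N j e (l e t) * l' e t).
Definition scaled'' j e t : R :=
  (rho'' e t * b 0%N j e (l e t) + rho' e t * (b 1%N j e (l e t) * l' e t)) +
  (rho' e t * (b 1%N j e (l e t) * l' e t) +
   rho e t * ((b 2%N j e (l e t) * l' e t) * l' e t + b 1%N j e (l e t) * l'' e t)).

Lemma jder_scaled j : jder (scaled j) (scaled' j).
Proof. exact: jderM drho (jder_comp (jder_crd0 k2 cpsi psiX j) dl). Qed.

Lemma jder_scaled' j : jder (scaled' j) (scaled'' j).
Proof.
have d0 := jder_comp (jder_crd0 k2 cpsi psiX j) dl.
have d1 := jderM (jder_comp (jder_crd1 k2 cpsi psiX j) dl) dl'.
exact: jderD (jderM drho' d0) (jderM drho d1).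
Qed.

Lemma scaled_det_gt0 e t : 0 < l' e t ->
  0 < d3v (fun j => scaled j e t) (fun j => scaled' j e t) (fun j => scaled'' j e t).
Proof.
move=> l0.
have := d3v_scale (rho e t) (rho' e t) (rho'' e t) (fun j => b 0%N j e (l e t))
  (fun j => b 1%N j e (l e t) * l' e t)
  (fun j => (b 2%N j e (l e t) * l' e t) * l' e t + b 1%N j e (l e t) * l'' e t).
rewrite d3v_reparam => H; rewrite [ltRHS]H.
have r0 := rho_gt0 e t.
apply: mulr_gt0; first by do 2 apply: mulr_gt0 => //.
apply: mulr_gt0; first by do 2 apply: mulr_gt0 => //.
exact: crd_det_gt0 psiX e (l e t).
Qed.

End Scaled.

(** Obtained by differentiating [same_proj] in time, with [nu] constant in time, through uniqueness
    of derivatives. *)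
Let same_proj' j e t : scaled' h h' j e t - nu j e * scaled' h h' o2 e t =
  c 1%N j e t - nu j e * c 1%N o2 e t.
Proof.
have d1 i := jder_scaled dh i.
have H1 := jderB (d1 j) (jderM (jder_param (@cnu j)) (d1 o2)).
have H2 := jderB (jder_crd0 k2 cphi phiX j)
  (jderM (jder_param (@cnu j)) (jder_crd0 k2 cphi phiX o2)).
have H3 := jder_eq H2 (fun e t => esym (same_proj j e t)) (fun _ _ => erefl).
have := jder_uniq H1 H3.
by move=> /(congr1 (fun F => F e t)); rewrite /= !mul0r !add0r.
Qed.

Let same_proj'' j e t : scaled'' h h' h'' j e t - nu j e * scaled'' h h' h'' o2 e t =
  c 2%N j e t - nu j e * c 2%N o2 e t.
Proof.
have d1 i := jder_scaled' dh dh' i.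
have H1 := jderB (d1 j) (jderM (jder_param (@cnu j)) (d1 o2)).
have H2 := jderB (jder_crd1 k2 cphi phiX j)
  (jderM (jder_param (@cnu j)) (jder_crd1 k2 cphi phiX o2)).
have H3 := jder_eq H2 (fun e t => esym (same_proj' j e t)) (fun _ _ => erefl).
have := jder_uniq H1 H3.
by move=> /(congr1 (fun F => F e t)); rewrite /= !mul0r !add0r.
Qed.

Let l e t : I := clamp ((1 - v e) * \val (h e t) + v e * \val t).
Let l' e t := (1 - v e) * h' e t + v e.
Let l'' e t := (1 - v e) * h'' e t.

Let lE e t : \val (l e t) = (1 - v e) * \val (h e t) + v e * \val t.
Proof.
have /andP[v0 v1] := v01 e; have w0 : 0 <= 1 - v e by rewrite subr_ge0.
rewrite val_clamp//; apply/andP; split.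
  by apply: addr_ge0; apply: mulr_ge0 => //; exact: unitI_ge0.
rewrite -[leRHS](subrK (v e)); apply: lerD.
  by apply: ler_piMr => //; exact: unitI_le1.
by apply: ler_piMr => //; exact: unitI_le1.
Qed.

Let cw : continuous (fun e => 1 - v e).
Proof.
move=> e; have K : {for e, continuous (fun _ : E => 1 : R)} by exact: for_continuous_cst.
exact: (cvgB K (@cv e)).
Qed.

Let cw' : continuous (fun e => 1 - u e).
Proof.
move=> e; have K : {for e, continuous (fun _ : E => 1 : R)} by exact: for_continuous_cst.
exact: (cvgB K (@cu e)).
Qed.

Let dl : jder (fun e t => \val (l e t)) l'.
Proof.
apply: (jder_eq (jderD (jderM (jder_param cw) dh) (jderM (jder_param cv) (jder_val R E)))).
  by move=> e t; rewrite lE.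
by move=> e t; rewrite !mul0r !add0r mulr1.
Qed.

Let dl' : jder l' l''.
Proof.
apply: (jder_eq (jderD (jderM (jder_param cw) dh') (jder_param cv))) => // e t.
by rewrite mul0r add0r addr0.
Qed.

Let l'_gt0 e t : 0 < l' e t.
Proof.
have /andP[v0 v1] := v01 e; have [vE|vn] := eqVneq (v e) 1.
  by rewrite /l' vE subrr mul0r add0r ltr01.
apply: ltr_pwDl => //; apply: mulr_gt0 => //.
by rewrite subr_gt0 lt_neqAle vn.
Qed.

Let Jl n : le_order n k -> J n (fun e t => \val (l e t)).
Proof.
move=> nk.
rewrite (_ : (fun e t => \val (l e t)) =
  fun e t => (1 - v e) * \val (h e t) + v e * \val t).
  apply: JD; apply: JM; [exact: (J_param n cw)|exact: Jh|exact: (J_param n cv)|exact: J_val].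
by apply/funext => e; apply/funext => t; rewrite lE.
Qed.

Let l_start e : l e 0I = 0I.
Proof. by apply: val_inj; rewrite lE h_start /= !mulr0 addr0. Qed.

Let l_end e : l e 1I = 1I.
Proof. by apply: val_inj; rewrite lE h_end /= !mulr1 subrK. Qed.

Let l_v0 e t : v e = 0 -> l e t = h e t.
Proof. by move=> v0; apply: val_inj; rewrite lE v0 subr0 mul1r mul0r addr0. Qed.

Let l'_v0 e t : v e = 0 -> l' e t = h' e t.
Proof. by move=> v0; rewrite /l' v0 subr0 mul1r addr0. Qed.

Let l''_v0 e t : v e = 0 -> l'' e t = h'' e t.
Proof. by move=> v0; rewrite /l'' v0 subr0 mul1r. Qed.

Let g j e t := (1 - u e) * c 0%N j e t + u e * scaled l j e t.
Let g' j e t := (1 - u e) * c 1%N j e t + u e * scaled' l l' j e t.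
Let g'' j e t := (1 - u e) * c 2%N j e t + u e * scaled'' l l' l'' j e t.

Let dg j : jder (g j) (g' j).
Proof.
apply: (jder_eq (jderD (jderM (jder_param cw') (jder_crd0 k2 cphi phiX j))
  (jderM (jder_param cu) (jder_scaled dl j)))) => // e t.
by rewrite !mul0r !add0r.
Qed.

Let dg' j : jder (g' j) (g'' j).
Proof.
apply: (jder_eq (jderD (jderM (jder_param cw') (jder_crd1 k2 cphi phiX j))
  (jderM (jder_param cu) (jder_scaled' dl dl' j)))) => // e t.
by rewrite !mul0r !add0r.
Qed.

Let Jg n : le_order n k -> forall j, J n (g j).
Proof.
move=> nk j; apply: JD; apply: JM; [exact: (J_param n cw')|by apply: (J_crd cphi phiX)|exact: (J_param n cu)|].
apply: JM; first exact: Jrho.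
by apply: J_comp; [apply: (J_crd cpsi psiX)|exact: Jl].
Qed.

Let sphere_crd (chi : E -> curves R k) (chiX : forall e, XQ k Q (chi e)) e t :
  crd chi 0%N 0 e t * crd chi 0%N 0 e t + crd chi 0%N 1 e t * crd chi 0%N 1 e t +
  crd chi 0%N o2 e t * crd chi 0%N o2 e t = 1.
Proof. by have [_ /(_ t) + _ _ _] := chiX e; rewrite /sphere /= sum_ord3 !expr2. Qed.

(** If u = 1, the blend is [rho] times a point of the sphere. If v = 0, its projection is that of
    [phi], which is nonzero. *)
Let g_neq0 e t : 0 < g 0 e t * g 0 e t + g 1 e t * g 1 e t + g o2 e t * g o2 e t.
Proof.
suff [j gj] : exists j, g j e t != 0.
  have sq i : 0 <= g i e t * g i e t by rewrite -expr2 sqr_ge0.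
  have pq : 0 < g j e t * g j e t by rewrite -expr2 lt0r sqr_ge0 sqrf_eq0 gj.
  have [E0|[E0|E0]] := ord3_cases j; rewrite E0 in pq.
  - by rewrite -addrA; apply: ltr_pwDl => //; apply: addr_ge0.
  - by apply: ltr_pwDl => //; apply: ltr_wpDl.
  - by apply: ltr_wpDl => //; apply: addr_ge0.
have [u1|v0] := uv e.
  apply: contrapT => /forallNP H.
  have K j : b 0%N j e (l e t) = 0.
    have /negP := H j; rewrite negbK /g u1 subrr mul0r add0r mul1r.
    by rewrite mulf_eq0 (negbTE (lt0r_neq0 (rho_gt0 e t))) /= => /eqP.
  have := sphere_crd psiX e (l e t); rewrite !K !mulr0 !addr0 => /eqP.
  by rewrite eq_sym oner_eq0.
have [j Pj] := proj_neq0 e t.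
apply: contrapT => /forallNP H.
have K i : g i e t = 0 by have /negP := H i; rewrite negbK => /eqP.
have := same_proj j e t; rewrite -!(l_v0 t v0) => Hj.
have : g j e t - nu j e * g o2 e t = c 0%N j e t - nu j e * c 0%N o2 e t.
  rewrite -[RHS](addrK (u e * (c 0%N j e t - nu j e * c 0%N o2 e t))).
  by rewrite -{2}Hj /g /scaled; ring.
by rewrite !K mulr0 subr0 => /esym; move/eqP: Pj.
Qed.

Let g_det e t : 0 < d3v (fun j => g j e t) (fun j => g' j e t) (fun j => g'' j e t).
Proof.
have D : 0 < d3v (fun j => scaled l j e t) (fun j => scaled' l l' j e t)
    (fun j => scaled'' l l' l'' j e t) by exact: scaled_det_gt0.
have [u1|v0] := uv e.
  move: D; rewrite /d3v /g /g' /g'' u1 subrr !mul0r !add0r !mul1r //.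
have /andP[ul ur] := u01 e.
have H j : scaled l j e t = c 0%N j e t + (scaled l o2 e t - c 0%N o2 e t) * nu j e.
  apply: along_center; have := same_proj j e t; rewrite -!(l_v0 t v0); exact.
have H' j : scaled' l l' j e t = c 1%N j e t + (scaled' l l' o2 e t - c 1%N o2 e t) * nu j e.
  apply: along_center; have := same_proj' j e t.
  rewrite /scaled' -!(l_v0 t v0) -!(l'_v0 t v0); exact.
have H'' j : scaled'' l l' l'' j e t =
    c 2%N j e t + (scaled'' l l' l'' o2 e t - c 2%N o2 e t) * nu j e.
  apply: along_center; have := same_proj'' j e t.
  rewrite /scaled'' -!(l_v0 t v0) -!(l'_v0 t v0) -!(l''_v0 t v0); exact.
have := d3v_affine (u e) H H' H''; rewrite /= => A; rewrite [ltRHS]A.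
have P := crd_det_gt0 phiX e t.
have [u1|un] := eqVneq (u e) 1; first by rewrite u1 subrr mul0r add0r mul1r.
apply: ltr_pwDl; last by apply: mulr_ge0 => //; exact: ltW.
by apply: mulr_gt0 => //; rewrite subr_gt0 lt_neqAle un.
Qed.

Let blend_flag_gt0 e (x y : R) : 0 < x -> 0 < y -> 0 < (1 - u e) * x + u e * y.
Proof.
move=> x0 y0; have /andP[ul ur] := u01 e.
have [u1|un] := eqVneq (u e) 1; first by rewrite u1 subrr mul0r add0r mul1r.
apply: ltr_pwDl; last by apply: mulr_ge0 => //; exact: ltW.
by apply: mulr_gt0 => //; rewrite subr_gt0 lt_neqAle un.
Qed.

(** The derivative of [rho] adds a multiple of the position at an end, so before normalization the
    flag is preserved only up to that component. *)
Let flag (M : 'M[R]_3) e z x y : l e z = z -> rho e z = 1 -> 0 < x -> 0 < y ->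
  (forall j, c 0%N j e z = M j 0) -> (forall j, b 0%N j e z = M j 0) ->
  (forall j, c 1%N j e z = x * M j 1) -> (forall j, b 1%N j e z = y * M j 1) ->
  (forall j, g j e z = M j 0) /\
  exists p q, 0 < q /\ forall j, g' j e z = p * M j 0 + q * M j 1.
Proof.
move=> lz rz x0 y0 c0 b0 c1 b1; split=> [j|].
  by rewrite /g /scaled lz rz c0 b0; ring.
exists (u e * rho' e z), ((1 - u e) * x + u e * (y * l' e z)); split.
  by apply: blend_flag_gt0 => //; exact: mulr_gt0.
by move=> j; rewrite /g' /scaled' lz rz b0 c1 b1; ring.
Qed.

Let g_start e : (forall j, g j e 0I = (1%:M : 'M[R]_3) j 0) /\
  exists x y, 0 < y /\ forall j, g' j e 0I = x * (1%:M : 'M[R]_3) j 0 + y * (1%:M : 'M[R]_3) j 1.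
Proof.
have H0 (chi : E -> curves R k) (chiX : forall e, XQ k Q (chi e)) j :
    crd chi 0%N j e 0I = (1%:M : 'M[R]_3) j 0.
  by have [->|[->|->]] := ord3_cases j; rewrite mxE ?(crd00 chiX) ?(crd01 chiX) ?(crd02 chiX).
have H1 (chi : E -> curves R k) (chiX : forall e, XQ k Q (chi e)) j :
    crd chi 1%N j e 0I = crd chi 1%N 1 e 0I * (1%:M : 'M[R]_3) j 1.
  by have [->|[->|->]] := ord3_cases j;
    rewrite mxE ?(crd10 chiX) ?(crd12 chiX) /= ?mulr0 ?mulr1.
exact: (flag (l_start e) (rho_start e) (crd11 phiX e) (crd11 psiX e)
  (H0 _ phiX) (H0 _ psiX) (H1 _ phiX) (H1 _ psiX)).
Qed.

Let g_end e : (forall j, g j e 1I = Q j 0) /\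
  exists x y, 0 < y /\ forall j, g' j e 1I = x * Q j 0 + y * Q j 1.
Proof.
have [x x0 [x1 x2 x3]] := crd_end_flag phiX e.
have [y y0 [y1 y2 y3]] := crd_end_flag psiX e.
apply: (flag (l_end e) (rho_end e) x0 y0).
- by move=> j; rewrite (crd_end phiX).
- by move=> j; rewrite (crd_end psiX).
- by move=> j; have [->|[->|->]] := ord3_cases j.
- by move=> j; have [->|[->|->]] := ord3_cases j.
Qed.

Lemma blend : exists Phi : E -> curves R k, [/\ continuous Phi,
  forall e, XQ k Q (Phi e), forall e, u e = 0 -> Phi e = phi e &
  forall e, u e = 1 -> v e = 1 -> Phi e = psi e].
Proof.
exists (normalized g : E -> curves R k); split.
- exact: (normalized_continuous Jg g_neq0).
- move=> e; exact: (normalized_XQ SQ k2 dg dg' Jg g_neq0 g_det g_start g_end).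
- move=> e u0; apply/funext => t; apply/matrixP => i j; rewrite ord1 mxE.
  have gE m : g m e t = c 0%N m e t by rewrite /g u0 subr0 mul1r mul0r addr0.
  by rewrite !gE (sphere_crd phiX) sqrtr1 invr1 mul1r.
- move=> e u1 v1; apply/funext => t; apply/matrixP => i j; rewrite ord1 mxE.
  have lt : l e t = t by apply: val_inj; rewrite lE v1 subrr mul0r add0r mul1r.
  have gE m : g m e t = rho e t * b 0%N m e t.
    by rewrite /g u1 subrr mul0r add0r mul1r /scaled lt.
  rewrite !gE; have r0 := rho_gt0 e t.
  rewrite (_ : _ + _ = rho e t ^+ 2); last first.
    by rewrite -[RHS]mulr1 -(sphere_crd psiX e t); ring.
  by rewrite sqrtr_sqr gtr0_norm// mulrA mulVf ?mul1r// lt0r_neq0.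
Qed.

End Blend.

Section Homotopy.
Variables (R : realType) (E : topologicalType) (k : option nat) (Q : 'M[R]_3).
Variables phi psi : E -> curves R k.
Local Notation I := (unitI R).
Hypothesis SQ : SO3 Q.
Hypothesis k2 : le_order 2 k.
Hypothesis cphi : continuous phi.
Hypothesis phiX : forall e, XQ k Q (phi e).
Hypothesis arcs : forall e, arcP phi e.
Hypothesis cpsi : continuous psi.
Hypothesis psiX : forall e, XQ k Q (psi e).
Hypothesis arcs' : forall e, arcP psi e.

Lemma two_stage_blend (u v : E -> R) : continuous u -> continuous v ->
  (forall e, 0 <= u e <= 1) -> (forall e, 0 <= v e <= 1) -> (forall e, u e = 1 \/ v e = 0) ->
  exists Phi : E -> curves R k, [/\ continuous Phi,
  forall e, XQ k Q (Phi e), forall e, u e = 0 -> Phi e = phi e &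
  forall e, u e = 1 -> v e = 1 -> Phi e = psi e].
Proof.
move=> cu cv u01 v01 uv.
have [nu1 [nu2 [h [h' [rho [[pr cnu1 cnu2 rho0] [dh h'0 hends Jh] rends Jrho same]]]]]] :=
  matching SQ k2 cphi phiX arcs cpsi psiX arcs'.
have [rho' [drho [rho'' [drho' _]]]] := Jrho _ k2.
have [h1 [dh1 [h'' [dh1' _]]]] := Jh _ k2.
rewrite -(jder_uniq dh dh1) in dh1'.
(* With third coordinate 1, the third projected coordinate is identically zero, so equality of
   projections extends to all three indices. *)
pose nu (j : 'I_3) e := if j == 0 then nu1 e else if j == 1 then nu2 e else 1.
apply: (@blend R E k Q phi psi SQ k2 cphi phiX cpsi psiX nu h h' h'' rho rho' rho'') => //.
- move=> j; have [->|[->|->]] := ord3_cases j => //; move=> e; exact: for_continuous_cst.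
- move=> e t; have [P|[P|P]] := pr e t.
  + by exists 0; rewrite lt0r_neq0.
  + by exists 0; rewrite ltr0_neq0.
  + by exists 1.
- by move=> e; have [] := rends e.
- by move=> e; have [] := rends e.
- by move=> e; have [] := hends e.
- by move=> e; have [] := hends e.
- move=> j e t; have [A B] := same e t.
  have [->|[->|->]] := ord3_cases j; rewrite /nu /=.
  + by rewrite -A; ring.
  + by rewrite -B; ring.
  + by rewrite !mul1r !subrr.
Qed.

End Homotopy.

(** * The component of convex curves *)

Section Convex.
Variables (R : realType) (k : option nat) (Q : 'M[R]_3).
Hypothesis k2 : le_order 2 k.

Lemma XQc_arcP (E : topologicalType) (phi : E -> curves R k) (cphi : continuous phi)
    (phiX : forall e, XQ k Q (phi e)) e : XQc k Q (phi e) <-> arcP phi e.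
Proof.
split=> [[_ cvx]|arc]; first exact: (arcP_of_convex k2 cphi phiX).
by split=> //; exact: (convex_of_arcP k2 cphi phiX).
Qed.

(** [C] itself, with its inclusion, is taken as the family: [arcP] then cuts out a set that is open
    and closed in [C]. *)
Lemma connected_XQc (C : set (curves R k)) : connected C -> C `<=` XQ k Q ->
  C `&` XQc k Q !=set0 -> C `<=` XQc k Q.
Proof.
move=> conC CX nC; pose phi (x : set_type C) : curves R k := \val x.
have cphi : continuous phi by exact: initial_continuous.
have phiX e : XQ k Q (phi e) by apply: CX; exact: set_valP.
have oU : open [set e | arcP phi e].
  by rewrite openE => e Pe; exact: (arcP_open k2 cphi phiX Pe).
have cU : closed [set e | arcP phi e].
  by move=> e Pe; exact: (arcP_closed k2 cphi phiX Pe).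
have {}oU : exists2 V : set (curves R k), open V & C `&` XQc k Q = C `&` V.
  have [V oV VU] := oU; exists V => //.
  apply/seteqP; split=> x [Cx Px]; split=> //.
    have := (XQc_arcP cphi phiX (exist _ x (mem_set Cx))).1 Px.
    by rewrite -[arcP phi _]/([set e | arcP phi e] _) -VU.
  apply: (XQc_arcP cphi phiX (exist _ x (mem_set Cx))).2.
  by rewrite -[arcP phi _]/([set e | arcP phi e] _) -VU.
have {}cU : exists2 V : set (curves R k), closed V & C `&` XQc k Q = C `&` V.
  have /closed_openC[V oV VU] := cU; exists (~` V); first exact: open_closedC.
  apply/seteqP; split=> x [Cx Px]; split=> //.
    have arc := (XQc_arcP cphi phiX (exist _ x (mem_set Cx))).1 Px.
    move=> Vx; have : (phi @^-1` V) (exist _ x (mem_set Cx)) by [].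
    by rewrite VU; apply.
  apply: (XQc_arcP cphi phiX (exist _ x (mem_set Cx))).2.
  apply: contrapT => nP; apply: Px.
  by have : (~` [set e | arcP phi e]) (exist _ x (mem_set Cx)) by []; rewrite -VU.
by rewrite -(conC _ nC oU cU) => x [].
Qed.

Hypothesis SQ : SO3 Q.

Lemma convex_deformation (gamma : curves R k) : XQc k Q gamma ->
  exists Phi : unitI R * set_type (XQc k Q) -> curves R k,
  [/\ continuous Phi, forall p, XQc k Q (Phi p),
      forall x, Phi (t0 R, x) = \val x & forall x, Phi (t1 R, x) = gamma].
Proof.
move=> gX; pose A := XQc k Q.
pose E : topologicalType := (unitI R * set_type A)%type.
pose phi (p : E) : curves R k := \val p.2.
pose psi (p : E) : curves R k := gamma.
have cval : continuous (fun x : set_type A => \val x : curves R k) by exact: initial_continuous.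
have cphi : continuous phi.
  move=> p; apply: (@continuous_comp _ _ _ snd (fun x : set_type A => \val x : curves R k)).
    exact: for_continuous_snd.
  exact: cval.
have cpsi : continuous psi by move=> p; exact: for_continuous_cst.
have phiA e : XQc k Q (phi e) by exact: set_valP.
have phiX e : XQ k Q (phi e) by have [] := phiA e.
have psiX e : XQ k Q (psi e) by have [] := gX.
(* During the first half of the deformation [u] runs from 0 to 1 while [v] stays 0; during the
   second half [u] stays 1 and [v] runs. *)
pose u (p : E) : R := \val (clamp (2 * \val p.1)).
pose v (p : E) : R := \val (clamp (2 * \val p.1 - 1)).
have c1 (p : E) : {for p, continuous (fun p : E => \val p.1 : R)}.
  apply: (@continuous_comp _ _ _ fst (fun t : unitI R => \val t : R)).
    exact: for_continuous_fst.
  exact: val_unitI_continuous.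
have cc (f : E -> R) : continuous f -> continuous (fun p : E => \val (clamp (f p)) : R).
  move=> cf p; apply: (@continuous_comp _ _ _ f (fun x : R => \val (clamp x) : R)).
    exact: cf.
  exact: clampR_continuous.
have c2 : continuous (fun p : E => 2 * \val p.1 : R).
  move=> p; have K : {for p, continuous (fun _ : E => 2 : R)} by exact: for_continuous_cst.
  exact: (cvgM K (c1 p)).
have c3 : continuous (fun p : E => 2 * \val p.1 - 1 : R).
  move=> p; have K : {for p, continuous (fun _ : E => 1 : R)} by exact: for_continuous_cst.
  exact: (cvgB (c2 p) K).
have in01 (t : unitI R) : 0 <= (\val t : R) <= 1 by rewrite unitI_ge0 unitI_le1.
have uv p : u p = 1 \/ v p = 0.
  have [le1|lt1] := leP 1 (2 * \val p.1 : R); first by left; rewrite /u clamp_ge1.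
  by right; rewrite /v clamp_le0// subr_le0 ltW.
have [Phi [cPhi PhiX Phi0 Phi1]] := two_stage_blend SQ k2 cphi phiX
  (fun e => (XQc_arcP cphi phiX e).1 (phiA e)) cpsi psiX
  (fun e => (XQc_arcP cpsi psiX e).1 gX) (cc _ c2) (cc _ c3)
  (fun p => in01 _) (fun p => in01 _) uv.
have start x : Phi (t0 R, x) = \val x.
  by rewrite Phi0// /u /= mulr0 -[LHS]/(\val (clamp 0)) clamp0.
exists Phi; split=> //; last first.
  move=> x; apply: Phi1.
    by rewrite clamp_ge1//= mulr1 ler1n.
  by rewrite clamp_ge1//= mulr1 lerBrDr.
(* The track of a single curve is connected, lies in [XQ] and starts at a convex curve, so it is
   convex throughout. *)
move=> [s x]; apply: (@connected_XQc [set Phi (r, x) | r in [set: unitI R]]); last by exists s.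
- apply: connected_continuous_connected; first exact: unitI_connected.
  apply: continuous_subspaceT => r.
  apply: (@continuous_comp _ _ _ (fun r => (r, x)) Phi); last exact: cPhi.
  by apply: for_continuous_pair => //; exact: for_continuous_cst.
- by move=> _ [r _ <-]; exact: PhiX.
- by exists (\val x); split; [exists (t0 R)|exact: set_valP].
Qed.

Lemma XQc_contractible (gamma : curves R k) : XQc k Q gamma -> contractible R (XQc k Q).
Proof.
move=> gX; have [Phi [cPhi PhiX Phi0 Phi1]] := convex_deformation gX.
(* [contractible] wants a map on the whole product: time is clamped, and outside the convex curves
   an arbitrary default is used. *)
pose H (p : R * curves R k) : curves R k :=
  if pselect (XQc k Q p.2) is left Ap then Phi (clamp p.1, exist _ p.2 (mem_set Ap)) else p.2.
have HE s (x : set_type (XQc k Q)) : H (s, \val x) = Phi (clamp s, x).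
  rewrite /H; case: pselect => [Ax|[]]; last exact: set_valP.
  by congr (Phi (_, _)); exact: val_inj.
exists gamma, H; split=> //.
- apply/subspace_sigL_continuousP.
  rewrite (_ : sigL _ _ = Phi \o @setX_of_sigT R (curves R k) `[0, 1] (XQc k Q)).
    move=> w; apply: continuous_comp; last exact: cPhi.
    exact: (@setX_of_sigT_continuous).
  apply/funext => w; rewrite /sigL /=; set z := setX_of_sigT _ _ w.
  have -> : set_val w = (\val (z.1 : unitI R), \val z.2).
    by rewrite [LHS]surjective_pairing.
  by rewrite HE clamp_val -surjective_pairing.
- move=> s x _ Ax; have := HE s (exist _ x (mem_set Ax)); rewrite /= => ->; exact: PhiX.
- move=> x Ax; have := HE 0 (exist _ x (mem_set Ax)); rewrite /= => ->.
  by rewrite clamp0 Phi0.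
- move=> x Ax; have := HE 1 (exist _ x (mem_set Ax)); rewrite /= => ->.
  by rewrite clamp1 Phi1.
Qed.

(** The deformation joins each convex curve to [gamma] by a path in [XQ]; conversely [connected_XQc]
    keeps every connected set through [gamma] inside the convex curves. *)
Lemma XQc_component (gamma : curves R k) : XQc k Q gamma ->
  XQc k Q = connected_component (XQ k Q) gamma.
Proof.
move=> gX; apply/seteqP; split=> [x Ax|x [C [Cg CX conC] Cx]]; last first.
  by apply: (connected_XQc conC CX) => //; exists gamma.
have [Phi [cPhi PhiX Phi0 Phi1]] := convex_deformation gX.
pose x' : set_type (XQc k Q) := exist _ x (mem_set Ax).
apply: (@connected_component_max _ _ [set Phi (r, x') | r in [set: unitI R]]).
- by exists (t1 R).
- by move=> _ [r _ <-]; have [] := PhiX (r, x').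
- apply: connected_continuous_connected; first exact: unitI_connected.
  apply: continuous_subspaceT => r.
  apply: (@continuous_comp _ _ _ (fun r => (r, x')) Phi); last exact: cPhi.
  by apply: for_continuous_pair => //; exact: for_continuous_cst.
- by exists (t0 R) => //; rewrite Phi0.
Qed.

End Convex.

Theorem theorem6 (R : realType) (k : option nat) (Q : 'M[R]_3) :
  le_order 2 k -> SO3 Q ->
  XQc k Q = set0 \/
  ((exists2 gamma : curves R k, XQ k Q gamma &
      XQc k Q = connected_component (XQ k Q) gamma) /\
   contractible R (XQc k Q)).
Proof.
move=> k2 SQ; have [->|/set0P[gamma gX]] := eqVneq (XQc k Q) set0; [by left|right].
split; last exact: XQc_contractible gX.
by exists gamma; [case: gX|exact: XQc_component].
Qed.
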